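(* Let $\mathcal X=\prod_{i=1}^m\mathcal X_i$, where each $\mathcal X_i\subset\mathbb R^{n_i}$ is either the unit ball $B_{n_i}$ or the standard simplex $\Delta_{n_i}$, and let $n=\sum_in_i$. Equip $\mathcal X$ with the reference measure $\mu=\otimes_{i=1}^m\mu_i$, where $\mu_i$ is the probability measure on $\mathcal X_i$ proportional to $(1-\|\mathbf x\|^2)^{-1/2}d\mathbf x$ if $\mathcal X_i=B_{n_i}$, and to $(1-\sum_jx_j)^{-1/2}\prod_jx_j^{-1/2}d\mathbf x$ if $\mathcal X_i=\Delta_{n_i}$. If $y^{(i)}=(y^{(i)}_{\alpha})_{\alpha\in\mathbb N^{n_i}}$ denotes the moment sequence of $\mu_i$, then the moment sequence $y=(y_\alpha)_{\alpha\in\mathbb N^n}$ of $\mu$ is given by $y_\alpha=\prod_{i=1}^my^{(i)}_{\alpha^{(i)}}$ for $\alpha=(\alpha^{(1)},\dots,\alpha^{(m)})$, $\alpha^{(i)}\in\mathbb N^{n_i}$. Moreover, let $f\in\mathbb R[\mathbf x]$ have degree $k$ and let $f_{\min}=\min_{\mathcal X}f$. Then for every integer $r>2(\max\{n_1,\dots,n_m\}+1)k$, $$\mathrm{ub}(f,\mathcal T(\mathcal X))_{mr}-f_{\min}\le\binom{k+m-1}{m-1}\Bigl(\sum_{i=1}^mc(n_i,k)\Bigr)\frac{\Lambda(\mathcal X,k)\,\|f\|_{\mathcal X}}{r^2}.$$ Consequently, the convergence rate of the Schmüdgen-type hierarchy of upper bounds over $\mathcal X$ is $O(1/r^2)$.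
   Context: Notation: $\lceil g\rceil=\lceil(\deg g)/2\rceil$; $\Sigma[\mathbf x]_{2s}$ = sums of squares of degree $\le2s$; $\|p\|_{\mathcal X}=\max_{\mathcal X}|p|$; $B_N$ is the closed unit ball of $\mathbb R^N$, described by $1-\|\mathbf x\|^2\ge0$; $\Delta_N=\{\mathbf x\in\mathbb R^N:x_j\ge0\ \forall j,\ 1-\sum_jx_j\ge0\}$; $\mathcal X$ is described by the list $(g_j)_{j\in I}$ of all inequalities of its factors. For $J\subset I$, $g_J=\prod_{j\in J}g_j$, $g_\emptyset=1$. $\mathcal T(\mathcal X)_{2r}=\{\sum_{J\subset I,\lceil g_J\rceil\le r}\sigma_Jg_J:\sigma_J\in\Sigma[\mathbf x]_{2(r-\lceil g_J\rceil)}\}$. The Schmüdgen-type upper bound is $\mathrm{ub}(f,\mathcal T(\mathcal X))_r=\inf\{\int_{\mathcal X}fq\,d\mu: q\in\mathcal T(\mathcal X)_{2r},\ \int_{\mathcal X}q\,d\mu=1\}$. Constants: $c(N,k)=2(N+1)^2k^2$. The harmonic constant $\Lambda(\mathcal X,k)$: let $\{P^{(i)}_\alpha:\alpha\in\mathbb N^{n_i}\}$ be an orthonormal polynomial basis for $\mu_i$ with $\deg P^{(i)}_\alpha=|\alpha|$ and $\{P^{(i)}_\alpha:|\alpha|\le q\}$ spanning polynomials of degree $\le q$ for all $q$; let $S_{j_1,\dots,j_m}=\mathrm{span}\{\prod_iP^{(i)}_{\alpha_i}(\mathbf x^{(i)}):|\alpha_i|=j_i\}$; each $p\in\mathbb R[\mathbf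 x]$ of degree $\le k$ decomposes uniquely as $\sum_{j_1+\dots+j_m\le k}p_{j_1,\dots,j_m}$ with $p_{j_1,\dots,j_m}\in S_{j_1,\dots,j_m}$; $\Lambda(\mathcal X,k)=\max_{0\ne p,\ \deg p\le k}\ \max_{j_1+\dots+j_m\le k}\|p_{j_1,\dots,j_m}\|_{\mathcal X}/\|p\|_{\mathcal X}$. *)

(* Defs.v *)
From HB Require Import structures.
From mathcomp Require Import all_boot all_order all_algebra.
(* mpoly comes first so that [isMeasure], [Measure] etc. refer to measure
   theory; its notations clash with those of MathComp-Analysis. *)
From mathcomp.multinomials Require Import -(notations) mpoly.
From mathcomp Require Import all_classical all_reals all_analysis.
From mathcomp Require Import measurable_realfun.

Set Implicit Arguments.
Unset Strict Implicit.
Unset Printing Implicit Defensive.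

Import Order.TTheory GRing.Theory Num.Theory numFieldNormedType.Exports.

Local Open Scope classical_set_scope.
Local Open Scope ring_scope.

Notation "{ 'mpoly' T [ n ] }" := (mpoly n T) : type_scope.
Notation "p .@[ v ]" := (meval v p) : ring_scope.
Notation msize p := (mmeasure mdeg p).

(** * Lebesgue measure on R^N, represented as [N.-tuple R] *)

Section Lebesgue.
Context (R : realType).

Section Step.
Variables (N : nat) (nu : {sigma_finite_measure set (N.-tuple R) -> \bar R}).

Definition cons_pt (z : measurableTypeR R * N.-tuple R) : N.+1.-tuple R :=
  [the N.+1.-tuple R of (z.1 : R) :: z.2].

Lemma measurable_cons_pt : measurable_fun [set: _] cons_pt.
Proof. exact: measurable_cons. Qed.

HB.instance Definition _ := isMeasurableFun.Build _ _ _ _ cons_pt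
  measurable_cons_pt.

Definition lebesgue_cons : set (N.+1.-tuple R) -> \bar R :=
  pushforward (@lebesgue_measure R \x nu)%E cons_pt.

Let lebesgue_cons0 : lebesgue_cons set0 = 0%E.
Proof. exact: measure0. Qed.

Let lebesgue_cons_ge0 A : (0 <= lebesgue_cons A)%E.
Proof. exact: measure_ge0. Qed.

Let lebesgue_cons_sigma_additive : semi_sigma_additive lebesgue_cons.
Proof. exact: measure_semi_sigma_additive. Qed.

HB.instance Definition _ := isMeasure.Build _ _ _ lebesgue_cons
  lebesgue_cons0 lebesgue_cons_ge0 lebesgue_cons_sigma_additive.

Let lebesgue_cons_sigma_finite : sigma_finite setT lebesgue_cons.
Proof.
have [F TF Foo] : sigma_finite setT (@lebesgue_measure R \x nu)%E.
  have /sigma_finiteP[F [TF ndF Foo]] := sigma_finiteT (@lebesgue_measure R).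
  have /sigma_finiteP[G [TG ndG Goo]] := sigma_finiteT nu.
  exists (fun k => F k `*` G k).
    apply/esym; rewrite -subTset => -[x y] _.
    have [k _ Fx] : (\bigcup_k F k) x by rewrite -TF.
    have [l _ Gy] : (\bigcup_k G k) y by rewrite -TG.
    exists (maxn k l) => //; split.
    - by move: x Fx; exact/subsetPset/ndF/leq_maxl.
    - by move: y Gy; exact/subsetPset/ndG/leq_maxr.
  move=> k; have [? ?] := Foo k; have [? ?] := Goo k.
  split; first exact: measurableX.
  by rewrite product_measure1E// lte_mul_pinfty// ge0_fin_numE.
pose g (t : N.+1.-tuple R) : measurableTypeR R * N.-tuple R :=
  (thead t, [tuple of behead t]).
have mg : measurable_fun [set: _] g.
  apply/measurable_fun_pairP; split; first exact: measurable_tnth.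
  exact: measurable_behead.
exists (fun k => g @^-1` F k).
  by rewrite -preimage_bigcup -TF preimage_setT.
move=> k; have [mF Fk] := Foo k; split.
  by rewrite -[X in measurable X]setTI; exact: mg.
suff -> : lebesgue_cons (g @^-1` F k) = (@lebesgue_measure R \x nu)%E (F k).
  by [].
rewrite /lebesgue_cons /pushforward -comp_preimage.
rewrite (_ : g \o cons_pt = id) ?preimage_id//.
apply/funext => -[x y]/=; rewrite /g /cons_pt/= theadE; congr (_, _).
exact/val_inj.
Qed.

HB.instance Definition _ := Measure_isSigmaFinite.Build _ _ _ lebesgue_cons
  lebesgue_cons_sigma_finite.

End Step.

Fixpoint lebesgue (N : nat) :
    {sigma_finite_measure set (N.-tuple R) -> \bar R} :=
  match N with
  | 0 => dirac [tuple]
  | N'.+1 => lebesgue_cons (lebesgue N')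
  end.

End Lebesgue.

(** * Blocks of coordinates and product of probability measures *)

(* R^n with n = \sum_i n_ i is cut into consecutive blocks; [tagnat.Rank i j] is
   the index in 'I_(\sum_i n_ i) of the j-th coordinate of the i-th block. *)

Section Blocks.
Context (m : nat) (n_ : 'I_m -> nat).

Definition point_block T (i : 'I_m) (x : (\sum_i n_ i).-tuple T) :
    (n_ i).-tuple T :=
  [tuple tnth x (tagnat.Rank i j) | j < n_ i].

Definition mnm_block (i : 'I_m) (a : multinom (\sum_i n_ i)) :
    multinom (n_ i) :=
  Multinom [tuple a (tagnat.Rank i j) | j < n_ i].

(* p(x^(i)) as a polynomial in x *)
Definition poly_block (R : realType) (i : 'I_m) (p : {mpoly R[n_ i]}) :
    {mpoly R[\sum_i n_ i]} :=
  comp_mpoly [tuple mpolyX R (mnm1 (tagnat.Rank i j)) | j < n_ i] p.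

End Blocks.
Arguments poly_block {m n_ R} i p.

Section ProductProbability.
Context (R : realType).

Section Step.
Variables (m : nat) (n_ : 'I_m.+1 -> nat).
Local Notation n' := (\sum_(i < m) n_ (lift ord0 i))%N.

Definition glue (z : (n_ ord0).-tuple R * n'.-tuple R) :
    (\sum_i n_ i).-tuple R :=
  tcast (esym (big_ord_recl m n_)) [tuple of z.1 ++ z.2].

Lemma measurable_glue : measurable_fun [set: _] glue.
Proof.
apply/measurable_fun_tnthP => k.
pose k' : 'I_(n_ ord0 + n') := cast_ord (big_ord_recl m n_) k.
rewrite (_ : _ \o _ = fun z : (n_ ord0).-tuple R * n'.-tuple R =>
    tnth [tuple of z.1 ++ z.2] k'); last first.
  by apply/funext => z /=; rewrite /glue tcastE esymK.
have [j ->|j ->] := split_ordP k'.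
- rewrite (_ : (fun _ => _) = fun z => tnth z.1 j); last first.
    by apply/funext => z; rewrite (tnth_lshift z.1 z.2).
  exact: (measurableT_comp (measurable_tnth j)).
- rewrite (_ : (fun _ => _) = fun z => tnth z.2 j); last first.
    by apply/funext => z; rewrite (tnth_rshift z.1 z.2).
  exact: (measurableT_comp (measurable_tnth j)).
Qed.

HB.instance Definition _ := isMeasurableFun.Build _ _ _ _ glue measurable_glue.

Variable P : probability ((n_ ord0).-tuple R) R.
Variable Q : probability (n'.-tuple R) R.

Definition glue_prob : set ((\sum_i n_ i).-tuple R) -> \bar R :=
  pushforward (P \x Q)%E glue.

Let glue_prob0 : glue_prob set0 = 0%E.
Proof. exact: measure0. Qed.

Let glue_prob_ge0 A : (0 <= glue_prob A)%E.
Proof. exact: measure_ge0. Qed.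

Let glue_prob_sigma_additive : semi_sigma_additive glue_prob.
Proof. exact: measure_semi_sigma_additive. Qed.

HB.instance Definition _ := isMeasure.Build _ _ _ glue_prob
  glue_prob0 glue_prob_ge0 glue_prob_sigma_additive.

Let glue_prob_setT : glue_prob [set: _] = 1%E.
Proof.
rewrite /glue_prob /pushforward preimage_setT -setXTT product_measure1E//.
rewrite [X in (X * _)%E](probability_setT P).
by rewrite [X in (_ * X)%E](probability_setT Q) mule1.
Qed.

HB.instance Definition _ := Measure_isProbability.Build _ _ _ glue_prob
  glue_prob_setT.

End Step.

Fixpoint prod_prob m : forall n_ : 'I_m -> nat,
    (forall i, probability ((n_ i).-tuple R) R) ->
    probability ((\sum_i n_ i).-tuple R) R :=
  match m with
  | 0 => fun n_ _ => @dirac _ ((\sum_i n_ i).-tuple R) [tuple 0 | _ < _] R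
  | m'.+1 => fun n_ P =>
      glue_prob (P ord0) (prod_prob (fun i => P (lift ord0 i)))
  end.

Lemma point_block_glue0 m (n_ : 'I_m.+1 -> nat)
    (z : (n_ ord0).-tuple R * (\sum_(i < m) n_ (lift ord0 i)).-tuple R) :
  point_block ord0 (glue (n_ := n_) z) = z.1.
Proof.
apply: eq_from_tnth => j; rewrite tnth_mktuple /glue tcastE esymK.
rewrite -(tnth_lshift z.1 z.2); congr tnth; apply/val_inj => /=.
by rewrite [LHS](@tagnat.RankEsum _ n_ ord0 j) big_pred0.
Qed.

Lemma point_block_glueS m (n_ : 'I_m.+1 -> nat)
    (z : (n_ ord0).-tuple R * (\sum_(i < m) n_ (lift ord0 i)).-tuple R)
    (i : 'I_m) :
  point_block (lift ord0 i) (glue (n_ := n_) z) =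
  point_block (n_ := fun i => n_ (lift ord0 i)) i z.2.
Proof.
apply: eq_from_tnth => j; rewrite !tnth_mktuple /glue tcastE esymK.
rewrite -(tnth_rshift z.1 z.2); congr tnth; apply/val_inj => /=.
rewrite [LHS](@tagnat.RankEsum _ n_ (lift ord0 i) j).
rewrite [X in _ = (_ + X)%N]
  (@tagnat.RankEsum _ (fun i => n_ (lift ord0 i)) i j).
by rewrite big_mkcond big_ord_recl -big_mkcond/= -addnA.
Qed.

(* [prod_prob P] is the product of the P_i. *)
Lemma prod_probE m (n_ : 'I_m -> nat)
    (P : forall i, probability ((n_ i).-tuple R) R)
    (A : forall i, set ((n_ i).-tuple R)) :
  (forall i, measurable (A i)) ->
  prod_prob P [set x | forall i, A i (point_block i x)] = (\prod_i P i (A i))%E.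
Proof.
elim: m n_ P A => [|m ih] n_ P A mA.
  by rewrite [RHS]big_ord0 /= diracE mem_set// => -[].
pose nS i := n_ (lift ord0 i).
rewrite [RHS]big_ord_recl.
rewrite -(ih nS (fun i => P (lift ord0 i)) (fun i => A (lift ord0 i)))//=;
  last first.
  by move=> i; exact: mA.
have mA0 := mA ord0.
rewrite -product_measure1E//; last first.
  rewrite (_ : mkset _ = \bigcap_(i in [set: 'I_m])
    (point_block (n_ := nS) i @^-1` A (lift ord0 i))); last first.
    by apply/seteqP; split => [x Ax i _|x Ax i]; [exact: Ax|exact: (Ax i I)].
  apply: fin_bigcap_measurable => // i _.
  rewrite -[X in measurable X]setTI.
  suff mB : measurable_fun [set: _] (@point_block _ nS R i).
    by apply: mB => //; exact: mA.
  apply/measurable_fun_tnthP => j.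
  rewrite (_ : _ \o _ = fun x => tnth x (tagnat.Rank i j)).
    exact: measurable_tnth.
  by apply/funext => x; rewrite /= /point_block tnth_mktuple.
rewrite /glue_prob /pushforward; congr (_ _).
apply/seteqP; split => z /=.
- move=> Az; split.
    by have := Az ord0; rewrite point_block_glue0.
  by move=> i; have := Az (lift ord0 i); rewrite point_block_glueS.
- move=> [Az0 Az] i; have [j ->|->] := unliftP ord0 i.
    by rewrite point_block_glueS.
  by rewrite point_block_glue0.
Qed.

End ProductProbability.

(** * Balls and simplices with their reference probability measures *)

Inductive body_kind := Ball | Simplex.

Section Body.
Context (R : realType).

Definition body (s : body_kind) N : set (N.-tuple R) :=
  match s with
  | Ball => [set x | \sum_j tnth x j ^+ 2 <= 1]
  | Simplex => [set x | (forall j, 0 <= tnth x j) /\ \sum_j tnth x j <= 1]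
  end.

Arguments body s N : clear implicits.

Definition constraints (s : body_kind) N : seq {mpoly R[N]} :=
  let X j := mpolyX R (mnm1 j) in
  match s with
  | Ball => [:: 1 - \sum_(j < N) X j ^+ 2]
  | Simplex => rcons [seq X j | j <- enum 'I_N] (1 - \sum_(j < N) X j)
  end.

Definition weight (s : body_kind) N (x : N.-tuple R) : R :=
  match s with
  | Ball => (1 - \sum_j tnth x j ^+ 2) `^ (- 2^-1)
  | Simplex => (1 - \sum_j tnth x j) `^ (- 2^-1) * \prod_j tnth x j `^ (- 2^-1)
  end.

Lemma measurable_body s N : measurable (body s N).
Proof.
have mt j : measurable_fun [set: N.-tuple R] (fun x => tnth x j).
  exact: measurable_tnth.
have mle (f : N.-tuple R -> R) (c : R) : measurable_fun [set: _] f ->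
    measurable [set x | f x <= c].
  move=> mf; have := mf measurableT _ (measurable_itv `]-oo, c]); rewrite setTI.
  by congr measurable; apply/seteqP; split => x; rewrite /= in_itv.
have mge (f : N.-tuple R -> R) (c : R) : measurable_fun [set: _] f ->
    measurable [set x | c <= f x].
  move=> mf; have := mf measurableT _ (measurable_itv `[c, +oo[); rewrite setTI.
  by congr measurable; apply/seteqP; split => x; rewrite /= in_itv/= andbT.
case: s => /=.
  by apply: mle; apply: measurable_sum => j; exact: measurable_funX.
apply: measurableI; last by apply: mle; exact: measurable_sum.
rewrite [X in measurable X]
  (_ : _ = \bigcap_(j in [set: 'I_N]) [set x | 0 <= tnth x j]).
  by apply: fin_bigcap_measurable => // j _; exact: mge.
by apply/seteqP; split => [x Ax i _|x Ax i]; [exact: Ax|exact: (Ax i I)].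
Qed.

Lemma measurable_weight s N : measurable_fun [set: _] (@weight s N).
Proof.
have mt j : measurable_fun [set: N.-tuple R] (fun x => tnth x j).
  exact: measurable_tnth.
have mp (f : N.-tuple R -> R) : measurable_fun [set: _] f ->
    measurable_fun [set: _] (fun x => f x `^ (- 2^-1)).
  by move=> mf; exact: (measurableT_comp (measurable_powR (- 2^-1))).
case: s => /=.
  apply: mp; apply: measurable_funB => //.
  by apply: measurable_sum => j; exact: measurable_funX.
apply: measurable_funM.
  by apply: mp; apply: measurable_funB => //; exact: measurable_sum.
by apply: measurable_prod => j _; exact: mp.
Qed.

Lemma weight_ge0 s N (x : N.-tuple R) : 0 <= weight s x.
Proof.
case: s => /=; first exact: powR_ge0.
by rewrite mulr_ge0 ?powR_ge0// prodr_ge0// => j _; exact: powR_ge0.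
Qed.

Section Weighted.
Variables (s : body_kind) (N : nat).

Definition weighted_lebesgue : set (N.-tuple R) -> \bar R :=
  fun A => (\int[lebesgue R N]_(x in body s N `&` A) (weight s x)%:E)%E.

Let weighted0 : weighted_lebesgue set0 = 0%E.
Proof. by rewrite /weighted_lebesgue setI0 integral_set0. Qed.

Let weighted_ge0 A : (0 <= weighted_lebesgue A)%E.
Proof. by apply: integral_ge0 => x _; rewrite lee_fin weight_ge0. Qed.

Let weighted_sigma_additive : semi_sigma_additive weighted_lebesgue.
Proof.
move=> F mF tF mUF; rewrite /weighted_lebesgue setI_bigcupr.
apply: cvg_toP.
  apply: ereal_nondecreasing_is_cvgn => k l kl.
  by apply: lee_sum_nneg_natr => // i _ _; exact: weighted_ge0.
rewrite ge0_integral_bigcup//=.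
- by move=> k; apply: measurableI => //; exact: measurable_body.
- apply: measurable_funTS; apply/measurable_EFinP; exact: measurable_weight.
- by move=> x _; rewrite lee_fin weight_ge0.
- exact: trivIset_setIl.
Qed.

HB.instance Definition _ := isMeasure.Build _ _ _ weighted_lebesgue
  weighted0 weighted_ge0 weighted_sigma_additive.

(* [mnormalize nu P] is nu / nu(R^N); the total mass of [weighted_lebesgue] is
   positive and finite, so that the default value P is irrelevant. On the
   boundary of the body, [weight] takes the value 0 instead of +oo; this is a
   null set. *)
Definition ref_prob : probability (N.-tuple R) R :=
  mnormalize weighted_lebesgue (@dirac _ (N.-tuple R) [tuple 0 | _ < N] R).

End Weighted.
End Body.
Arguments body {R} s N _.
Arguments constraints R s N : clear implicits.
Arguments ref_prob R s N : clear implicits.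

(** * Polynomials on R^N *)

Section Polynomials.
Context (R : realType) (N : nat).
Implicit Types (D : set (N.-tuple R)) (p q f : {mpoly R[N]}).

(* Total degree, with the convention deg 0 = 0 *)
Definition pdeg p : nat := (msize p).-1.

(* ceil((deg g) / 2) *)
Definition half_deg p : nat := uphalf (pdeg p).

Definition peval p (x : N.-tuple R) : R := p.@[tnth x].

Definition monom (a : multinom N) (x : N.-tuple R) : R :=
  \prod_j tnth x j ^+ a j.

(* Used for compact D only, so that sup and inf are a max and a min *)
Definition sup_norm D p : R := sup [set `|peval p x| | x in D].

Definition min_on D p : R := inf [set peval p x | x in D].

Definition moment (mu : {measure set (N.-tuple R) -> \bar R})
    (D : set (N.-tuple R)) (a : multinom N) : R :=
  \int[mu]_(x in D) monom a x.

Definition sos (t : nat) p : Prop :=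
  (pdeg p <= t)%N /\ exists s : seq {mpoly R[N]}, p = \sum_(h <- s) h ^+ 2.

Definition prod_constraints (g : seq {mpoly R[N]}) (J : {set 'I_(size g)}) :=
  \prod_(j in J) g`_j.

(* The truncated preordering T(X)_{2r}, X being described by the list g *)
Definition preordering (g : seq {mpoly R[N]}) (r : nat) : set {mpoly R[N]} :=
  [set q | exists sigma : {set 'I_(size g)} -> {mpoly R[N]},
    (forall J, (half_deg (prod_constraints J) <= r)%N ->
      sos (2 * (r - half_deg (prod_constraints J))) (sigma J)) /\
    q = \sum_(J | (half_deg (prod_constraints J) <= r)%N)
          sigma J * prod_constraints J].

Definition ub (mu : {measure set (N.-tuple R) -> \bar R}) D
    (g : seq {mpoly R[N]}) f (r : nat) : R :=
  inf [set \int[mu]_(x in D) (peval f x * peval q x) |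
       q in preordering g r `&` [set q | \int[mu]_(x in D) peval q x = 1]].

(* The elements of degree <= t span the polynomials of degree <= t; the converse
   inclusion follows from the second clause. *)
Definition orthonormal_basis (mu : {measure set (N.-tuple R) -> \bar R}) D
    (P : multinom N -> {mpoly R[N]}) : Prop :=
  [/\ forall a b,
        \int[mu]_(x in D) (peval (P a) x * peval (P b) x) = (a == b)%:R,
      forall a, pdeg (P a) = mdeg a
    & forall t p, (pdeg p <= t)%N ->
        exists c : multinom N -> R, p = \sum_(a : bmultinom N t.+1) c a *: P a].

End Polynomials.

(** * The product X of the bodies X_i *)

Section Product.
Context (R : realType) (m : nat) (s : 'I_m -> body_kind) (n_ : 'I_m -> nat).
Local Notation n := (\sum_i n_ i)%N.

Definition prod_body : set (n.-tuple R) :=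
  [set x | forall i, body (s i) (n_ i) (point_block i x)].

Definition prod_ref : probability (n.-tuple R) R :=
  prod_prob (fun i => ref_prob R (s i) (n_ i)).

Definition all_constraints : seq {mpoly R[n]} :=
  flatten [seq [seq poly_block i g | g <- constraints R (s i) (n_ i)] |
           i <- enum 'I_m].

Section Harmonic.
Variable P : forall i, multinom (n_ i) -> {mpoly R[n_ i]}.
Implicit Types (j : multinom m) (p : {mpoly R[n]}).

Definition prod_basis (a : multinom n) : {mpoly R[n]} :=
  \prod_i poly_block i (P (mnm_block i a)).

(* S_{j_1, ..., j_m}; all the multi-indices a involved have degree \sum_i j_i *)
Definition harmonic_space j : set {mpoly R[n]} :=
  [set p | exists c : multinom n -> R,
     p = \sum_(a : bmultinom n (mdeg j).+1 |
               [forall i, mdeg (mnm_block i a) == j i]) c a *: prod_basis a].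

(* Only the values of d on multi-indices of degree <= k matter. *)
Definition harmonic_decomposition (k : nat) p
    (d : multinom m -> {mpoly R[n]}) :=
  (forall j, (mdeg j <= k)%N -> harmonic_space j (d j)) /\
  p = \sum_(j : bmultinom m k.+1) d j.

(* The components are unique, hence the quantification over decompositions is
   the maximum over p and j; it is a maximum by finite-dimensionality. *)
Definition harmonic_constant (k : nat) : R :=
  sup [set t | exists p d j,
    [/\ p != 0, (pdeg p <= k)%N, harmonic_decomposition k p d, (mdeg j <= k)%N
      & t = sup_norm prod_body (d j) / sup_norm prod_body p]].

End Harmonic.
End Product.
Arguments prod_body R {m} s n_ _.

(* c(N, k) *)
Definition c_const (N k : nat) : nat := 2 * N.+1 ^ 2 * k ^ 2.

(* Main.v *)
(* The density is a product of densities q_i of the blocks x^(i), chosen one block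
   after the other: integrating out the blocks already treated leaves a polynomial of
   degree <= k which is still bounded by ||f||, and each block costs an error of at
   most 2 (n_i + 1)^2 k^2 ||f|| / r^2. The binomial coefficient and the harmonic
   constant only enter by being at least 1.

   For a ball of dimension N, lift the reference measure to the uniform measure of
   the sphere S^N. On the great circle through the lifts of x and of a minimizer, f
   is a trigonometric polynomial of degree k, and a Markov inequality on the circle
   gives f(x) - min f <= 2 k^2 ||f|| (1 - tau), where tau is the scalar product of
   the two lifts. A univariate s of degree r, built from Gegenbauer polynomials, makes
   the integral of (1 - tau) s(tau)^2 at most (N + 1)^2 / r^2 times that of s(tau)^2.
   The mean of s(tau)^2 over the two lifts of x is A(x)^2 + (1 - |x|^2) B(x)^2.

   The simplex is the image of the ball under x_j -> x_j^2; sorting the monomials of A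
   by the parity of their exponents turns A^2 into a sum of x^J A_J(x)^2. *)
Require Import Defs.
From mathcomp Require Import all_boot all_order all_algebra.
From mathcomp.multinomials Require Import -(notations) mpoly.
From mathcomp Require Import all_classical all_reals all_analysis.
From mathcomp Require Import measurable_realfun ring lra zify.
Import Order.TTheory GRing.Theory Num.Theory numFieldNormedType.Exports.
Local Open Scope classical_set_scope.
Local Open Scope ring_scope.

Set Implicit Arguments.
Unset Strict Implicit.
Unset Printing Implicit Defensive.

(** * Integration of derivatives on open intervals *)

Section ImproperFTC.
Context (R : realType).
Local Notation mu := (@lebesgue_measure R).

(** Measures are compared through moments alone. In the coordinates [x_j ^+ 2] for the ball and
    [x_j] for the simplex, both reference measures are the Dirichlet law whose [N.+1] parameters all
    equal 1/2, the slack being the last coordinate. The exponent -1/2 of the weight gives the slack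
    the same parameter as the other coordinates: this is why the lift of the ball is uniform on the
    sphere, and why squaring the coordinates carries the ball to the simplex. Rotation invariance
    enters as a recursion for the moments of a unit linear form, the same for every direction, so
    the univariate kernel is built for an abstract linear functional on polynomials. Minimizers are
    replaced by points within [delta] of the infimum, and [delta] tends to 0 at the very end. Since
    [sup] and [inf] return a default value on empty or unbounded sets, nonemptiness and boundedness
    have to be proved before the hierarchy or the harmonic constant can be estimated. *)

Lemma bigcup_itvcc_oo (a b : R) : a < b ->
  \bigcup_n `[a + (b - a) / n.+3%:R, b - (b - a) / n.+3%:R]%classic =
  `]a, b[%classic.
Proof.
move=> ab; apply/seteqP; split => x /=.
  move=> [n _] /=; rewrite !in_itv/= => /andP[ax xb].
  have : 0 < (b - a) / n.+3%:R by rewrite divr_gt0// subr_gt0.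
  by move: ((b - a) / n.+3%:R) ax xb => e ax xb e0; apply/andP; split; lra.
rewrite in_itv/= => /andP[ax xb].
pose d := Num.min (x - a) (b - x).
have d0 : 0 < d by rewrite lt_min !subr_gt0 ax xb.
pose n := Num.truncn ((b - a) / d).
have nd : (b - a) / n.+3%:R <= d.
  rewrite ler_pdivrMr// mulrC -ler_pdivrMr//.
  apply: ltW; apply: (lt_le_trans (truncnS_gt _)).
  by rewrite ler_nat; apply: leq_trans (leqnSn _) (leqnSn _).
exists n => //=; rewrite in_itv/=.
move: nd; rewrite le_min; move: ((b - a) / n.+3%:R) => e /andP[h1 h2].
by apply/andP; split; lra.
Qed.

(* [F' = f1 - f2] with [f1, f2 >= 0] possibly unbounded near the endpoints;
   both integrals may a priori be infinite. *)
Lemma FTC_oo (F f1 f2 : R -> R) (a b la lb : R) : a < b ->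
  {in `]a, b[, forall x, 0 <= f1 x} -> {in `]a, b[, forall x, 0 <= f2 x} ->
  {in `]a, b[, continuous f1} -> {in `]a, b[, continuous f2} ->
  {in `]a, b[, forall x : R, is_derive x 1 F (f1 x - f2 x)} ->
  F x @[x --> a^'+] --> la -> F x @[x --> b^'-] --> lb ->
  (\int[mu]_(x in `]a, b[) (f1 x)%:E =
   \int[mu]_(x in `]a, b[) (f2 x)%:E + (lb - la)%:E)%E.
Proof.
move=> ab f10 f20 cf1 cf2 dF Fa Fb.
(* The offset is at most a third of the length, so the compact intervals are nondegenerate for every
   [n]. *)
pose an n : R := a + (b - a) / n.+3%:R.
pose bn n : R := b - (b - a) / n.+3%:R.
have e0 n : 0 < (b - a) / n.+3%:R by rewrite divr_gt0// subr_gt0.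
have e3 n : (b - a) / n.+3%:R <= (b - a) / 3.
  by rewrite ler_pM2l ?subr_gt0// lef_pV2 ?posrE// ler_nat.
have aan n : a < an n by rewrite /an ltrDl.
have bbn n : bn n < b by rewrite /bn ltrBlDr ltrDl.
have abn n : an n < bn n.
  rewrite /an /bn; have := e3 n; have := e0 n.
  by move: ((b - a) / n.+3%:R) => e; lra.
have cc_oo n x : x \in `[an n, bn n] -> x \in `]a, b[.
  rewrite !in_itv/= => /andP[h1 h2]; apply/andP; split.
    exact: lt_le_trans (aan n) h1.
  exact: le_lt_trans h2 (bbn n).
have oo_bigcup : `]a, b[%classic = \bigcup_n `[an n, bn n]%classic.
  by rewrite bigcup_itvcc_oo.
have wc (f : R -> R) n : {in `]a, b[, continuous f} -> {within `[an n, bn n], continuous f}.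
  move=> cf; apply: continuous_in_subspaceT => x.
  by rewrite inE => /cc_oo; exact: cf.
have mf (f : R -> R) n : {in `]a, b[, continuous f} ->
    measurable_fun `[an n, bn n] (EFin \o f).
  move=> cf; apply/measurable_EFinP.
  by apply: subspace_continuous_measurable_fun => //; exact: wc.
(* On a compact subinterval both integrals are finite, so the usual fundamental theorem can be
   rearranged without subtracting infinities. The rearranged identity survives the monotone limit
   even if both sides become infinite. *)
have key n : (\int[mu]_(x in `[an n, bn n]) (f1 x)%:E =
   \int[mu]_(x in `[an n, bn n]) (f2 x)%:E + (F (bn n) - F (an n))%:E)%E.
  have Fn : (\int[mu]_(x in `[an n, bn n]) (f1 x - f2 x)%:E =
             (F (bn n))%:E - (F (an n))%:E)%E.
    apply: continuous_FTC2 => //.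
    - apply: wc => x xab; apply: continuousB; [exact: cf1|exact: cf2].
    - have dFx x : x \in `[an n, bn n] -> derivable F x 1.
        by move=> /cc_oo/dF [].
      have cFx x : x \in `[an n, bn n] -> F y @[y --> x] --> F x.
        by move=> /dFx /derivable1_diffP /differentiable_continuous.
      split.
      + by move=> x; rewrite in_itv/= => /andP[/ltW ? /ltW ?]; apply: dFx;
          rewrite in_itv/=; apply/andP.
      + apply: cvg_at_right_filter; apply: cFx.
        by rewrite in_itv/= lexx ltW.
      + apply: cvg_at_left_filter; apply: cFx.
        by rewrite in_itv/= lexx ltW.
    - move=> x xab; rewrite derive1E; have xi : x \in `]a, b[.
        by apply: (@cc_oo n); move: xab; rewrite !in_itv/= => /andP[/ltW -> /ltW ->].
      by have ? := dF x xi; rewrite derive_val.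
  have i1 : mu.-integrable `[an n, bn n] (EFin \o f1).
    by apply: continuous_compact_integrable; [exact: segment_compact|exact: wc].
  have i2 : mu.-integrable `[an n, bn n] (EFin \o f2).
    by apply: continuous_compact_integrable; [exact: segment_compact|exact: wc].
  move: Fn; under eq_integral do rewrite EFinB.
  rewrite integralB_EFin// EFinB => <-.
  by rewrite addeC subeK//; exact: integrable_fin_num.
have nd : nondecreasing_seq (fun n => `[an n, bn n]%classic).
  move=> m n mn; rewrite subsetEset => x/=; rewrite !in_itv/=.
  have : (b - a) / n.+3%:R <= (b - a) / m.+3%:R.
    by rewrite ler_pM2l ?subr_gt0// lef_pV2 ?posrE// ler_nat.
  rewrite /an /bn; move: ((b - a) / n.+3%:R) ((b - a) / m.+3%:R) => e e'.
  by move=> h /andP[h1 h2]; apply/andP; split; lra.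
have cvgI (f : R -> R) : {in `]a, b[, continuous f} -> {in `]a, b[, forall x, 0 <= f x} ->
    (\int[mu]_(x in `[an n, bn n]) (f x)%:E)%E @[n --> \oo] -->
    (\int[mu]_(x in `]a, b[) (f x)%:E)%E.
  move=> cf f0; rewrite oo_bigcup.
  have mcc n : measurable `[an n, bn n]%classic by exact: measurable_itv.
  have ge0f n x : `[an n, bn n]%classic x -> (0 <= (EFin \o f) x)%E.
    by move=> /cc_oo xab /=; rewrite lee_fin; exact: f0.
  exact: (ge0_nondecreasing_set_cvg_integral (mu := mu) nd mcc
    (fun n => mf f n cf) ge0f).
have e_cvg : (b - a) / n.+3%:R @[n --> \oo] --> (0 : R).
  rewrite -(mulr0 (b - a)); apply: cvgM; first exact: cvg_cst.
  have := @cvg_harmonic R; rewrite -(cvg_shiftn 2 (@harmonic R)).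
  by under eq_fun do rewrite /harmonic/= addn2.
have Fan : F (an n) @[n --> \oo] --> la.
  have /cvg_at_rightP := Fa; apply; split => //.
  by rewrite -[X in _ --> X]addr0; apply: cvgD => //; exact: cvg_cst.
have Fbn : F (bn n) @[n --> \oo] --> lb.
  have /cvg_at_leftP := Fb; apply; split => //.
  by rewrite -[X in _ --> X]subr0; apply: cvgB => //; exact: cvg_cst.
have h1 := cvgI _ cf1 f10.
have h2 : (\int[mu]_(x in `[an n, bn n]) (f2 x)%:E
    + (F (bn n) - F (an n))%:E)%E @[n --> \oo] -->
    (\int[mu]_(x in `]a, b[) (f2 x)%:E + (lb - la)%:E)%E.
  apply: cvgeD; [by rewrite fin_num_adde_defl|exact: cvgI|].
  by apply: cvg_EFin; [exact: nearW|]; apply: cvgB.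
by apply: (cvg_unique _ h1); [exact: ereal_hausdorff|rewrite (funext key)].
Unshelve. all: by end_near. Qed.

End ImproperFTC.

(** * Beta integrals *)

Section PowerIntegrals.
Context (R : realType).

Let continuous_mul (f g : R -> R) (x : R) :
  {for x, continuous f} -> {for x, continuous g} ->
  {for x, continuous (fun y => f y * g y)}.
Proof. exact: continuousM. Qed.

Let cvg_exprn (T : Type) (F : set_system T) {FF : Filter F} (f : T -> R)
    (n : nat) (l : R) :
  f x @[x --> F] --> l -> f x ^+ n @[x --> F] --> l ^+ n.
Proof.
by move=> Fl; apply: (@continuous_cvg _ _ _ F FF f (fun y : R => y ^+ n) l) => //;
  exact: exprn_continuous.
Qed.
Local Notation mu := (@lebesgue_measure R).

Definition pochhammer (x : R) (n : nat) : R := \prod_(i < n) (x + i%:R).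

(* With [p = t sin u] and [r = t cos u] this is the derivative of
   [u = 2 atan (p / (t + r))]. *)
Lemma half_angle_derive (t r p d : R) : 0 < t -> 0 < r ->
  p ^+ 2 = t ^+ 2 - r ^+ 2 ->
  2 * ((1 + (p / (t + r)) ^+ 2)^-1 *
    (p * (- (t + r) ^- 2 * - (p * d / r)) + (t + r)^-1 * d)) = d / r.
Proof.
move=> t0 r0 pE; have tr0 : t + r != 0 by rewrite gt_eqF// addr_gt0.
have t_neq0 : t != 0 by rewrite gt_eqF.
have r_neq0 : r != 0 by rewrite gt_eqF.
have -> : 1 + (p / (t + r)) ^+ 2 = 2 * t / (t + r).
  by rewrite expr_div_n pE; field.
have -> : p * (- (t + r) ^- 2 * - (p * d / r)) = p ^+ 2 * d / (r * (t + r) ^+ 2).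
  by field; rewrite tr0.
by rewrite pE; field; rewrite tr0 r_neq0.
Qed.

Lemma pochhammer0 x : pochhammer x 0 = 1.
Proof. by rewrite /pochhammer big_ord0. Qed.

Lemma pochhammerS x n : pochhammer x n.+1 = pochhammer x n * (x + n%:R).
Proof. by rewrite /pochhammer big_ord_recr. Qed.

Lemma pochhammerSl x n : pochhammer x n.+1 = x * pochhammer (x + 1) n.
Proof.
rewrite /pochhammer big_ord_recl addr0; congr (_ * _).
by apply: eq_bigr => i _; rewrite /= /bump /= natrD addrA.
Qed.

Lemma pochhammer_gt0 x n : 0 < x -> 0 < pochhammer x n.
Proof. by move=> x0; apply: prodr_gt0 => i _; rewrite ltr_wpDr. Qed.

(* Ratio of Beta values: [B(1/2 + k, q/2 + j) / B(1/2, q/2)]. *)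
Definition beta_ratio (q k j : nat) : R :=
  pochhammer 2^-1 k * pochhammer (q%:R / 2) j /
  pochhammer (q.+1%:R / 2) (k + j).

Variables (a b c sg : R) (psi dpsi : R -> R).
Hypothesis ab : a < b.
Hypothesis c0 : 0 < c.
Hypothesis sgE : sg = 0 \/ sg = -1.
Hypothesis psi_lt : {in `]a, b[, forall x, psi x ^+ 2 < c}.
Hypothesis dpsi_gt0 : {in `]a, b[, forall x, 0 < dpsi x}.
Hypothesis dpsiP : {in `]a, b[, forall x : R, is_derive x 1 psi (dpsi x)}.
Hypothesis dpsi_cont : {in `]a, b[, continuous dpsi}.
Hypothesis psi_a : psi x @[x --> a^'+] --> sg * Num.sqrt c.
Hypothesis psi_b : psi x @[x --> b^'-] --> Num.sqrt c.

(** [psi] is a change of variable that runs from [sg * Num.sqrt c] to [Num.sqrt c]. It will be the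
    identity with [sg = -1] for a coordinate of the ball, and the square root with [sg = 0] for a
    coordinate of the simplex. *)
Let G (k : nat) (e : R) (x : R) : R :=
  dpsi x * psi x ^+ (2 * k) * (c - psi x ^+ 2) `^ e.
Let J k e := (\int[mu]_(x in `]a, b[) (G k e x)%:E)%E.

Let psi_cont : {in `]a, b[, continuous psi}.
Proof.
by move=> x /dpsiP dx; apply/differentiable_continuous/derivable1_diffP.
Qed.

Let h_gt0 : {in `]a, b[, forall x, 0 < c - psi x ^+ 2}.
Proof. by move=> x /psi_lt; rewrite subr_gt0. Qed.

Let h_derive : {in `]a, b[, forall x : R,
  is_derive x 1 (fun y => c - psi y ^+ 2) (- (2 * psi x * dpsi x))}.
Proof.
move=> x /dpsiP dx.
have := is_deriveB (is_derive_cst c x 1) (is_deriveX 2 dx).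
by move=> h; apply: is_derive_eq; rewrite sub0r /= expr1 /GRing.scale/=; ring.
Qed.

Let hpow_derive (e : R) : {in `]a, b[, forall x : R,
  is_derive x 1 (fun y => (c - psi y ^+ 2) `^ e)
    (- (2 * e * psi x * dpsi x * (c - psi x ^+ 2) `^ (e - 1)))}.
Proof.
move=> x xab; have hx := h_gt0 xab.
have := @is_derive1_comp R (fun y => y `^ e) (fun y => c - psi y ^+ 2) x _ _
  (is_derive1_powR e hx) (h_derive xab).
by move=> h; apply: is_derive_eq; ring.
Qed.

Let G_cont k e : {in `]a, b[, continuous (G k e)}.
Proof.
move=> x xab; apply: (@continuous_mul (fun x => dpsi x * psi x ^+ (2 * k))
  (fun x => (c - psi x ^+ 2) `^ e)).
  apply: (@continuous_mul dpsi (fun x => psi x ^+ (2 * k))).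
    exact: dpsi_cont.
  by apply: cvg_exprn; exact: psi_cont.
have dx := hpow_derive e xab.
by apply/differentiable_continuous/derivable1_diffP.
Qed.

Let G_ge0 k e : {in `]a, b[, forall x, 0 <= G k e x}.
Proof.
move=> x xab; rewrite /G mulr_ge0 ?powR_ge0// mulr_ge0 ?(ltW (dpsi_gt0 _))//.
by rewrite exprM exprn_ge0 ?sqr_ge0.
Qed.

Let G_meas k e : measurable_fun `]a, b[ (EFin \o G k e).
Proof.
apply/measurable_EFinP; apply: open_continuous_measurable_fun.
  exact: interval_open.
by move=> x; rewrite inE; exact: G_cont.
Qed.

Let D : set (g_sigma_algebraType R.-ocitv.-measurable) := `]a, b[%classic.

Let mD : measurable D. Proof. exact: measurable_itv. Qed.

Let G_ge0E k e x : D x -> (0 <= (G k e x)%:E)%E.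
Proof. by move=> xab; rewrite lee_fin; exact: G_ge0. Qed.

Let JZ (r : R) k e : 0 <= r ->
  (r%:E * J k e = \int[mu]_(x in `]a, b[) (r * G k e x)%:E)%E.
Proof.
move=> r0; under eq_integral do rewrite EFinM.
exact/esym/(ge0_integralZl_EFin mu mD (@G_ge0E k e) (@G_meas k e) r0).
Qed.

(** Split [c] as [psi ^+ 2] plus [c - psi ^+ 2] under the integral. *)
Let JD k e : (c%:E * J k e = J k.+1 e + J k (e + 1))%E.
Proof.
rewrite JZ ?(ltW c0)// /J.
rewrite -(ge0_integralD mu mD (@G_ge0E k.+1 e) (@G_meas k.+1 e)
  (@G_ge0E k (e + 1)) (@G_meas k (e + 1))).
apply: eq_integral => x; rewrite inE => xab.
rewrite -EFinD /G; congr EFin.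
have hx := h_gt0 xab.
rewrite powRD; last by rewrite (gt_eqF hx) implybT.
rewrite powRr1 ?(ltW hx)//.
by rewrite mulnS !exprD; ring.
Qed.

Let J_ge0 k e : (0 <= J k e)%E.
Proof. by apply: integral_ge0 => x xab; rewrite lee_fin; exact: G_ge0. Qed.

Let cvg_h_b : (c - psi x ^+ 2) @[x --> b^'-] --> (0 : R).
Proof.
have -> : 0 = c - Num.sqrt c ^+ 2 by rewrite sqr_sqrtr ?subrr// ltW.
apply: cvgB; first exact: cvg_cst.
by rewrite expr2; under eq_fun do rewrite expr2; apply: cvgM.
Qed.

Let cvg_h_a : (c - psi x ^+ 2) @[x --> a^'+] --> (c - sg ^+ 2 * c : R).
Proof.
apply: cvgB; first exact: cvg_cst.
rewrite -[X in _ * X](@sqr_sqrtr _ c) ?ltW// -exprMn.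
by rewrite expr2; under eq_fun do rewrite expr2; apply: cvgM.
Qed.

Let near_a : \forall x \near a^'+, x \in `]a, b[.
Proof. by near=> x; rewrite in_itv/=; apply/andP; split. Unshelve. all: by end_near. Qed.

Let near_b : \forall x \near b^'-, x \in `]a, b[.
Proof. by near=> x; rewrite in_itv/=; apply/andP; split. Unshelve. all: by end_near. Qed.

Let cvg_pow0 (F : set_system R) {FF : ProperFilter F} (p : R) : 0 < p ->
  (\forall x \near F, x \in `]a, b[) ->
  (c - psi x ^+ 2) @[x --> F] --> (0 : R) ->
  ((c - psi x ^+ 2) `^ p) @[x --> F] --> (0 : R).
Proof.
move=> p0 Fab Fh.
apply: (@cvg_comp _ _ _ (fun x => c - psi x ^+ 2) (fun y => y `^ p) F 0^'+).
  move=> A; rewrite /at_right /within/= => nA.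
  have := Fh _ nA; rewrite !near_simpl => FA.
  by near=> x; apply: (near FA x) => //; apply: h_gt0; near: x.
exact: powR_cvg0.
Unshelve. all: by end_near. Qed.

(** Integration by parts with the primitive psi^(2k+1) (c - psi^2)^(e+1). It vanishes at [b] through
    its second factor; at [a] through its first factor if [sg = 0], and through its second if
    [sg = -1]. *)
Let JR k e : 0 < e + 1 ->
  ((2 * k + 1)%:R%:E * J k (e + 1) = (2 * (e + 1))%:E * J k.+1 e)%E.
Proof.
move=> e0; rewrite (@JZ _ k (e + 1) (ler0n _ _)) (@JZ _ k.+1 e (mulr_ge0 (ler0n _ 2) (ltW e0))).
have -> : (\int[mu]_(x in `]a, b[) (2 * (e + 1) * G k.+1 e x)%:E =
  \int[mu]_(x in `]a, b[) (2 * (e + 1) * G k.+1 e x)%:E + (0 - 0 : R)%:E)%E.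
  by rewrite subrr adde0.
apply: (@FTC_oo R (fun x => psi x ^+ (2 * k).+1 * (c - psi x ^+ 2) `^ (e + 1))).
- exact: ab.
- by move=> x xab; rewrite mulr_ge0//; exact: G_ge0.
- by move=> x xab; rewrite mulr_ge0 ?G_ge0// mulr_ge0// ltW.
- by move=> x xab; apply: (@continuous_mul (fun=> _) (G _ _));
    [exact: cst_continuous|exact: G_cont].
- by move=> x xab; apply: (@continuous_mul (fun=> _) (G _ _));
    [exact: cst_continuous|exact: G_cont].
- move=> x xab.
  have h1 := is_deriveX (2 * k).+1 (dpsiP xab).
  have h2 := hpow_derive (e + 1) xab.
  have h := is_deriveM h1 h2.
  rewrite (_ : (fun _ => _) = psi ^+ (2 * k).+1 *
    (fun y => (c - psi y ^+ 2) `^ (e + 1))); last first.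
    by apply/funext => y; rewrite exprfctE.
  apply: (is_derive_eq h); rewrite exprfctE.
  rewrite /GRing.scale/= addrK /G mulnS addn1 (exprD (psi x) 2) exprS.
  by move: (_.+1%:R : R) (psi x ^+ (2 * k)) => u v; ring.
- have [s0|s1] := sgE.
    move: psi_a; rewrite s0 mul0r => pa.
    apply/cvgr0Pnorm_lt => eps eps0.
    have C0 : 0 < c `^ (e + 1) by rewrite powR_gt0.
    have pa0 : psi x ^+ (2 * k).+1 @[x --> a^'+] --> (0 : R).
      have <- : (0 : R) ^+ (2 * k).+1 = 0 by rewrite expr0n.
      exact: cvg_exprn.
    have near_eps : \forall x \near a^'+,
        `|psi x ^+ (2 * k).+1| < eps / c `^ (e + 1).
      by apply: (cvgr0_norm_lt _ pa0); exact: divr_gt0.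
    near=> x; rewrite normrM.
    have xab : x \in `]a, b[ by near: x; exact: near_a.
    have hc : (c - psi x ^+ 2) `^ (e + 1) <= c `^ (e + 1).
      apply: ge0_ler_powR; rewrite ?nnegrE; [exact: ltW|
        exact: ltW (h_gt0 xab)|exact: ltW|by rewrite lerBlDr lerDl sqr_ge0].
    rewrite [X in _ * X]ger0_norm ?powR_ge0//.
    apply: (le_lt_trans (ler_wpM2l _ hc)) => //.
    by rewrite -ltr_pdivlMr//; near: x.
  have ha := cvg_h_a; move: ha; rewrite s1 sqrrN expr1n mul1r subrr => ha.
  rewrite -(mulr0 ((sg * Num.sqrt c) ^+ (2 * k).+1)).
  by apply: cvgM; [exact: cvg_exprn|exact: cvg_pow0].
- rewrite -(mulr0 (Num.sqrt c ^+ (2 * k).+1)).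
  by apply: cvgM; [exact: cvg_exprn|exact: cvg_pow0].
Unshelve. all: by end_near. Qed.

Let J00 : J 0 0 = (Num.sqrt c * (1 - sg))%:E.
Proof.
rewrite /J (@FTC_oo R psi (G 0 0) (fun=> 0) a b (sg * Num.sqrt c)
  (Num.sqrt c) ab) ?integral0 ?add0e.
- by congr EFin; ring.
- exact: G_ge0.
- by [].
- exact: G_cont.
- by move=> x _; exact: cst_continuous.
- move=> x xab; have dx := dpsiP xab; apply: is_derive_eq.
  by rewrite /G expr0 powRr0 !mulr1 subr0.
- exact: psi_a.
- exact: psi_b.
Qed.

(** The primitive is 2 arctan of psi / (sqrt c + sqrt (c - psi^2)), the half-angle form of arcsin
    (psi / sqrt c). Its denominator stays positive up to the endpoints, so the limits there follow
    from continuity. *)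
Let J0N : J 0 (- 2^-1) = (2 * (atan 1 - atan sg))%:E.
Proof.
pose s x : R := Num.sqrt c + Num.sqrt (c - psi x ^+ 2).
have sc0 : 0 < Num.sqrt c by rewrite sqrtr_gt0.
have s_gt0 x : 0 < s x by rewrite /s ltr_pwDl// sqrtr_ge0.
pose F x : R := 2 * atan (psi x / s x).
have cvgF (FF : set_system R) (PF : ProperFilter FF) (t : R) : t ^+ 2 <= 1 ->
    (psi x @[x --> FF] --> t * Num.sqrt c) -> (t = 0 \/ t ^+ 2 = 1) ->
    F x @[x --> FF] --> 2 * atan t.
  move=> t1 pt tt.
  have hc : (c - psi x ^+ 2) @[x --> FF] --> (c - t ^+ 2 * c : R).
    apply: cvgB; first exact: cvg_cst.
    rewrite -[X in _ * X](@sqr_sqrtr _ c) ?ltW// -exprMn.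
    exact: cvg_exprn.
  have hs : s x @[x --> FF] --> (Num.sqrt c + Num.sqrt (c - t ^+ 2 * c)).
    apply: cvgD; first exact: cvg_cst.
    by apply: (@continuous_cvg _ _ _ FF _ _ Num.sqrt) => //; exact: sqrt_continuous.
  have l0 : Num.sqrt c + Num.sqrt (c - t ^+ 2 * c) != 0.
    by rewrite gt_eqF// ltr_pwDl// sqrtr_ge0.
  have hq : psi x / s x @[x --> FF] -->
      (t * Num.sqrt c) / (Num.sqrt c + Num.sqrt (c - t ^+ 2 * c)).
    by apply: cvgM => //; exact: cvgV.
  have <- : (t * Num.sqrt c) / (Num.sqrt c + Num.sqrt (c - t ^+ 2 * c)) = t.
    case: tt => [->|->]; first by rewrite !mul0r.
    by rewrite mul1r subrr sqrtr0 addr0 mulfK// gt_eqF.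
  apply: cvgM; first exact: cvg_cst.
  by apply: (@continuous_cvg _ _ _ FF _ _ atan) => //; exact: continuous_atan.
rewrite /J (@FTC_oo R F (G 0 (- 2^-1)) (fun=> 0) a b (2 * atan sg)
  (2 * atan 1) ab) ?integral0 ?add0e.
- by congr EFin; ring.
- exact: G_ge0.
- by [].
- exact: G_cont.
- by move=> x _; exact: cst_continuous.
- move=> x xab; have dx := dpsiP xab; have hx := h_gt0 xab.
  have dh := h_derive xab.
  have ds := @is_derive1_comp R (fun y => Num.sqrt y) (fun y => c - psi y ^+ 2) x _ _
    (is_derive1_sqrt hx) dh.
  have ds' : is_derive x 1 s (- (psi x * dpsi x / Num.sqrt (c - psi x ^+ 2))).
    have := is_deriveD (is_derive_cst (Num.sqrt c) x 1) ds.
    move=> h; apply: is_derive_eq; rewrite add0r.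
    by field; rewrite gt_eqF// sqrtr_gt0.
  have sx0 : s x != 0 by rewrite gt_eqF.
  have dV := is_deriveV sx0 ds'.
  have dq := is_deriveM dx dV.
  have da := @is_derive1_comp R (fun y => atan y) (fun y => psi y / s y) x _ _
    (is_derive1_atan (psi x / s x)) dq.
  have h := is_deriveZ 2 da; apply: (is_derive_eq h).
  rewrite /G muln0 expr0 mulr1 subr0 powRN powR12_sqrt ?ltW//.
  rewrite /GRing.scale/=.
  have r0 : 0 < Num.sqrt (c - psi x ^+ 2) by rewrite sqrtr_gt0.
  have rE : psi x ^+ 2 = Num.sqrt c ^+ 2 - Num.sqrt (c - psi x ^+ 2) ^+ 2.
    by rewrite !sqr_sqrtr ?ltW// opprB addrC subrK.
  exact: (half_angle_derive _ sc0 r0 rE).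
- apply: cvgF => //; case: sgE => ->; rewrite ?sqrrN ?expr1n ?expr0n//; by [left|right].
- by apply: cvgF; [rewrite expr1n|rewrite mul1r|right; rewrite expr1n].
Qed.

(** By [JD] the two unknowns have a finite sum, hence are finite; [JR] fixes their ratio. *)
Let J_step k e (y : R) : 0 < e + 1 -> J k e = y%:E ->
  J k.+1 e = (c * y * ((2 * k + 1)%:R / ((2 * k + 1)%:R + 2 * (e + 1))))%:E /\
  J k (e + 1) = (c * y * (2 * (e + 1) / ((2 * k + 1)%:R + 2 * (e + 1))))%:E.
Proof.
move=> e0 Jy; have := JD k e; have := JR k e0.
have := J_ge0 k.+1 e; have := J_ge0 k (e + 1); rewrite Jy.
have k0 : 0 < (2 * k + 1)%:R :> R by rewrite ltr0n addn1.
have d0 : (2 * k + 1)%:R + 2 * (e + 1) != 0 by rewrite gt_eqF// addr_gt0// mulr_gt0.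
case: (J k (e + 1)) => [u| |]; case: (J k.+1 e) => [v| |]//=.
rewrite !lee_fin => u0 v0 [uv] [cy].
move: (_%:R : R) k0 d0 uv => t t0 d0 uv.
have -> : v = u * t / (2 * (e + 1)).
  by rewrite [u * t]mulrC uv mulrC mulKf// gt_eqF// mulr_gt0.
have e10 : e + 1 != 0 by rewrite gt_eqF.
have -> : c * y = u * t / (2 * (e + 1)) + u.
  by rewrite cy; congr (_ + _); rewrite [u * t]mulrC uv mulrC mulKf// gt_eqF// mulr_gt0.
by split; congr EFin; field; rewrite ?e10 ?d0.
Qed.

Let J_grid q (x : R) k j : (0 < q)%N -> J 0 (q%:R / 2 - 1) = x%:E ->
  J k (q%:R / 2 - 1 + j%:R) = (x * beta_ratio q k j * c ^+ (k + j))%:E.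
Proof.
move=> q0 J0.
have q0R : 0 < q%:R :> R by rewrite ltr0n.
have e0 i : 0 < q%:R / 2 - 1 + i%:R + 1 :> R.
  by rewrite addrAC subrK ltr_wpDr// divr_gt0.
elim: k => [|k ih].
  elim: j => [|j ih].
    by rewrite addr0 J0; congr EFin; rewrite /beta_ratio !pochhammer0 expr0; field.
  rewrite -[j.+1%:R]natr1 addrA; have [_ ->] := J_step (e0 j) ih; congr EFin.
  rewrite /beta_ratio !add0n !pochhammerS exprS pochhammer0.
  have := pochhammer_gt0 j (divr_gt0 (ltr0Sn R q) (ltr0Sn R 1)).
  rewrite -[q.+1%:R]natr1.
  move: (pochhammer _ j) (pochhammer _ j) => u v v0.
  move: (q%:R : R) q0R (ler0n R j) => r r0; move: (j%:R : R) => z z0.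
  by field; rewrite ?gt_eqF//; lra.
have [-> _] := J_step (e0 j) ih; congr EFin.
rewrite /beta_ratio addSn !pochhammerS exprS.
have := pochhammer_gt0 (k + j) (divr_gt0 (ltr0Sn R q) (ltr0Sn R 1)).
rewrite -[q.+1%:R]natr1 [(2 * k + 1)%:R]natrD [(2 * k)%:R]natrM [(k + j)%:R]natrD.
move: (pochhammer _ k) (pochhammer _ j) (pochhammer _ (k + j)) => u w v v0.
move: (q%:R : R) q0R (ler0n R j) (ler0n R k) => r r0.
move: (j%:R : R) (k%:R : R) => z z' z0 z'0.
by field; rewrite ?gt_eqF//; lra.
Qed.

(** For [s] equal to -1 or 0 and [q] positive, this is the integral of (1 - u^2)^(q/2 - 1) over
    [s, 1]. The exponents -1/2 and 0 are elementary, and the recursion goes by steps of two from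
    there. The value at [q = 0] is a default that keeps the mass positive for all [q]. *)
Fixpoint beta_mass (s : R) (q : nat) : R :=
  match q with
  | 0 => 1
  | 1 => 2 * (atan 1 - atan s)
  | p.+2 => if p is 0 then 1 - s else beta_mass s p * (p%:R / p.+1%:R)
  end.

Lemma beta_mass_gt0 (s : R) q : s < 1 -> 0 < beta_mass s q.
Proof.
move=> s1; elim/ltn_ind: q => -[|[|[|q]]] ih //=.
- by rewrite mulr_gt0// subr_gt0 lt_atan.
- by rewrite subr_gt0.
- apply: mulr_gt0; last by rewrite divr_gt0.
  by apply: (ih q.+1); rewrite ltnS.
Qed.

Lemma integral_power_kernel q k j : (0 < q)%N ->
  (\int[mu]_(x in `]a, b[)
     (dpsi x * psi x ^+ (2 * k) *
      (c - psi x ^+ 2) `^ (q%:R / 2 - 1 + j%:R))%:E)%E =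
  (beta_mass sg q * beta_ratio q k j *
   (c ^+ (k + j) * c `^ ((q%:R - 1) / 2)))%:E.
Proof.
rewrite -/(J _ _); elim/ltn_ind: q k j => -[//|[|[|q]]] ih k j _.
- rewrite (@J_grid 1 (2 * (atan 1 - atan sg)) k j (ltn0Sn 0)); last first.
    by rewrite (_ : 1%:R / 2 - 1 = - 2^-1) ?J0N//; field.
  by rewrite subrr mul0r powRr0 mulr1.
- rewrite (@J_grid 2 (Num.sqrt c * (1 - sg)) k j (ltn0Sn 1)); last first.
    by rewrite (_ : 2%:R / 2 - 1 = 0); [exact: J00|field].
  congr EFin => /=; rewrite (_ : (2%:R - 1) / 2 = 2^-1); last by field.
  by rewrite powR12_sqrt ?(ltW c0)//; ring.
(* Raising [q] by two has the same effect on the exponent as raising [j] by one, so this case is an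
   instance of the induction hypothesis at [j.+1]. *)
have -> : q.+3%:R / 2 - 1 + j%:R = q.+1%:R / 2 - 1 + j.+1%:R :> R.
  by rewrite -[q.+3%:R]natr1 -[q.+2%:R]natr1 -[j.+1%:R]natr1; field.
rewrite ih//; congr EFin.
have -> : beta_mass sg q.+3 = beta_mass sg q.+1 * (q.+1%:R / q.+2%:R) by [].
have -> : c ^+ (k + j.+1) * c `^ ((q.+1%:R - 1) / 2) =
          c ^+ (k + j) * c `^ ((q.+3%:R - 1) / 2).
  rewrite (_ : (q.+3%:R - 1) / 2 = (q.+1%:R - 1) / 2 + 1); last first.
    by rewrite -[q.+3%:R]natr1 -[q.+2%:R]natr1; field.
  rewrite powRD ?(gt_eqF c0) ?implybT// powRr1 ?(ltW c0)// addnS exprS; ring.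
rewrite !mulrA; congr (_ * _ * _); rewrite -!mulrA; congr (_ * _).
rewrite /beta_ratio addnS !pochhammerSl.
have h1 : q.+1%:R / 2 + 1 = q.+3%:R / 2 :> R.
  by rewrite -[q.+3%:R]natr1 -[q.+2%:R]natr1; field.
have h2 : q.+2%:R / 2 + 1 = q.+4%:R / 2 :> R.
  by rewrite -[q.+4%:R]natr1 -[q.+3%:R]natr1; field.
rewrite h1 h2.
have := pochhammer_gt0 (k + j) (divr_gt0 (ltr0Sn R q.+3) (ltr0Sn R 1)).
have := ltr0Sn R q.+1; move: (_.+2%:R : R) => t t0.
move: (pochhammer _ (k + j)) => v v0.
by field; rewrite !gt_eqF.
Qed.

End PowerIntegrals.

(** * Dirichlet integrals and moments *)

Section DirichletIntegrals.
Context (R : realType).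
Local Notation mu := (@lebesgue_measure R).

Lemma ge0_integral_lebesgueS N (f : N.+1.-tuple R -> \bar R) :
  measurable_fun [set: _] f -> (forall x, 0 <= f x)%E ->
  (\int[lebesgue R N.+1]_x f x =
   \int[mu]_t \int[lebesgue R N]_y f (cons_pt (t, y)))%E.
Proof.
move=> mf f0.
have mc : measurable_fun [set: _] (@cons_pt R N) by exact: measurable_cons_pt.
transitivity (\int[pushforward (mu \x lebesgue R N)%E (@cons_pt R N)]_x f x)%E.
  by [].
rewrite ge0_integral_pushforward//=.
rewrite preimage_setT fubini_tonelli1//=.
exact: measurableT_comp.
Qed.

(** Truncated at 0 so that the integrand itself encodes the domain: an integral over a body becomes
    an iterated integral over whole lines, with no bounds depending on the previous coordinates. *)
Definition ppow (y e : R) : R := if 0 < y then y `^ e else 0.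

Lemma ppow_ge0 y e : 0 <= ppow y e.
Proof. by rewrite /ppow; case: ifP => // _; exact: powR_ge0. Qed.

Lemma measurable_ppow e : measurable_fun [set: R] (ppow ^~ e).
Proof.
apply: measurable_fun_ifT => //.
exact: measurable_fun_ltr.
Qed.

Lemma ball_kernel_integral (c : R) q k j : 0 < c -> (0 < q)%N ->
  (\int[mu]_t (1 * (t ^+ 2) ^+ k * ppow (c - t ^+ 2) (q%:R / 2 - 1 + j%:R))%:E)%E =
  (beta_mass (-1 : R) q * beta_ratio R q k j *
   (c ^+ (k + j) * c `^ ((q%:R - 1) / 2)))%:E.
Proof.
move=> c0 q0.
have s0 : 0 < Num.sqrt c by rewrite sqrtr_gt0.
have lt_c (x : R) : (x \in `]- Num.sqrt c, Num.sqrt c[) = (x ^+ 2 < c).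
  rewrite in_itv/= -ltr_norml -sqrtr_sqr ltr_sqrt//.
have := @integral_power_kernel R (- Num.sqrt c) (Num.sqrt c) c (-1) id (fun=> 1).
move=> <- //.
- rewrite [RHS]integral_mkcond; apply: eq_integral => x _.
  rewrite patchE; case: ifPn; rewrite ?inE/= ?notin_setE/= lt_c.
    by move=> xc; rewrite /ppow subr_gt0 xc exprM.
  by move=> /negP/negbTE xc; rewrite /ppow subr_gt0 xc mulr0.
- by lra.
- by right.
- by move=> x; rewrite lt_c.
- by move=> x _; exact: is_derive_id.
- by move=> x _; exact: cst_continuous.
- by rewrite mulN1r; apply: cvg_at_right_filter; exact: cvg_id.
- by apply: cvg_at_left_filter; exact: cvg_id.
Qed.

(** With [psi] the square root, t^(-1/2) dt is twice d(sqrt t); hence the factor 2, and the same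
    beta integrals as for the ball. *)
Lemma simplex_kernel_integral (c : R) q k j : 0 < c -> (0 < q)%N ->
  (\int[mu]_t (ppow t (- 2^-1) * t ^+ k *
     ppow (c - t) (q%:R / 2 - 1 + j%:R))%:E)%E =
  (2 * beta_mass (0 : R) q * beta_ratio R q k j *
   (c ^+ (k + j) * c `^ ((q%:R - 1) / 2)))%:E.
Proof.
move=> c0 q0.
have s0 : 0 < Num.sqrt c by rewrite sqrtr_gt0.
have K := @integral_power_kernel R 0 c c 0 Num.sqrt (fun x => (2 * Num.sqrt x)^-1).
have x0c (x : R) : x \in `]0, c[ -> 0 < x by rewrite in_itv/= => /andP[].
transitivity (2%:E * (beta_mass (0 : R) q * beta_ratio R q k j *
   (c ^+ (k + j) * c `^ ((q%:R - 1) / 2)))%:E)%E; last first.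
  by rewrite -EFinM; congr EFin; ring.
rewrite -K//; last 7 first.
- by left.
- move=> x xc; rewrite sqr_sqrtr ?ltW//; last exact: (x0c _ xc).
  by move: xc; rewrite in_itv/= => /andP[].
- by move=> x /x0c x0; rewrite invr_gt0 mulr_gt0// sqrtr_gt0.
- by move=> x /x0c x0; exact: is_derive1_sqrt.
- move=> x /x0c x0; apply: cvgV; first by rewrite mulf_neq0// gt_eqF// sqrtr_gt0.
  by apply: cvgM; [exact: cvg_cst|exact: sqrt_continuous].
- rewrite mul0r -[X in _ --> X](@sqrtr0 R).
  by apply: cvg_at_right_filter; exact: sqrt_continuous.
- by apply: cvg_at_left_filter; exact: sqrt_continuous.
rewrite -ge0_integralZl_EFin//=; last 2 first.
- by move=> x xc; rewrite lee_fin mulr_ge0 ?powR_ge0// mulr_ge0.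
- apply/measurable_EFinP; apply: measurable_funM; last first.
    apply: (measurableT_comp (measurable_powR _)) => //.
    apply: measurable_funB => //; apply: measurable_funX.
    by apply: measurable_funTS; apply: continuous_measurable_fun; exact: sqrt_continuous.
  apply: measurable_funM; last first.
    apply: measurable_funX.
    by apply: measurable_funTS; apply: continuous_measurable_fun; exact: sqrt_continuous.
  apply: open_continuous_measurable_fun; first exact: interval_open.
  move=> x; rewrite inE/= => /x0c x0.
  apply: cvgV; first by rewrite mulf_neq0// gt_eqF// sqrtr_gt0.
  by apply: cvgM; [exact: cvg_cst|exact: sqrt_continuous].
rewrite [RHS]integral_mkcond; apply: eq_integral => x _.
rewrite patchE; case: ifPn; rewrite ?inE/= ?notin_setE/= in_itv/=.
  move=> /andP[x0 xc]; rewrite /ppow x0 subr_gt0 xc -EFinM; congr EFin.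
  rewrite exprM sqr_sqrtr ?(ltW x0)// powRN powR12_sqrt ?(ltW x0)//.
  have sx : Num.sqrt x != 0 by rewrite gt_eqF// sqrtr_gt0.
  by move: (_ `^ _) => u; field.
move=> /negP; rewrite negb_and /ppow subr_gt0 => /orP[/negbTE ->|/negbTE ->].
  by rewrite !mul0r.
by rewrite mulr0.
Qed.

Section Iterated.
Variables (phi w : R -> R) (mass : nat -> R).
Hypothesis mass_gt0 : forall q, 0 < mass q.
Hypothesis mphi : measurable_fun [set: R] phi.
Hypothesis mw : measurable_fun [set: R] w.
Hypothesis w0 : forall t, 0 <= w t.
Hypothesis phi0 : forall t, w t != 0 -> 0 <= phi t.
Hypothesis kernel : forall (c : R) q k j, 0 < c -> (0 < q)%N ->
  (\int[mu]_t (w t * phi t ^+ k * ppow (c - phi t) (q%:R / 2 - 1 + j%:R))%:E)%E =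
  (mass q * beta_ratio R q k j * (c ^+ (k + j) * c `^ ((q%:R - 1) / 2)))%:E.

Definition dirichlet_fun N (a : 'I_N -> nat) (j : nat) (c : R)
    (x : N.-tuple R) : R :=
  (\prod_i (w (tnth x i) * phi (tnth x i) ^+ a i)) *
  ppow (c - \sum_i phi (tnth x i)) (2^-1 - 1 + j%:R).

(** These are the mixed moments of the Dirichlet law with all [N.+1] parameters equal to 1/2, where
    [j] is the exponent of the slack. *)
Definition dirichlet_ratio N (a : 'I_N -> nat) (j : nat) : R :=
  (\prod_i pochhammer 2^-1 (a i)) * pochhammer 2^-1 j /
  pochhammer (N.+1%:R / 2) (\sum_i a i + j).

Lemma measurable_dirichlet_fun N a j c :
  measurable_fun [set: _] (@dirichlet_fun N a j c).
Proof.
have mt i : measurable_fun [set: N.-tuple R] (fun x => tnth x i).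
  exact: measurable_tnth.
apply: measurable_funM.
  apply: measurable_prod => i _; apply: measurable_funM.
    exact: (measurableT_comp mw).
  by apply: measurable_funX; exact: (measurableT_comp mphi).
apply: (measurableT_comp (measurable_ppow _)) => //.
apply: measurable_funB => //; apply: measurable_sum => i.
exact: (measurableT_comp mphi).
Qed.

Lemma wphi_neq0_or t k : w t * phi t ^+ k = 0 \/ 0 <= phi t.
Proof.
by have [->|/phi0] := eqVneq (w t) 0; [left; rewrite mul0r|right].
Qed.

Lemma dirichlet_fun_ge0 N a j c x : 0 <= @dirichlet_fun N a j c x.
Proof.
rewrite /dirichlet_fun mulr_ge0 ?ppow_ge0//; apply: prodr_ge0 => i _.
have [->//|p0] := wphi_neq0_or (tnth x i) (a i).
by rewrite mulr_ge0// exprn_ge0.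
Qed.

Lemma dirichlet_fun_cons N (a : 'I_N.+1 -> nat) j c t (y : N.-tuple R) :
  dirichlet_fun a j c (cons_pt (t, y)) =
  w t * phi t ^+ a ord0 * dirichlet_fun (fun i => a (lift ord0 i)) j (c - phi t) y.
Proof.
rewrite /dirichlet_fun !big_ord_recl /= -!mulrA; congr (_ * (_ * (_ * _))).
- by apply: eq_bigr => i _; rewrite !(tnth_nth 0)/=.
- rewrite opprD addrA; congr (ppow (_ - _) _).
  by apply: eq_bigr => i _; rewrite !(tnth_nth 0)/=.
Qed.

(** Integrating out all coordinates but the first leaves the truncated power at [c - phi t], with
    its exponent raised by 1/2 per coordinate besides the integer exponents. This is a beta kernel
    with [q = N.+1] in the first coordinate, which is why [c] stays arbitrary and [kernel] covers
    all half-integer exponents. *)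
Lemma dirichlet_integral N (a : 'I_N -> nat) j c :
  (\int[lebesgue R N]_x (dirichlet_fun a j c x)%:E =
   (\prod_(i < N) mass i.+1 * dirichlet_ratio a j *
    ppow c (N.+1%:R / 2 - 1 + (\sum_i a i + j)%:R))%:E)%E.
Proof.
elim: N a j c => [|N ih] a j c.
  have mf : measurable_fun [set: 0.-tuple R] (fun x => (dirichlet_fun a j c x)%:E).
    by apply/measurable_EFinP; exact: measurable_dirichlet_fun.
  transitivity (dirichlet_fun a j c [tuple])%:E.
    have := integral_dirac ([tuple] : 0.-tuple R) measurableT mf.
    by rewrite diracT mul1e.
  rewrite /dirichlet_fun /dirichlet_ratio.
  rewrite !big_ord0 !mul1r subr0 divff ?mul1r//.
  by rewrite gt_eqF// pochhammer_gt0.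
rewrite ge0_integral_lebesgueS; last 2 first.
- by apply/measurable_EFinP; exact: measurable_dirichlet_fun.
- by move=> x; rewrite lee_fin dirichlet_fun_ge0.
pose a' i := a (lift ord0 i); pose S := (\sum_i a' i + j)%N.
pose K := \prod_(i < N) mass i.+1 * dirichlet_ratio a' j.
have inner t : (\int[lebesgue R N]_y (dirichlet_fun a j c (cons_pt (t, y)))%:E =
    (K * (w t * phi t ^+ a ord0 * ppow (c - phi t) (N.+1%:R / 2 - 1 + S%:R)))%:E)%E.
  under eq_integral do rewrite dirichlet_fun_cons EFinM.
  have [->|p0] := wphi_neq0_or t (a ord0).
    by under eq_integral do rewrite mul0e; rewrite integral0 mul0r mulr0.
  rewrite ge0_integralZl_EFin//=.
  - by rewrite ih -EFinM; congr EFin; rewrite /K /S; ring.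
  - by move=> x _; rewrite lee_fin dirichlet_fun_ge0.
  - by apply/measurable_EFinP; exact: measurable_dirichlet_fun.
  - by rewrite mulr_ge0// exprn_ge0.
under eq_integral do rewrite inner.
have sumE : (\sum_i a i + j = a ord0 + S)%N by rewrite big_ord_recl -addnA.
rewrite sumE.
have [c0|c0] := ltP 0 c; last first.
  rewrite {2}/ppow ltNge c0/= mulr0; apply: integral0_eq => t _.
  have [->|p0] := wphi_neq0_or t (a ord0); first by rewrite mul0r mulr0.
  by rewrite /ppow ifF ?mulr0// subr_gt0; apply/negbTE; rewrite -leNgt (le_trans c0).
have K0 : 0 <= K.
  rewrite mulr_ge0//; first by apply: prodr_ge0 => i _; exact/ltW/mass_gt0.
  rewrite /dirichlet_ratio divr_ge0 ?mulr_ge0 ?(ltW (pochhammer_gt0 _ _))//.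
  by apply: prodr_ge0 => i _; exact/ltW/pochhammer_gt0.
under eq_integral do rewrite EFinM.
rewrite ge0_integralZl_EFin//=; last 2 first.
- move=> t _; rewrite lee_fin.
  have [->|p0] := wphi_neq0_or t (a ord0); first by rewrite mul0r.
  by rewrite mulr_ge0 ?ppow_ge0// mulr_ge0// exprn_ge0.
- apply/measurable_EFinP; apply: measurable_funM.
    by apply: measurable_funM => //; exact: measurable_funX.
  by apply: (measurableT_comp (measurable_ppow _)) => //; exact: measurable_funB.
rewrite kernel// -EFinM; congr EFin.
rewrite /ppow c0 /K big_ord_recr /=.
have -> : N.+2%:R / 2 - 1 + (a ord0 + S)%:R = (a ord0 + S)%:R + (N.+1%:R - 1) / 2 :> R.
  by rewrite -[N.+2%:R]natr1; field.
rewrite powRD ?(gt_eqF c0) ?implybT// powR_mulrn ?(ltW c0)//.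
rewrite /dirichlet_ratio /beta_ratio sumE [in RHS]big_ord_recl -/S -/(a' _).
have := pochhammer_gt0 S (divr_gt0 (ltr0Sn R N) (ltr0Sn R 1)).
have := pochhammer_gt0 (a ord0 + S) (divr_gt0 (ltr0Sn R N.+1) (ltr0Sn R 1)).
rewrite -/(\prod_(i < N) pochhammer 2^-1 (a' i)).
move: (pochhammer _ S) (pochhammer _ (a ord0 + S)) => u v v0 u0.
by field; rewrite !gt_eqF.
Qed.

End Iterated.
End DirichletIntegrals.

(** * Integration against a density *)

Section Density.
Local Open Scope ereal_scope.
Context d (T : measurableType d) (R : realType).
Variables (mu nu : {measure set T -> \bar R}) (w : T -> R).
Hypothesis mw : measurable_fun [set: T] w.
Hypothesis w0 : forall x, (0 <= w x)%R.
Hypothesis nuE : forall A, measurable A -> nu A = \int[mu]_(x in A) (w x)%:E.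

Let integral_density_indic E : measurable E ->
  \int[nu]_x (\1_E x)%:E = \int[mu]_x ((\1_E x)%:E * (w x)%:E).
Proof.
move=> mE; rewrite integral_indic//= setIT nuE// integral_mkcond/=.
apply: eq_integral => x _; rewrite patchE indicE.
by case: (x \in E); rewrite ?mul1e ?mul0e.
Qed.

Import HBNNSimple.

Let mwE : measurable_fun [set: T] (EFin \o w).
Proof. exact/measurable_EFinP. Qed.

Let integral_density_nnsfun (f : {nnsfun T >-> R}) :
  \int[nu]_x (f x)%:E = \int[mu]_x ((f x)%:E * (w x)%:E).
Proof.
under [LHS]eq_integral do rewrite fimfunE -fsumEFin//.
rewrite [LHS]ge0_integral_fsum//; last 2 first.
  - by move=> r; exact/measurable_EFinP/measurableT_comp.
  - by move=> n x _; rewrite EFinM nnfun_muleindic_ge0.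
under [RHS]eq_integral.
  move=> x xD; rewrite fimfunE -fsumEFin// muleC ge0_mule_fsumr; last first.
    by move=> r; rewrite EFinM nnfun_muleindic_ge0.
  over.
rewrite [RHS]ge0_integral_fsum//; last 2 first.
  - move=> r; apply: emeasurable_funM => //.
    by apply/measurable_EFinP; exact: measurableT_comp.
  - move=> n x _; rewrite EFinM mule_ge0//; first by rewrite lee_fin.
    by rewrite nnfun_muleindic_ge0.
apply: eq_fsbigr => r /[!inE] -[y _ <-].
rewrite integralZl_indic_nnsfun//= integral_density_indic//.
rewrite -ge0_integralZl_EFin//=; last 2 first.
  - by move=> x _; rewrite mule_ge0// lee_fin.
  - apply: emeasurable_funM => //.
    by apply/measurable_EFinP; exact: measurable_indic.
by apply: eq_integral => x _; rewrite EFinM muleA muleC.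
Qed.

Lemma ge0_integral_density (f : T -> \bar R) :
  measurable_fun [set: T] f -> (forall x, 0 <= f x) ->
  \int[nu]_x f x = \int[mu]_x (f x * (w x)%:E).
Proof.
move=> mf f0; pose f_ := nnsfun_approx measurableT mf.
have mf_ n : measurable_fun [set: T] (fun x => (f_ n x)%:E * (w x)%:E).
  by apply: emeasurable_funM => //; exact/measurable_EFinP/measurable_funTS.
transitivity (lim (\int[nu]_x (f_ n x)%:E @[n --> \oo])).
  rewrite -monotone_convergence//=.
  - apply: eq_integral => ? /[!inE] xD; apply/esym/cvg_lim => //=.
    exact: cvg_nnsfun_approx.
  - by move=> n; exact/measurable_EFinP/measurable_funTS.
  - by move=> n ? _; rewrite lee_fin.
  - by move=> ? _ ? ? mn; rewrite lee_fin; exact/lefP/nd_nnsfun_approx.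
rewrite [RHS](_ : _ = lim
    (\int[mu]_x ((f_ n x)%:E * (w x)%:E) @[n --> \oo])); last first.
  rewrite -monotone_convergence//=.
  - apply: eq_integral => x /[!inE] xD; apply/esym/cvg_lim => //.
    by apply: cvgeZr => //; exact: cvg_nnsfun_approx.
  - by move=> n x _; rewrite mule_ge0// lee_fin.
  - move=> x _ m n mn; apply: lee_wpmul2r; rewrite lee_fin//.
    exact/lefP/nd_nnsfun_approx.
by apply: congr_lim; apply/funext => n /=; exact: integral_density_nnsfun.
Qed.

End Density.

Lemma mnormalizeE d (T : measurableType d) (R : realType)
    (mu : {measure set T -> \bar R}) (P : probability T R) (t : R) A :
  0 < t -> mu [set: T] = t%:E -> mnormalize mu P A = (t^-1%:E * mu A)%E.
Proof.
move=> t0 mut; rewrite /mnormalize mut eqe gt_eqF//=.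
by rewrite muleC.
Qed.

(** * Moments and symmetries of the reference measures *)

Section ReferenceMeasure.
Context (R : realType).
Local Notation mu := (@lebesgue_measure R).

Definition body_coord (s : body_kind) (t : R) : R :=
  match s with Ball => t ^+ 2 | Simplex => t end.

Definition body_density (s : body_kind) (t : R) : R :=
  match s with Ball => 1 | Simplex => ppow t (- 2^-1) end.

Definition body_factor (s : body_kind) (q : nat) : R :=
  match s with Ball => beta_mass (-1 : R) q | Simplex => 2 * beta_mass (0 : R) q end.

Lemma body_factor_gt0 s q : 0 < body_factor s q.
Proof.
case: s; first by apply: beta_mass_gt0; lra.
by rewrite mulr_gt0// beta_mass_gt0.
Qed.

Lemma measurable_body_coord s : measurable_fun [set: R] (body_coord s).
Proof.
case: s; last exact: measurable_id.
change (measurable_fun [set: R] (fun t : R => t ^+ 2)).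
exact: measurable_funX.
Qed.

Lemma measurable_body_density s : measurable_fun [set: R] (body_density s).
Proof. by case: s; [exact: measurable_cst|exact: measurable_ppow]. Qed.

Definition slack (s : body_kind) N (x : N.-tuple R) : R :=
  1 - \sum_i body_coord s (tnth x i).

Definition body_monom s N (a : 'I_N -> nat) (j : nat) (x : N.-tuple R) : R :=
  (\prod_i body_coord s (tnth x i) ^+ a i) * slack s x ^+ j.

Lemma measurable_body_monom s N a j :
  measurable_fun [set: _] (@body_monom s N a j).
Proof.
have mt i : measurable_fun [set: N.-tuple R] (fun x => body_coord s (tnth x i)).
  case: s => /=; [apply: measurable_funX|]; exact: measurable_tnth.
apply: measurable_funM.
  by apply: measurable_prod => i _; exact: measurable_funX.
by apply: measurable_funX; apply: measurable_funB => //; exact: measurable_sum.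
Qed.

Lemma body_coord_ge0 s N (x : N.-tuple R) i :
  body s N x -> 0 <= body_coord s (tnth x i).
Proof. by case: s => /= [_|[x0 _]]; [exact: sqr_ge0|exact: x0]. Qed.

Lemma slack_ge0 s N (x : N.-tuple R) : body s N x -> 0 <= slack s x.
Proof. by rewrite /slack subr_ge0; case: s => /= [|[_]]. Qed.

Lemma body_monom_ge0 s N a j (x : N.-tuple R) :
  body s N x -> 0 <= body_monom s a j x.
Proof.
move=> bx; rewrite mulr_ge0// ?exprn_ge0 ?slack_ge0//.
by apply: prodr_ge0 => i _; rewrite exprn_ge0// body_coord_ge0.
Qed.

Lemma ppow_half (y : R) (j : nat) : 0 <= y ->
  ppow y (2^-1 - 1 + j%:R) = y `^ (- 2^-1) * y ^+ j.
Proof.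
rewrite le_eqVlt => /predU1P[<-|y0].
  by rewrite /ppow ltxx powR0 ?mul0r// oppr_eq0 invr_eq0.
rewrite /ppow y0 powRD ?(gt_eqF y0) ?implybT// powR_mulrn ?(ltW y0)//.
by congr (_ `^ _ * _); field.
Qed.

(** The identity holds off the body too: there the slack is negative or, for the simplex, some
    coordinate is, and the corresponding truncated power vanishes. On the boundary both sides use
    the value 0 for a negative power of 0. *)
Lemma weight_body_monom s N a j (x : N.-tuple R) :
  (body_monom s a j \_ (body s N)) x * (@weight R s N \_ (body s N)) x =
  dirichlet_fun (body_coord s) (body_density s) a j 1 x.
Proof.
rewrite !patchE /dirichlet_fun; case: ifPn => [/[!inE] bx|].
  have sl := slack_ge0 bx.
  rewrite ppow_half// /body_monom -/(slack s x) big_split/=.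
  have -> : weight s x = slack s x `^ (- 2^-1) * \prod_i body_density s (tnth x i).
    case: s bx sl => /= [_ _|[x0 _] _]; first by rewrite [X in _ * X]big1 ?mulr1.
    congr (_ * _); apply: eq_bigr => i _; rewrite /ppow; case: ifPn => //.
    rewrite -leNgt => xi0.
    have -> : tnth x i = 0 by apply/le_anti; rewrite xi0 x0.
    by rewrite powR0// oppr_eq0 invr_eq0.
  by move: (_ `^ _) => u; ring.
rewrite notin_setE mul0r => nbx; apply/esym.
have [S1|S1] := leP (\sum_i body_coord s (tnth x i)) 1; last first.
  by rewrite /ppow ifF ?mulr0//; apply/negbTE; rewrite -leNgt subr_le0 ltW.
case: s nbx S1 => /= nbx S1; first by rewrite S1 in nbx.
have [i xi0] : exists i, tnth x i < 0.
  apply: contrapT => /forallNP h; apply: nbx; split => // i.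
  by rewrite leNgt; apply/negP; exact: h.
by rewrite (bigD1 i)//= /ppow ltNge ltW//= !mul0r.
Qed.

Lemma body_dirichlet_integral s N (a : 'I_N -> nat) j :
  (\int[lebesgue R N]_x
     (dirichlet_fun (body_coord s) (body_density s) a j 1 x)%:E =
   (\prod_(i < N) body_factor s i.+1 * dirichlet_ratio R a j)%:E)%E.
Proof.
rewrite (@dirichlet_integral R _ _ (body_factor s)).
- by rewrite /ppow ltr01 powR1 mulr1.
- exact: body_factor_gt0.
- exact: measurable_body_coord.
- exact: measurable_body_density.
- by case: s => t //=; exact: ppow_ge0.
- case: s => t /=; first by rewrite sqr_ge0.
  by rewrite /ppow; case: ifPn; [move=> /ltW|rewrite eqxx].
- case: s => c q k j0 c0 q0; first exact: ball_kernel_integral.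
  exact: simplex_kernel_integral.
Qed.

Lemma dirichlet_ratio0 N : dirichlet_ratio R (fun _ : 'I_N => 0%N) 0 = 1.
Proof.
rewrite /dirichlet_ratio (eq_bigr (fun=> 1)) => [|i _]; last exact: pochhammer0.
by rewrite !big1_eq !pochhammer0 mulr1 divr1.
Qed.

Let total s N := \prod_(i < N) body_factor s i.+1.

Let total_gt0 s N : 0 < total s N.
Proof. by apply: prodr_gt0 => i _; exact: body_factor_gt0. Qed.

(** The mass is finite and positive, so [mnormalize] divides by it instead of falling back on its
    default measure. *)
Lemma weighted_lebesgueT s N :
  weighted_lebesgue s [set: N.-tuple R] = (total s N)%:E.
Proof.
rewrite /weighted_lebesgue setIT integral_mkcond.
have := body_dirichlet_integral s (fun _ : 'I_N => 0%N) 0.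
rewrite dirichlet_ratio0 mulr1 => <-; apply: eq_integral => x _.
rewrite -weight_body_monom !patchE; case: ifPn => _; last by rewrite mul0r.
by rewrite /body_monom big1 ?expr0 ?mul1r// => i _; rewrite expr0.
Qed.

Definition ref_density s N (x : N.-tuple R) : R :=
  (total s N)^-1 * (@weight R s N \_ (body s N)) x.

Lemma measurable_ref_density s N :
  measurable_fun [set: _] (@ref_density s N).
Proof.
apply: measurable_funM => //.
apply/(measurable_restrictT _ _).1; first exact: measurable_body.
by apply: measurable_funTS; exact: measurable_weight.
Qed.

Lemma ref_density_ge0 s N x : 0 <= @ref_density s N x.
Proof.
rewrite mulr_ge0 ?invr_ge0 ?(ltW (total_gt0 _ _))// patchE.
by case: ifP => // _; exact: weight_ge0.
Qed.

Lemma ref_probE s N A : measurable A ->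
  ref_prob R s N A = (\int[lebesgue R N]_(x in A) (ref_density s x)%:E)%E.
Proof.
move=> mA; have tE := weighted_lebesgueT s N.
transitivity ((total s N)^-1%:E * weighted_lebesgue s A)%E.
  exact: (mnormalizeE _ _ (total_gt0 s N) tE).
rewrite /weighted_lebesgue.
under [RHS]eq_integral do rewrite /ref_density EFinM.
rewrite ge0_integralZl_EFin//=.
- congr (_ * _)%E; rewrite setIC integral_mkcondr.
  by apply: eq_integral => x _; rewrite !patchE; case: ifP.
- by move=> x _; rewrite lee_fin patchE; case: ifP => // _; exact: weight_ge0.
- apply/measurable_EFinP/measurable_funTS.
  apply/(measurable_restrictT _ _).1; first exact: measurable_body.
  by apply: measurable_funTS; exact: measurable_weight.
- by rewrite invr_ge0 ltW.
Qed.

Lemma ge0_integral_ref_prob s N (f : N.-tuple R -> \bar R) :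
  measurable_fun [set: _] f -> (forall x, 0 <= f x)%E ->
  (\int[ref_prob R s N]_x f x =
   \int[lebesgue R N]_x (f x * (ref_density s x)%:E))%E.
Proof.
apply: ge0_integral_density.
- exact: measurable_ref_density.
- exact: ref_density_ge0.
- by move=> A mA; exact: ref_probE.
Qed.

(** Powers of the slack are included because, for the ball, the slack is the square of the
    coordinate added by the lift to the sphere. *)
Lemma ref_prob_moment s N (a : 'I_N -> nat) j :
  \int[ref_prob R s N]_(x in body s N) body_monom s a j x =
  dirichlet_ratio R a j.
Proof.
rewrite Rintegral_mkcond /Rintegral ge0_integral_ref_prob.
- have t0 := total_gt0 s N.
  transitivity (fine ((total s N)^-1%:E * (\int[lebesgue R N]_x
     (dirichlet_fun (body_coord s) (body_density s) a j 1 x)%:E))%E).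
    congr fine; rewrite -ge0_integralZl_EFin//=.
    + apply: eq_integral => x _.
      by rewrite -weight_body_monom -!EFinM; congr EFin; rewrite mulrCA.
    + move=> x _; rewrite lee_fin -weight_body_monom mulr_ge0// patchE.
        by case: ifPn => // /[!inE]; exact: body_monom_ge0.
      by case: ifP => // _; exact: weight_ge0.
    + apply/measurable_EFinP; apply: measurable_dirichlet_fun.
        exact: measurable_body_coord.
      exact: measurable_body_density.
    + by rewrite invr_ge0 ltW.
  by rewrite body_dirichlet_integral -EFinM/= mulKf// gt_eqF.
- apply/measurable_EFinP/(measurable_restrictT _ _).1; first exact: measurable_body.
  by apply: measurable_funTS; exact: measurable_body_monom.
- move=> x; rewrite lee_fin patchE; case: ifPn => // /[!inE].
  exact: body_monom_ge0.
Qed.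

Definition flip N (i : 'I_N) (x : N.-tuple R) : N.-tuple R :=
  [tuple if k == i then - tnth x k else tnth x k | k < N].

Lemma tnth_flip N (i k : 'I_N) x :
  tnth (flip i x) k = if k == i then - tnth x k else tnth x k.
Proof. by rewrite tnth_mktuple. Qed.

Lemma measurable_flip N (i : 'I_N) : measurable_fun [set: _] (flip i).
Proof.
apply/measurable_fun_tnthP => k.
rewrite (_ : _ \o _ = fun x => if k == i then - tnth x k else tnth x k); last first.
  by apply/funext => x /=; rewrite tnth_flip.
case: (k == i); last exact: measurable_tnth.
by apply: measurableT_comp => //; exact: measurable_tnth.
Qed.

Lemma ge0_integralN (h : R -> \bar R) :
  measurable_fun [set: R] h -> (forall t, 0 <= h t)%E ->
  (\int[mu]_t h (- t)%R = \int[mu]_t h t)%E.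
Proof.
move=> mh h0.
have -> : (\int[mu]_t h t = \int[pushforward mu (-%R : measurableTypeR R -> measurableTypeR R)]_t h t)%E.
  by apply: eq_measure_integral => A mA _; exact/esym/lebesgue_measureN.
by rewrite ge0_integral_pushforward//= preimage_setT.
Qed.

Lemma tnth_cons_pt0 N (z : measurableTypeR R * N.-tuple R) :
  tnth (cons_pt z) ord0 = z.1.
Proof. by rewrite (tnth_nth 0). Qed.

Lemma tnth_cons_ptS N (z : measurableTypeR R * N.-tuple R) i :
  tnth (cons_pt z) (lift ord0 i) = tnth z.2 i.
Proof. by rewrite !(tnth_nth 0). Qed.

Lemma ge0_integral_flip N (i : 'I_N) (f : N.-tuple R -> \bar R) :
  measurable_fun [set: _] f -> (forall x, 0 <= f x)%E ->
  (\int[lebesgue R N]_x f (flip i x) = \int[lebesgue R N]_x f x)%E.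
Proof.
elim: N i f => [[]//|N ih] i f mf f0.
have mff : measurable_fun [set: _] (f \o flip i).
  by apply: measurableT_comp => //; exact: measurable_flip.
rewrite [RHS](ge0_integral_lebesgueS mf f0).
rewrite [LHS](ge0_integral_lebesgueS mff (fun x => f0 (flip i x))).
have mfc : measurable_fun [set: _] (f \o @cons_pt R N).
  by apply: measurableT_comp => //; exact: measurable_cons_pt.
have [k ->|->] := unliftP ord0 i.
  apply: eq_integral => t _.
  rewrite -(ih k (fun y => f (cons_pt (t, y)))) //; last first.
    exact: (measurableT_comp mfc (measurable_pair1 _)).
  apply: eq_integral => y _; congr f; apply: eq_from_tnth => l.
  rewrite tnth_flip; have [l' ->|->] := unliftP ord0 l.
    by rewrite (inj_eq lift_inj) !tnth_cons_ptS tnth_flip.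
  by rewrite (negbTE (neq_lift _ _)) !tnth_cons_pt0.
rewrite -(ge0_integralN (h := fun t => \int[lebesgue R N]_y f (cons_pt (t, y)))%E).
- apply: eq_integral => t _; apply: eq_integral => y _; congr f.
  apply: eq_from_tnth => l; rewrite tnth_flip.
  have [l' ->|->] := unliftP ord0 l.
    by rewrite eq_sym (negbTE (neq_lift _ _)) !tnth_cons_ptS.
  by rewrite eqxx !tnth_cons_pt0.
- exact: (measurable_fun_fubini_tonelli_F (m2 := lebesgue R N) _ mfc
    (fun z => f0 (cons_pt z))).
- by move=> t; exact: integral_ge0.
Qed.

Lemma ref_prob_ball_odd N (i : 'I_N) (g : N.-tuple R -> R) :
  measurable_fun [set: _] g -> (forall x, g (flip i x) = - g x) ->
  \int[ref_prob R Ball N]_(x in body Ball N) g x = 0.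
Proof.
move=> mg gN; rewrite Rintegral_mkcond /Rintegral.
pose h := g \_ (body Ball N).
have body_flip x : body Ball N (flip i x) = body Ball N x.
  rewrite /body/=; congr (is_true (_ <= _)); apply: eq_bigr => k _.
  by rewrite tnth_flip; case: ifP => // _; rewrite sqrrN.
have in_body_flip x : (flip i x \in body Ball N) = (x \in body Ball N).
  by apply/idP/idP; rewrite !inE body_flip.
have mh : measurable_fun [set: _] h.
  apply/(measurable_restrictT _ _).1; first exact: measurable_body.
  exact: measurable_funTS.
have hN x : h (flip i x) = - h x.
  by rewrite /h !patchE in_body_flip; case: ifP; rewrite ?gN ?oppr0.
have dens_flip x : ref_density Ball (flip i x) = ref_density Ball x.
  rewrite /ref_density !patchE in_body_flip; case: ifP => // _.
  rewrite /weight; congr (_ * ((1 - _) `^ _)).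
  by apply: eq_bigr => k _; rewrite tnth_flip; case: ifP => // _; rewrite sqrrN.
change (fine (\int[ref_prob R Ball N]_x (EFin \o h) x)%E = 0).
rewrite integralE.
have mp : measurable_fun [set: _] ((EFin \o h)^\+)%E.
  by apply: measurable_funepos; exact/measurable_EFinP.
have mn : measurable_fun [set: _] ((EFin \o h)^\-)%E.
  by apply: measurable_funeneg; exact/measurable_EFinP.
(* The reflection exchanges the positive and the negative part and preserves the density. If the two
   integrals are infinite, their difference is still mapped to 0 by [fine]. *)
have -> : (\int[ref_prob R Ball N]_x (EFin \o h)^\+ x =
           \int[ref_prob R Ball N]_x (EFin \o h)^\- x)%E.
  rewrite !ge0_integral_ref_prob//.
  rewrite -(@ge0_integral_flip N i).
  - apply: eq_integral => x _; rewrite dens_flip; congr (_ * _)%E.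
    by rewrite funeposE funenegE /= hN.
  - by apply: emeasurable_funM => //; apply/measurable_EFinP; exact: measurable_ref_density.
  - by move=> x; rewrite mule_ge0// lee_fin ref_density_ge0.
by case: (\int[_]_x _)%E => [r| |]//=; rewrite subrr.
Qed.

End ReferenceMeasure.

(** * Gegenbauer kernels *)

Section GegenbauerKernel.
Context (R : realFieldType) (n : nat).
Variable L : {poly R} -> R.
Hypothesis LD : forall p q, L (p + q) = L p + L q.
Hypothesis LZ : forall a p, L (a *: p) = a * L p.
Hypothesis L1 : L 1 = 1.
Hypothesis LX : L 'X = 0.
Hypothesis LXSS : forall i, (n.+2 + i)%:R * L 'X^(i.+2) = i.+1%:R * L 'X^i.

Let L0 : L 0 = 0.
Proof. by rewrite -(scale0r (0 : {poly R})) LZ mul0r. Qed.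

Let LN p : L (- p) = - L p.
Proof. by rewrite -scaleN1r LZ mulN1r. Qed.

Let LB p q : L (p - q) = L p - L q.
Proof. by rewrite LD LN. Qed.

Let Ln (k : nat) p : L (k%:R * p) = k%:R * L p.
Proof. by rewrite mulr_natl -scaler_nat LZ. Qed.

Let scale_natE (k : nat) (p : {poly R}) : (k%:R : R) *: p = k%:R * p.
Proof. by rewrite scaler_nat mulr_natl. Qed.

Let L_sum (I : Type) (s : seq I) (P : pred I) (F : I -> {poly R}) :
  L (\sum_(i <- s | P i) F i) = \sum_(i <- s | P i) L (F i).
Proof. exact: (big_morph L LD L0). Qed.

Let deriv_nat (k : nat) : (k%:R : {poly R})^`() = 0.
Proof. by rewrite -(rmorph_nat polyC) derivC. Qed.

(* Integration by parts against the weight (1 - t^2)^((n - 1) / 2). *)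
Let L_stein p : n.+1%:R * L ('X * p) = L ((1 - 'X^2) * p^`()).
Proof.
have mono i : n.+1%:R * L ('X * 'X^i) = L ((1 - 'X^2) * ('X^i)^`()).
  rewrite derivXn -exprS; case: i => [|i].
    by rewrite mulr0n mulr0 L0 expr1 LX mulr0.
  transitivity (L (i.+1%:R * 'X^i - i.+1%:R * 'X^(i.+2))).
    by rewrite LB !Ln -LXSS; ring.
  by congr L; rewrite succnK -mulr_natl !exprS; ring.
rewrite -[p]coefK poly_def mulr_sumr raddf_sum mulr_sumr !L_sum mulr_sumr /=.
apply: eq_bigr => i _; rewrite derivZ -!scalerAr !LZ -mono.
by rewrite mulrCA.
Qed.

(* Zonal polynomials of the sphere of dimension n + 1, normalized by 1 at 1. *)
Fixpoint gegenbauer_pair (j : nat) : {poly R} * {poly R} :=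
  if j is j'.+1 then
    let: (g, h) := gegenbauer_pair j' in
    (h, (j' + n).+1%:R^-1 *:
        ((2 * j' + n).+2%:R * ('X * h) - j'.+1%:R * g))
  else (1, 'X).

Definition gegenbauer j := (gegenbauer_pair j).1.

Let zonal0 : gegenbauer 0 = 1. Proof. by []. Qed.
Let zonal1 : gegenbauer 1 = 'X. Proof. by []. Qed.

Let zonal_pairE j : gegenbauer_pair j = (gegenbauer j, gegenbauer j.+1).
Proof. by rewrite /gegenbauer /=; case: (gegenbauer_pair j). Qed.

Let zonalSSE j : gegenbauer j.+2 = (j + n).+1%:R^-1 *:
  ((2 * j + n).+2%:R * ('X * gegenbauer j.+1) - j.+1%:R * gegenbauer j).
Proof. by rewrite {1}/gegenbauer /= zonal_pairE. Qed.

Let zonalSS j : (j + n).+1%:R * gegenbauer j.+2 =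
  (2 * j + n).+2%:R * ('X * gegenbauer j.+1) - j.+1%:R * gegenbauer j.
Proof.
by rewrite zonalSSE -scale_natE scalerA divff ?scale1r// pnatr_eq0.
Qed.

Let size_zonal j : (size (gegenbauer j) <= j.+1)%N.
Proof.
suff : (size (gegenbauer j) <= j.+1)%N /\ (size (gegenbauer j.+1) <= j.+2)%N by case.
elim: j => [|j [ih1 ih2]].
  by rewrite zonal0 zonal1 size_poly1 size_polyX.
split=> //; rewrite zonalSSE -(scale_natE (2 * j + n).+2) -(scale_natE j.+1).
apply: leq_trans (size_scale_leq _ _) _.
apply: leq_trans (size_polyD _ _) _; rewrite geq_max size_polyN.
apply/andP; split; apply: leq_trans (size_scale_leq _ _) _.
  by apply: leq_trans (size_polyMleq _ _) _; rewrite size_polyX.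
by apply: leq_trans ih1 _; rewrite !ltnS leqW.
Qed.

(** The two ladder relations have to be proved together: the second at [j.+1] comes from the first
    at [j], and the first at [j.+1] from both at [j], by differentiating the three-term recurrence.
    The first one turns [L_stein] into a recursion for the values [L (gegenbauer j)]. *)
Let zonal_deriv j :
  (1 - 'X^2) * (gegenbauer j.+1)^`() = j.+1%:R * (gegenbauer j - 'X * gegenbauer j.+1) /\
  (1 - 'X^2) * (gegenbauer j)^`() = (j + n)%:R * ('X * gegenbauer j - gegenbauer j.+1).
Proof.
elim: j => [|j [ih1 ih2]].
  rewrite zonal0 zonal1 derivX derivC; split; ring.
have r0 : (j + n).+1%:R != 0 :> {poly R}.
  by rewrite -(rmorph_nat polyC) polyC_eq0 pnatr_eq0.
have rec := zonalSS j.
have drec : (j + n).+1%:R * (gegenbauer j.+2)^`() =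
    (2 * j + n).+2%:R * (gegenbauer j.+1 + 'X * (gegenbauer j.+1)^`())
    - j.+1%:R * (gegenbauer j)^`().
  have := congr1 (@deriv R) rec.
  by rewrite derivB !derivM !deriv_nat derivX !mul0r !add0r mul1r.
split; last first.
  rewrite ih1; transitivity ('X * ((j + n).+1%:R * gegenbauer j.+1)
    - (j + n).+1%:R * gegenbauer j.+2); first by rewrite rec; ring.
  by rewrite addSn; ring.
apply: (mulfI r0).
transitivity ((1 - 'X^2) * ((j + n).+1%:R * (gegenbauer j.+2)^`())); first by ring.
rewrite drec.
transitivity ((2 * j + n).+2%:R *
   ((1 - 'X^2) * gegenbauer j.+1 + 'X * ((1 - 'X^2) * (gegenbauer j.+1)^`()))
  - j.+1%:R * ((1 - 'X^2) * (gegenbauer j)^`())); first by ring.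
rewrite ih1 ih2.
transitivity (j.+2%:R * ((j + n).+1%:R * gegenbauer j.+1
   - 'X * ((j + n).+1%:R * gegenbauer j.+2))); last by ring.
by rewrite rec; ring.
Qed.

(** Integration by parts applied to [gegenbauer i.+1], with the three-term recurrence, makes
    [L (gegenbauer i.+2)] a multiple of [L (gegenbauer i)] with a factor [i]. That factor starts the
    even chain at 0, and [LX] starts the odd one. *)
Let L_zonal j : L (gegenbauer j.+1) = 0.
Proof.
have step i : L (gegenbauer i.+2) =
    i.+1%:R * i%:R / ((i + n).+1%:R * (i + n).+2%:R) * L (gegenbauer i).
  have r1 : (i + n).+1%:R != 0 :> R by rewrite pnatr_eq0.
  have r2 : (i + n).+2%:R != 0 :> R by rewrite pnatr_eq0.
  have [d1 _] := zonal_deriv i.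
  have := L_stein (gegenbauer i.+1); rewrite d1 Ln LB => st.
  have LXz : (i + n).+2%:R * L ('X * gegenbauer i.+1) = i.+1%:R * L (gegenbauer i).
    transitivity (n.+1%:R * L ('X * gegenbauer i.+1) + i.+1%:R * L ('X * gegenbauer i.+1)).
      by ring.
    by rewrite st; ring.
  apply: (mulfI r1); rewrite -Ln zonalSS LB !Ln.
  have -> : L ('X * gegenbauer i.+1) = i.+1%:R * L (gegenbauer i) / (i + n).+2%:R.
    by rewrite -LXz mulrAC mulfV ?mul1r.
  move: (L _) => l; field.
  have := ler0n R i; have := ler0n R n => n0 i0.
  by apply/andP; split; apply: lt0r_neq0; lra.
suff : L (gegenbauer j.+1) = 0 /\ L (gegenbauer j.+2) = 0 by case.
elim: j => [|j [ih1 ih2]]; last by split=> //; rewrite step ih1 mulr0.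
by rewrite step mulr0 mul0r mul0r zonal1 LX.
Qed.

(** [d j] is the dimension of the space of spherical harmonics of degree [j] on the sphere of
    dimension n + 1. [em j] is [e j.-1], set to 0 at [j = 0]; in these terms the recurrence takes a
    form adapted to telescoping. *)
Let e (j : nat) : R := 'C(n + j, n)%:R.
Let em (j : nat) : R := if j is i.+1 then e i else 0.
Let d j := e j + em j.

Let e_gt0 j : 0 < e j. Proof. by rewrite ltr0n bin_gt0 leq_addr. Qed.
Let em_ge0 j : 0 <= em j.
Proof. by case: j => [|j]; [exact: lexx|exact/ltW/e_gt0]. Qed.
Let d_gt0 j : 0 < d j.
Proof. by rewrite /d ltr_pwDl ?e_gt0 ?em_ge0. Qed.

Let eS j : j.+1%:R * e j.+1 = (j + n).+1%:R * e j.
Proof.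
rewrite -!natrM; congr (_%:R); rewrite addnS [(j + n)%N]addnC.
have := mul_bin_down (n + j).+1 n; rewrite succnK => ->.
by rewrite -addnS addKn.
Qed.

Let zonal_rec j : d j *: ('X * gegenbauer j) = e j *: gegenbauer j.+1 + em j *: gegenbauer j.-1.
Proof.
case: j => [|j].
  by rewrite /d /em addr0 scale0r addr0 zonal0 mulr1.
have j0 : j.+1%:R != 0 :> R by rewrite pnatr_eq0.
apply: (scalerI j0).
transitivity (e j *: ((2 * j + n).+2%:R * ('X * gegenbauer j.+1))).
  rewrite -scale_natE !scalerA; congr (_ *: _).
  by rewrite /d /= mulrDr eS; ring.
transitivity (e j *: ((j + n).+1%:R * gegenbauer j.+2 + j.+1%:R * gegenbauer j)).
  by rewrite zonalSS subrK.
rewrite -!scale_natE !scalerDr !scalerA eS /=.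
by congr (_ *: _ + _ *: _); exact: mulrC.
Qed.

(** Multiplication by 'X is self-adjoint for the form defined by [L], so the recurrence computes row
    [i.+1] of the Gram matrix from the rows [i] and [i.-1]. Row 0 is [L_zonal]. *)
Let ortho i j : L (gegenbauer i * gegenbauer j) = (i == j)%:R / d i.
Proof.
suff : (forall k, L (gegenbauer i * gegenbauer k) = (i == k)%:R / d i) /\
       (forall k, L (gegenbauer i.+1 * gegenbauer k) = (i.+1 == k)%:R / d i.+1) by case.
have dn k : d k != 0 by rewrite gt_eqF.
have L0z k : L (gegenbauer 0 * gegenbauer k) = (0 == k)%:R / d 0.
  rewrite zonal0 mul1r; case: k => [|k]; last by rewrite L_zonal mul0r.
  by rewrite zonal0 L1 /d /em /e !addr0 addn0 binn divr1.
have rowS a b : e a * L (gegenbauer a.+1 * gegenbauer b) =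
    d a / d b * (e b * L (gegenbauer a * gegenbauer b.+1) + em b * L (gegenbauer a * gegenbauer b.-1))
    - em a * L (gegenbauer a.-1 * gegenbauer b).
  apply/eqP; rewrite eq_sym subr_eq eq_sym; apply/eqP.
  transitivity (L ((d a *: ('X * gegenbauer a)) * gegenbauer b)).
    by rewrite zonal_rec mulrDl LD -!scalerAl !LZ.
  transitivity (d a / d b * L (gegenbauer a * (d b *: ('X * gegenbauer b)))).
    rewrite -scalerAl -scalerAr !LZ mulrA divfK//; congr (_ * L _); ring.
  by rewrite zonal_rec mulrDr LD -!scalerAr !LZ.
elim: i => [|i [ih1 ih2]].
  split=> // k; apply: (mulfI (lt0r_neq0 (e_gt0 0))); rewrite rowS !L0z.
  case: k => [|[|k]]; rewrite /em /= !(mul0r, mulr0, oppr0, addr0, add0r)//.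
  by field; rewrite !dn.
split=> // k; apply: (mulfI (lt0r_neq0 (e_gt0 i.+1))); rewrite rowS !ih2 ih1.
case: k => [|k]; rewrite /= !eqSS.
  case: i {ih1 ih2} => [|i] /=; last by rewrite /em !(mul0r, mulr0) addr0 mulr0 subrr.
  by rewrite !(mul0r, mulr0) addr0; field; rewrite !dn.
have [->|ik] := eqVneq i k.+1.
  rewrite (_ : (k.+2 == k) = false); last by lia.
  by rewrite /= !(mul0r, mulr0) addr0; field; rewrite !dn.
have [<-|ik1] := eqVneq i.+1 k.
  by rewrite /= !(mul0r, mulr0) add0r subr0; field; rewrite !dn.
by rewrite !(mul0r, mulr0) addr0 mulr0 subrr.
Qed.

(** The polynomial [s] is the sum of the reproducing kernels [K j] at the point 1 of the polynomials
    of degree at most [j], for [j] up to [r]. Telescoping reduces the numerator to the sum [S0] of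
    the [e j]. The denominator is at least [Q], their second moment in [r.+1 - j], which
    Cauchy-Schwarz bounds below by the first moment [A], known exactly. *)
Lemma gegenbauer_kernel (r : nat) : (0 < r)%N ->
  exists s : {poly R}, [/\ (size s <= r.+1)%N, 0 < L (s ^+ 2) &
    L ((1 - 'X) * s ^+ 2) * r%:R ^+ 2 <= n.+2%:R ^+ 2 * L (s ^+ 2)].
Proof.
move=> r0.
pose K j := \sum_(i < j.+1) d i *: gegenbauer i.
pose s := \sum_(i < r.+1) ((r.+1 - i)%:R * d i) *: gegenbauer i.
have sK : s = \sum_(j < r.+1) K j.
  rewrite /s; elim: (r) => [|q ih].
    by rewrite !big_ord_recl !big_ord0 !addr0 /K big_ord_recl big_ord0 addr0 subn0
      mul1r.
  rewrite [RHS]big_ord_recr /= -ih (_ : K q.+1 =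
    \sum_(i < q.+1) d i *: gegenbauer i + d q.+1 *: gegenbauer q.+1); last first.
    by rewrite /K big_ord_recr.
  rewrite [LHS]big_ord_recr /= addrA -big_split/= subSnn mul1r; congr (_ + _).
  apply: eq_bigr => i _; rewrite -scalerDl; congr (_ *: _).
  by rewrite subSn 1?ltnW// -natr1 mulrDl mul1r.
(* Christoffel-Darboux formula at the point 1. *)
have KE j : (1 - 'X) * K j = e j *: (gegenbauer j - gegenbauer j.+1).
  elim: j => [|j ih].
    rewrite /K big_ord_recl big_ord0 addr0 /d /em /e addr0 addn0 binn !scale1r.
    by rewrite zonal0 zonal1 mulr1.
  rewrite /K big_ord_recr /= mulrDr -/(K j) ih mulrBl mul1r -scalerAr zonal_rec.
  by rewrite /d /= scalerDl !scalerBr; ring.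
(* This holds for every [i]: beyond degree [r] the truncated subtraction gives 0. The value at
   [i = r.+1] is used in the telescoping below, where consecutive values differ by exactly 1. *)
have Lz i : L (gegenbauer i * s) = (r.+1 - i)%:R.
  rewrite /s mulr_sumr L_sum.
  under eq_bigr => k _ do rewrite -scalerAr LZ ortho.
  have [ir|ir] := ltnP i r.+1.
    rewrite (bigD1 (Ordinal ir))//= eqxx big1 ?addr0.
      by rewrite mul1r mulfK// gt_eqF.
    move=> k; rewrite -val_eqE /= eq_sym => /negbTE ->.
    by rewrite mul0r mulr0.
  rewrite big1; first by move: ir; rewrite -subn_eq0 => /eqP ->.
  move=> k _; rewrite gtn_eqF ?mul0r ?mulr0//.
  exact: leq_trans (ltn_ord k) ir.
pose S0 := \sum_(j < r.+1) e j.
have Ls2 : L (s ^+ 2) = \sum_(i < r.+1) (r.+1 - i)%:R ^+ 2 * d i.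
  rewrite expr2 {1}/s mulr_suml L_sum; apply: eq_bigr => i _.
  by rewrite -scalerAl LZ Lz mulrAC.
have L1s2 : L ((1 - 'X) * s ^+ 2) = S0.
  transitivity (L ((\sum_(j < r.+1) (1 - 'X) * K j) * s)).
    by rewrite -mulr_sumr -sK expr2 mulrA.
  rewrite mulr_suml L_sum; apply: eq_bigr => j _.
  rewrite KE -scalerAl LZ mulrBl LB !Lz.
  by rewrite subSS subSn ?mulrSr; [ring|rewrite -ltnS].
pose Q := \sum_(j < r.+1) (r.+1 - j)%:R ^+ 2 * e j.
pose A := \sum_(j < r.+1) (r.+1 - j)%:R * e j.
have S0_gt0 : 0 < S0.
  by rewrite /S0 big_ord_recl ltr_pwDl// sumr_ge0// => i _; exact/ltW.
have QL : Q <= L (s ^+ 2).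
  rewrite Ls2 /Q; apply: ler_sum => i _; apply: ler_wpM2l; first exact: sqr_ge0.
  by rewrite /d lerDl.
(* Both sums are binomial coefficients by the hockey-stick identity, and their quotient is linear in
   [r]: this is the origin of the ratio of [n.+2] to [r]. *)
have AE : n.+2%:R * A = (n + r).+2%:R * S0.
  have S0E q : \sum_(j < q.+1) e j = 'C(n + q.+1, n.+1)%:R.
    elim: q => [|q ih]; first by rewrite big_ord_recl big_ord0 /e addn0 addn1 !binn addr0.
    by rewrite big_ord_recr /= ih /e -natrD -binS -addnS.
  have AE q : \sum_(j < q.+1) (q.+1 - j)%:R * e j = 'C(n + q.+2, n.+2)%:R.
    elim: q => [|q ih].
      by rewrite big_ord_recl big_ord0 subn0 mul1r /e addn0 addn2 !binn addr0.
    transitivity (\sum_(j < q.+1) (q.+1 - j)%:R * e j + \sum_(j < q.+2) e j).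
      rewrite big_ord_recr [\sum_(j < q.+2) _]big_ord_recr /= addrA -big_split/=.
      rewrite subSnn mul1r; congr (_ + _); apply: eq_bigr => i _.
      by rewrite subSn 1?ltnW// -natr1 mulrDl mul1r.
    by rewrite ih S0E -natrD -binS -addnS.
  rewrite /A /S0 AE S0E -!natrM; congr (_%:R).
  by have := mul_bin_diag (n + r.+2) n.+1; rewrite addnS succnK addnS => ->.
(* Cauchy-Schwarz for the weights [e j], obtained from a weighted variance. *)
have CS : A ^+ 2 <= S0 * Q.
  rewrite -subr_ge0 -(pmulr_rge0 _ S0_gt0).
  have -> : S0 * (S0 * Q - A ^+ 2) =
      \sum_(j < r.+1) e j * (S0 * (r.+1 - j)%:R - A) ^+ 2.
    have expand (u v : R) : \sum_(j < r.+1) e j * (u * (r.+1 - j)%:R - v) ^+ 2 =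
        u ^+ 2 * Q - 2 * u * v * A + v ^+ 2 * S0.
      rewrite /Q /A /S0 !mulr_sumr -sumrB -big_split/=.
      by apply: eq_bigr => j _; ring.
    by rewrite expand; ring.
  by apply: sumr_ge0 => j _; rewrite mulr_ge0 ?sqr_ge0// ltW.
have Q_gt0 : 0 < Q.
  rewrite /Q big_ord_recl ltr_pwDl//; first by rewrite mulr_gt0// exprn_gt0// ltr0n.
  by rewrite sumr_ge0// => i _; rewrite mulr_ge0 ?sqr_ge0// ltW.
exists s; split.
- apply: leq_trans (size_sum _ _ _) _; apply/bigmax_leqP => i _.
  apply: leq_trans (size_scale_leq _ _) _.
  exact: leq_trans (size_zonal _) (ltn_ord i).
- exact: lt_le_trans QL.
rewrite L1s2; apply: le_trans (ler_wpM2l (sqr_ge0 _) QL).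
rewrite -(ler_pM2l S0_gt0) [X in _ <= X]mulrCA.
apply: (@le_trans _ _ (n.+2%:R ^+ 2 * A ^+ 2)); last first.
  by apply: ler_wpM2l CS; exact: sqr_ge0.
rewrite -exprMn AE exprMn mulrCA mulrA -expr2 mulrC.
apply: ler_wpM2r; first exact: sqr_ge0.
by rewrite ler_sqr ?nnegrE// ler_nat; lia.
Qed.

End GegenbauerKernel.

(** * Markov inequality on the circle *)

Section CosineMarkov.
Context (R : realType).
Implicit Types (x t : R) (k l h p : nat).

Let cw h : R := if h is 0%N then 1 else 2.

Let cos_prod l h x : 2 * (cos (l%:R * x) * cos (h%:R * x)) =
  cos ((l + h)%:R * x) + cos ((l%:R - h%:R) * x).
Proof.
have -> : (l + h)%:R * x = l%:R * x + h%:R * x by rewrite natrD; ring.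
have -> : (l%:R - h%:R) * x = l%:R * x - h%:R * x by ring.
by rewrite !cosD cosN sinN; ring.
Qed.

(** The Fejer kernel without its normalization, extending sin^2 (l x / 2) / sin^2 (x / 2) by
    continuity. *)
Definition fejer l x : R := \sum_(h < l) cw h * (l - h)%:R * cos (h%:R * x).

Let dirichlet l x : R := \sum_(h < l.+1) cw h * cos (h%:R * x).

Let fejerS l x : fejer l.+1 x = fejer l x + dirichlet l x.
Proof.
rewrite /fejer /dirichlet !big_ord_recr /= subSnn mulr1 addrA -big_split/=.
congr (_ + _); apply: eq_bigr => h _.
by rewrite subSn 1?ltnW// -natr1; ring.
Qed.

Let dirichletE l x :
  (1 - cos x) * dirichlet l x = cos (l%:R * x) - cos (l.+1%:R * x).
Proof.
elim: l => [|l ih].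
  by rewrite /dirichlet big_ord_recl big_ord0 /= !mul0r cos0 !mul1r; ring.
rewrite /dirichlet big_ord_recr mulrDr -/(dirichlet l x) ih /=.
have := cos_prod l.+1 1 x; rewrite addn1 mul1r.
have -> : (l.+1%:R - 1%:R) * x = l%:R * x by rewrite -natr1; ring.
move=> h2; have -> : cos (l.+2%:R * x) =
   2 * (cos (l.+1%:R * x) * cos x) - cos (l%:R * x) by rewrite h2; ring.
ring.
Qed.

Lemma fejerE l x : (1 - cos x) * fejer l x = 1 - cos (l%:R * x).
Proof.
elim: l => [|l ih]; first by rewrite /fejer big_ord0 mul0r cos0; ring.
by rewrite fejerS mulrDr ih dirichletE; ring.
Qed.

Lemma fejer_ge0 l x : 0 <= fejer l x.
Proof.
have [c1|c1] := eqVneq (cos x) 1.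
  apply: sumr_ge0 => h _.
  have s0 : sin x = 0.
    apply/eqP; rewrite -sqrf_eq0 sin2cos2 c1; apply/eqP; ring.
  have -> : cos (h%:R * x) = 1.
    have [] : cos (h%:R * x) = 1 /\ sin (h%:R * x) = 0.
      elim: (nat_of_ord h) => [|j [ih1 ih2]]; first by rewrite mul0r cos0 sin0.
      by rewrite -natr1 mulrDl mul1r cosD sinD ih1 ih2 c1 s0; split; ring.
    by [].
  by rewrite mulr1 mulr_ge0//; case: (nat_of_ord h).
have d0 : 0 < 1 - cos x by rewrite subr_gt0 lt_neqAle c1 cos_le1.
by rewrite -(pmulr_rge0 _ d0) fejerE subr_ge0 cos_le1.
Qed.

Section Nodes.
Variable k : nat.
Hypothesis k0 : (0 < k)%N.

Let node (j : nat) : R := pi * j%:R / k%:R.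

Let kR0 : (k%:R : R) != 0. Proof. by rewrite pnatr_eq0 -lt0n. Qed.

Let avg (F : R -> R) : R := (2 * k%:R)^-1 * \sum_(j < 2 * k) F (node j).

Let cos_sin_pi_nat l : cos (l%:R * pi) = (-1) ^+ l :> R /\ sin (l%:R * pi) = 0 :> R.
Proof.
elim: l => [|l [ih1 ih2]]; first by rewrite mul0r cos0 sin0 expr0.
have -> : l.+1%:R * pi = l%:R * pi + pi :> R by rewrite -natr1; ring.
by rewrite cosDpi sinDpi ih1 ih2 exprS oppr0 mulN1r.
Qed.

Let node_mul j : k%:R * node j = j%:R * pi.
Proof. by rewrite /node; field. Qed.

(* Telescoping after multiplication by 2 sin (m pi / 2k), which is positive. *)
Let sum_cos_node m : (0 < m < 2 * k)%N -> \sum_(j < 2 * k) cos (m%:R * node j) = 0.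
Proof.
move=> /andP[m0 mk].
pose a : R := m%:R * pi / k%:R.
have kp : 0 < k%:R :> R by rewrite ltr0n.
have s0 : 0 < sin (a / 2).
  apply: sin_gt0_pi; rewrite divr_gt0 ?divr_gt0 ?mulr_gt0 ?ltr0n ?pi_gt0//=.
  rewrite /a !ltr_pdivrMr// [m%:R * pi]mulrC -mulrA ltr_pM2l ?pi_gt0//.
  by rewrite -natrM ltr_nat.
have E q : 2 * sin (a / 2) * \sum_(j < q) cos (j%:R * a) =
    sin (q%:R * a - a / 2) + sin (a / 2).
  elim: q => [|q ih]; first by rewrite big_ord0 mul0r add0r sinN; ring.
  rewrite big_ord_recr mulrDr ih /=.
  have -> : q.+1%:R * a - a / 2 = q%:R * a + a / 2 by rewrite -natr1; field.
  by rewrite !sinD cosN sinN; ring.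
have -> : \sum_(j < 2 * k) cos (m%:R * node j) = \sum_(j < 2 * k) cos (j%:R * a).
  by apply: eq_bigr => j _; congr cos; rewrite /node /a; field.
have [c2 s2] := cos_sin_pi_nat (2 * m).
have E2 := E (2 * k)%N.
apply: (@mulfI _ (2 * sin (a / 2))); first by rewrite mulf_neq0// gt_eqF.
rewrite E2 mulr0 (_ : (2 * k)%:R * a = (2 * m)%:R * pi); last first.
  by rewrite /a !natrM; field.
by rewrite sinB c2 s2 exprM sqrrN expr1n expr1n; ring.
Qed.

(** The strict bound on [h] keeps [h + p] below [2 * k], so no nonzero frequency becomes constant on
    the nodes. *)
Let avg_cos_cos h p : (h < k)%N -> (p <= k)%N ->
  cw h * avg (fun x => cos (h%:R * x) * cos (p%:R * x)) = (h == p)%:R.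
Proof.
move=> hk pk; rewrite /avg.
have c0 m : (m < 2 * k)%N -> \sum_(j < 2 * k) cos (m%:R * node j) =
    (m == 0)%:R * (2 * k%:R).
  case: m => [_|m mk]; last by rewrite sum_cos_node// mul0r.
  under eq_bigr do rewrite mul0r cos0.
  by rewrite sumr_const card_ord -mulr_natl mulr1 mul1r natrM.
pose q := if (h <= p)%N then (p - h)%N else (h - p)%N.
have qE x : cos ((h%:R - p%:R) * x) = cos (q%:R * x).
  rewrite /q; case: leqP => hp; last by rewrite natrB// ltnW.
  by rewrite natrB// -cosN -mulNr opprB.
have -> : \sum_(j < 2 * k) cos (h%:R * node j) * cos (p%:R * node j) =
    2^-1 * (\sum_(j < 2 * k) cos ((h + p)%:R * node j) +
            \sum_(j < 2 * k) cos (q%:R * node j)).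
  rewrite -big_split mulr_sumr; apply: eq_bigr => j _ /=.
  by rewrite -qE -cos_prod mulKf.
have hpk : (h + p < 2 * k)%N by lia.
have qk : (q < 2 * k)%N by rewrite /q; case: (leqP h p) => _; lia.
rewrite !c0// addn_eq0.
have -> : (q == 0) = (h == p) by rewrite /q; case: leqP => hp; lia.
case: h hk {hpk qk qE q} => [|h] hk /=.
  by rewrite [p == 0]eq_sym; set b : R := (0 == p)%:R; field.
by set b : R := (h.+1 == p)%:R; field.
Qed.

Let avg_fejer n p : (n <= k)%N -> (p <= k)%N ->
  avg (fun x => fejer n x * cos (p%:R * x)) = (n - p)%:R.
Proof.
move=> nk pk.
have -> : avg (fun x => fejer n x * cos (p%:R * x)) =
    \sum_(h < n) (n - h)%:R *
      (cw h * avg (fun x => cos (h%:R * x) * cos (p%:R * x))).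
  rewrite /avg; under eq_bigr do rewrite /fejer mulr_suml.
  rewrite exchange_big /= mulr_sumr; apply: eq_bigr => h _.
  rewrite !mulr_sumr; apply: eq_bigr => j _; ring.
under eq_bigr => h _ do rewrite avg_cos_cos// ?(leq_trans (ltn_ord h))//.
have [pn|np] := ltnP p n.
  rewrite (bigD1 (Ordinal pn))//= eqxx mulr1 big1 ?addr0// => h.
  by rewrite -val_eqE /= => /negbTE ->; rewrite mulr0.
rewrite big1; first by move: np; rewrite -subn_eq0 => /eqP ->.
by move=> h _; rewrite ltn_eqF ?mulr0//; exact: leq_trans (ltn_ord h) np.
Qed.

(** By [fejerE] each 1 - cos (l t) contains the factor 1 - cos t, and the cofactor of the whole
    difference is a cosine sum with coefficients [B h], up to the weights [cw h]. Each [B h] is an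
    average over the nodes of a function bounded by [M] against a nonnegative Fejer kernel, hence at
    most [M * (k - h)] in absolute value. The weighted sum of the numbers k - h is k^2. *)
Lemma cosine_markov (a : nat -> R) (M t : R) :
  (forall x, `|\sum_(l < k.+1) a l * cos (l%:R * x)| <= M) ->
  `|\sum_(l < k.+1) a l - \sum_(l < k.+1) a l * cos (l%:R * t)|
    <= k%:R ^+ 2 * M * (1 - cos t).
Proof.
move=> gM; pose g x := \sum_(l < k.+1) a l * cos (l%:R * x).
pose B h := \sum_(l < k.+1) a l * (l - h)%:R.
(* At the nodes sin (k x) vanishes, so multiplying by cos (k x) turns the frequency [l] into
   [k - l]. Pairing with the Fejer kernel of order [k - h] then yields the truncated difference
   [l - h]. *)
have BE h : (h < k)%N ->
    B h = avg (fun x => fejer (k - h) x * (cos (k%:R * x) * g x)).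
  move=> hk; rewrite /B /avg /g.
  under [in RHS]eq_bigr do rewrite !mulr_sumr.
  rewrite exchange_big /= mulr_sumr; apply: eq_bigr => l _.
  have lk : (l <= k)%N by rewrite -ltnS.
  have := avg_fejer (leq_subr h k) (leq_subr l k).
  have -> : (k - h - (k - l) = l - h)%N by lia.
  rewrite /avg => <-; rewrite mulrCA mulr_sumr; congr (_ * _).
  apply: eq_bigr => j _; rewrite natrB// mulrBl cosB.
  have [c1 s1] := cos_sin_pi_nat j; rewrite node_mul s1; ring.
have Bbound h : (h < k)%N -> `|B h| <= M * (k - h)%:R.
  move=> hk; rewrite BE// /avg.
  have := avg_fejer (leq_subr h k) (leq0n k); rewrite subn0 => <-.
  rewrite /avg normrM ger0_norm ?invr_ge0 ?mulr_ge0//.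
  rewrite mulrCA ler_wpM2l ?invr_ge0 ?mulr_ge0// mulr_sumr.
  apply: le_trans (ler_norm_sum _ _ _) _; apply: ler_sum => j _.
  rewrite mul0r cos0 mulr1 normrM ger0_norm ?fejer_ge0// mulrC.
  apply: ler_wpM2r; first exact: fejer_ge0.
  rewrite normrM -[M]mul1r; apply: ler_pM => //; last exact: gM.
  by rewrite ler_norml cos_geN1 cos_le1.
have -> : \sum_(l < k.+1) a l - \sum_(l < k.+1) a l * cos (l%:R * t) =
    (1 - cos t) * \sum_(h < k) cw h * cos (h%:R * t) * B h.
  rewrite -sumrB.
  under eq_bigr => l _.
    rewrite -{1}[a l]mulr1 -mulrBr -fejerE mulrCA.
    rewrite (_ : fejer l t = \sum_(h < k) cw h * (l - h)%:R * cos (h%:R * t)).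
      over.
    have lk : (l <= k)%N by rewrite -ltnS.
    rewrite /fejer (big_ord_widen _ (fun h => cw h * (l - h)%:R * cos (h%:R * t)) lk).
    rewrite big_mkcond; apply: eq_bigr => h _; case: ltnP => // lh.
    by move: lh; rewrite -subn_eq0 => /eqP ->; rewrite mulr0 mul0r.
  rewrite -mulr_sumr; congr (_ * _).
  under eq_bigr do rewrite mulr_sumr.
  rewrite exchange_big /=; apply: eq_bigr => h _.
  by rewrite /B mulr_sumr; apply: eq_bigr => l _; ring.
have c1 : 0 <= 1 - cos t by rewrite subr_ge0 cos_le1.
rewrite normrM ger0_norm// mulrC; apply: ler_wpM2r => //.
apply: (@le_trans _ _ (\sum_(h < k) cw h * (M * (k - h)%:R))).
  apply: le_trans (ler_norm_sum _ _ _) _; apply: ler_sum => h _.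
  have cw0 : 0 <= cw h by rewrite /cw; case: (nat_of_ord h).
  rewrite -mulrA normrM ger0_norm//; apply: ler_wpM2l => //.
  rewrite normrM -[X in _ <= X]mul1r; apply: ler_pM => //; last exact: Bbound.
  by rewrite ler_norml cos_geN1 cos_le1.
have sq (q : nat) : \sum_(h < q) cw h * (q - h)%:R = q%:R ^+ 2.
  elim: q => [|q ih]; first by rewrite big_ord0 expr0n.
  have cwsum (i : nat) : \sum_(h < i.+1) cw h = (2 * i + 1)%:R.
    elim: i => [|i ihi]; first by rewrite big_ord_recl big_ord0 addr0.
    by rewrite big_ord_recr ihi /= -natrD; congr (_%:R); lia.
  transitivity (\sum_(h < q) cw h * (q - h)%:R + \sum_(h < q.+1) cw h).
    rewrite !big_ord_recr /= subSnn mulr1 addrA -big_split/=; congr (_ + _).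
    by apply: eq_bigr => h _; rewrite subSn 1?ltnW// -natr1; ring.
  by rewrite ih cwsum natrD natrM -natr1; ring.
rewrite -sq mulr_suml; apply: ler_sum => h _; rewrite le_eqVlt; apply/orP; left.
by apply/eqP; ring.
Qed.

End Nodes.

Definition trig_poly k (T : R -> R) := exists a b : nat -> R,
  forall x, T x = \sum_(l < k.+1) (a l * cos (l%:R * x) + b l * sin (l%:R * x)).

Lemma trig_poly_ext k T T' : T =1 T' -> trig_poly k T -> trig_poly k T'.
Proof. by move=> E [a [b h]]; exists a, b => x; rewrite -E. Qed.

Lemma trig_polyD k T T' :
  trig_poly k T -> trig_poly k T' -> trig_poly k (fun x => T x + T' x).
Proof.
move=> [a [b h]] [a' [b' h']].
exists (fun l => a l + a' l), (fun l => b l + b' l) => x.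
by rewrite h h' -big_split/=; apply: eq_bigr => l _; ring.
Qed.

Lemma trig_polyZ k c T : trig_poly k T -> trig_poly k (fun x => c * T x).
Proof.
move=> [a [b h]]; exists (fun l => c * a l), (fun l => c * b l) => x.
by rewrite h mulr_sumr; apply: eq_bigr => l _; ring.
Qed.

Lemma trig_poly_sum k (I : Type) (s : seq I) (F : I -> R -> R) :
  (forall i, trig_poly k (F i)) -> trig_poly k (fun x => \sum_(i <- s) F i x).
Proof.
move=> hF; elim: s => [|i s ih].
  exists (fun=> 0), (fun=> 0) => x; rewrite big_nil big1// => l _; ring.
apply: (trig_poly_ext (T := fun x => F i x + \sum_(j <- s) F j x)).
  by move=> x; rewrite big_cons.
exact: trig_polyD.
Qed.

Lemma trig_poly_cos k l : (l <= k)%N -> trig_poly k (fun x => cos (l%:R * x)).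
Proof.
move=> lk; exists (fun i => (i == l)%:R), (fun=> 0) => x.
rewrite (bigD1 (inord l)) //= inordK ?ltnS// eqxx mul1r mul0r addr0 big1 ?addr0//.
by move=> i; rewrite -val_eqE /= inordK ?ltnS// => /negbTE ->; rewrite !mul0r addr0.
Qed.

Lemma trig_poly_sin k l : (l <= k)%N -> trig_poly k (fun x => sin (l%:R * x)).
Proof.
move=> lk; exists (fun=> 0), (fun i => (i == l)%:R) => x.
rewrite (bigD1 (inord l)) //= inordK ?ltnS// eqxx mul1r mul0r add0r big1 ?addr0//.
by move=> i; rewrite -val_eqE /= inordK ?ltnS// => /negbTE ->; rewrite !mul0r addr0.
Qed.

Lemma trig_poly_widen k k' T : (k <= k')%N -> trig_poly k T -> trig_poly k' T.
Proof.
move=> kk [a [b h]].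
apply: (trig_poly_ext (T := fun x => \sum_(l <- enum 'I_k.+1)
    (a l * cos (l%:R * x) + b l * sin (l%:R * x)))).
  by move=> x; rewrite h big_enum.
apply: trig_poly_sum => l; have lk : (l <= k')%N.
  by apply: leq_trans kk; rewrite -ltnS.
by apply: trig_polyD; apply: trig_polyZ; [exact: trig_poly_cos|exact: trig_poly_sin].
Qed.

Lemma trig_polyM k T u w : trig_poly k T ->
  trig_poly k.+1 (fun x => (u * cos x + w * sin x) * T x).
Proof.
move=> [a [b h]].
pose F (l : 'I_k.+1) x : R :=
  (a l * u / 2) * (2 * (cos (l%:R * x) * cos x)) +
  (a l * w / 2) * (2 * (cos (l%:R * x) * sin x)) +
  ((b l * u / 2) * (2 * (sin (l%:R * x) * cos x)) +
   (b l * w / 2) * (2 * (sin (l%:R * x) * sin x))).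
apply: (trig_poly_ext (T := fun x => \sum_(l <- enum 'I_k.+1) F l x)).
  move=> x; rewrite h big_enum mulr_sumr; apply: eq_bigr => l _.
  by rewrite /F; field.
apply: trig_poly_sum => l; rewrite /F.
case: l => -[|l] lk /=.
  have c0 : trig_poly k.+1 (fun x => 2 * cos x).
    apply: (trig_poly_ext (T := fun x => 2 * cos (1%:R * x))).
      by move=> x; rewrite mul1r.
    by apply: trig_polyZ; exact: trig_poly_cos.
  have s0 : trig_poly k.+1 (fun x => 2 * sin x).
    apply: (trig_poly_ext (T := fun x => 2 * sin (1%:R * x))).
      by move=> x; rewrite mul1r.
    by apply: trig_polyZ; exact: trig_poly_sin.
  apply: (trig_poly_ext (T := fun x => a 0%N * u / 2 * (2 * cos x) +
     a 0%N * w / 2 * (2 * sin x))).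
    by move=> x; rewrite mul0r cos0 sin0; ring.
  by apply: trig_polyD; exact: trig_polyZ.
have lk2 : (l.+2 <= k.+1)%N by [].
have lk0 : (l <= k.+1)%N by rewrite ltnW// ltnW// ltnW.
have e1 x : l.+2%:R * x = l.+1%:R * x + x :> R by rewrite -natr1; ring.
have e2 x : l%:R * x = l.+1%:R * x - x :> R by rewrite -[l.+1%:R]natr1; ring.
apply: trig_polyD; apply: trig_polyD; apply: trig_polyZ.
- apply: (trig_poly_ext (T := fun x => cos (l.+2%:R * x) + cos (l%:R * x))).
    by move=> x; rewrite e1 e2 !cosD cosN sinN; ring.
  by apply: trig_polyD; exact: trig_poly_cos.
- apply: (trig_poly_ext (T := fun x => sin (l.+2%:R * x) + (-1) * sin (l%:R * x))).
    by move=> x; rewrite e1 e2 !sinD cosN sinN; ring.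
  by apply: trig_polyD; [|apply: trig_polyZ]; exact: trig_poly_sin.
- apply: (trig_poly_ext (T := fun x => sin (l.+2%:R * x) + sin (l%:R * x))).
    by move=> x; rewrite e1 e2 !sinD cosN sinN; ring.
  by apply: trig_polyD; exact: trig_poly_sin.
- apply: (trig_poly_ext (T := fun x => cos (l%:R * x) + (-1) * cos (l.+2%:R * x))).
    by move=> x; rewrite e1 e2 !cosD cosN sinN; ring.
  by apply: trig_polyD; [|apply: trig_polyZ]; exact: trig_poly_cos.
Qed.

(* Near a minimum at 0, [T t - T 0 <= T t + T (- t) - 2 T 0] up to [delta], which
   removes the odd part of [T]. *)
Lemma trig_poly_growth k T (M delta t : R) : trig_poly k T ->
  (forall x, `|T x| <= M) -> (forall x, T 0 - delta <= T x) ->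
  T t - T 0 <= 2 * k%:R ^+ 2 * M * (1 - cos t) + delta.
Proof.
move=> [a [b hT]] TM Tmin.
pose g x := \sum_(l < k.+1) a l * cos (l%:R * x).
have gE x : T x + T (- x) = 2 * g x.
  rewrite !hT -big_split mulr_sumr/=; apply: eq_bigr => l _.
  by rewrite mulrN cosN sinN; ring.
have g0 : \sum_(l < k.+1) a l = T 0.
  have -> : T 0 = g 0 by have := gE 0; rewrite oppr0; lra.
  by apply: eq_bigr => l _; rewrite mulr0 cos0 mulr1.
have gM x : `|g x| <= M.
  have -> : g x = 2^-1 * (T x + T (- x)) by rewrite gE mulKf.
  rewrite normrM ger0_norm// ler_pdivrMl//.
  by rewrite mulr_natl mulr2n; apply: le_trans (ler_normD _ _) _; apply: lerD.
have key : `|T 0 - g t| <= k%:R ^+ 2 * M * (1 - cos t).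
  have [k0|k0] := posnP k.
    rewrite k0 expr0n !mul0r -g0 /g k0 !big_ord_recl !big_ord0 mul0r cos0 mulr1.
    by rewrite subrr normr0.
  by rewrite -g0; exact: cosine_markov.
have := Tmin (- t); have := gE t; move: key; rewrite ler_norml => /andP[key _].
by move=> h1 h2; lra.
Qed.

End CosineMarkov.

(** * Bounded measurable functions and polynomials *)

Section BoundedMeasurable.
Context (R : realType) d (T : measurableType d).
Implicit Types (D : set T) (f g : T -> R).

Definition bounded_mfun D f :=
  measurable_fun D f /\ exists C, forall x, D x -> `|f x| <= C.

Lemma eq_bounded_mfun D f g : {in D, f =1 g} ->
  bounded_mfun D f -> bounded_mfun D g.
Proof.
move=> fg [mf [C fC]]; split; first exact: eq_measurable_fun mf.
by exists C => x Dx; rewrite -fg ?inE//; exact: fC.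
Qed.

Lemma bounded_mfun_cst D c : bounded_mfun D (fun=> c).
Proof. by split; [exact: measurable_cst|exists `|c|]. Qed.

Lemma bounded_mfunD D f g : bounded_mfun D f -> bounded_mfun D g ->
  bounded_mfun D (fun x => f x + g x).
Proof.
move=> [mf [A fA]] [mg [B gB]]; split; first exact: measurable_funD.
exists (A + B) => x Dx; rewrite (le_trans (ler_normD _ _))// lerD//.
  exact: fA.
exact: gB.
Qed.

Lemma bounded_mfunM D f g : bounded_mfun D f -> bounded_mfun D g ->
  bounded_mfun D (fun x => f x * g x).
Proof.
move=> [mf [A fA]] [mg [B gB]]; split; first exact: measurable_funM.
exists (A * B) => x Dx; rewrite normrM ler_pM//; [exact: fA|exact: gB].
Qed.

Lemma bounded_mfunZ D c f : bounded_mfun D f -> bounded_mfun D (fun x => c * f x).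
Proof. by apply: bounded_mfunM; exact: bounded_mfun_cst. Qed.

Lemma bounded_mfunX D f k : bounded_mfun D f -> bounded_mfun D (fun x => f x ^+ k).
Proof.
move=> bf; elim: k => [|k ih]; first exact: bounded_mfun_cst.
by under eq_fun do rewrite exprS; exact: bounded_mfunM.
Qed.

Lemma bounded_mfun_sum D (I : Type) (s : seq I) (F : I -> T -> R) :
  (forall i, bounded_mfun D (F i)) -> bounded_mfun D (fun x => \sum_(i <- s) F i x).
Proof.
move=> bF; elim: s => [|i s ih].
  by under eq_fun do rewrite big_nil; exact: bounded_mfun_cst.
by under eq_fun do rewrite big_cons; exact: bounded_mfunD.
Qed.

Lemma bounded_mfun_prod D (I : Type) (s : seq I) (F : I -> T -> R) :
  (forall i, bounded_mfun D (F i)) -> bounded_mfun D (fun x => \prod_(i <- s) F i x).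
Proof.
move=> bF; elim: s => [|i s ih].
  by under eq_fun do rewrite big_nil; exact: bounded_mfun_cst.
by under eq_fun do rewrite big_cons; exact: bounded_mfunM.
Qed.

Lemma bounded_mfun_meval D N (p : {mpoly R[N]}) (v : T -> 'I_N -> R) :
  (forall i, bounded_mfun D (v^~ i)) -> bounded_mfun D (fun x => p.@[v x]).
Proof.
move=> bv; under eq_fun do rewrite mevalE.
apply: bounded_mfun_sum => a; apply: bounded_mfunZ.
by apply: bounded_mfun_prod => i; exact: bounded_mfunX.
Qed.

Lemma bounded_mfun_horner D (p : {poly R}) f :
  bounded_mfun D f -> bounded_mfun D (fun x => p.[f x]).
Proof.
move=> bf; under eq_fun do rewrite horner_coef.
by apply: bounded_mfun_sum => a; apply: bounded_mfunZ; exact: bounded_mfunX.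
Qed.

Section Integral.
Variables (mu : probability T R) (D : set T).
Hypothesis mD : measurable D.
Local Notation E f := (\int[mu]_(x in D) f x).

Lemma bounded_mfun_integrable f : bounded_mfun D f -> mu.-integrable D (EFin \o f).
Proof.
move=> [mf [C fC]]; apply: measurable_bounded_integrable => //.
  by rewrite (le_lt_trans (probability_le1 _ _))// ltry.
by exists C; split; [exact: num_real|move=> M CM x Dx; exact: (le_trans (fC _ Dx) (ltW CM))].
Qed.
Local Hint Resolve bounded_mfun_integrable : core.

Lemma expectD f g : bounded_mfun D f -> bounded_mfun D g ->
  E (fun x => f x + g x) = E f + E g.
Proof. by move=> bf bg; rewrite RintegralD//; exact: bounded_mfun_integrable. Qed.

Lemma expectZ c f : bounded_mfun D f -> E (fun x => c * f x) = c * E f.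
Proof. by move=> bf; rewrite RintegralZl//; exact: bounded_mfun_integrable. Qed.

Lemma expect_sum (I : Type) (s : seq I) (F : I -> T -> R) :
  (forall i, bounded_mfun D (F i)) ->
  E (fun x => \sum_(i <- s) F i x) = \sum_(i <- s) E (F i).
Proof.
move=> bF; elim: s => [|i s ih].
  under eq_Rintegral do rewrite big_nil.
  by rewrite big_nil (Rintegral_cst mu mD) mul0r.
under eq_Rintegral do rewrite big_cons.
by rewrite expectD// ?ih ?big_cons//; exact: bounded_mfun_sum.
Qed.

Lemma ler_expect f g : bounded_mfun D f -> bounded_mfun D g ->
  (forall x, D x -> f x <= g x) -> E f <= E g.
Proof. by move=> bf bg; apply: le_Rintegral => //; exact: bounded_mfun_integrable. Qed.

End Integral.
End BoundedMeasurable.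

(** * Degree and evaluation of multivariate polynomials *)

Section Degree.
Context (R : realType) (N : nat).
Implicit Types (p q : {mpoly R[N]}).

Lemma pdegP p t : reflect {in msupp p, forall a, (mdeg a <= t)%N} (pdeg p <= t)%N.
Proof.
apply: (iffP idP) => [pt a /msize_mdeg_lt|h].
  by move: pt; rewrite /pdeg; case: (mmeasure _ p) => //= u ut au; exact: leq_trans (au : (mdeg a <= u)%N) ut.
rewrite /pdeg msizeE; suff : (\max_(a <- msupp p) (mdeg a).+1 <= t.+1)%N by case: (\max_(_ <- _) _)%N.
by apply/bigmax_leqP_seq => a /h.
Qed.

Lemma pdegD_le p q t : (pdeg p <= t)%N -> (pdeg q <= t)%N -> (pdeg (p + q)%R <= t)%N.
Proof.
move=> /pdegP hp /pdegP hq; apply/pdegP => a /msuppD_le.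
by rewrite mem_cat => /orP[/hp|/hq].
Qed.

Lemma pdeg0 : pdeg (0 : {mpoly R[N]}) = 0%N.
Proof. by rewrite /pdeg mmeasure0. Qed.

Lemma pdeg1 : pdeg (1 : {mpoly R[N]}) = 0%N.
Proof. by rewrite /pdeg msize1. Qed.

Lemma pdegZ_le c p t : (pdeg p <= t)%N -> (pdeg (c *: p) <= t)%N.
Proof. by move=> /pdegP hp; apply/pdegP => a /msuppZ_le/hp. Qed.

Lemma pdegN p : pdeg (- p) = pdeg p.
Proof. by rewrite /pdeg mmeasureN. Qed.

Lemma pdegM_le p q s t : (pdeg p <= s)%N -> (pdeg q <= t)%N -> (pdeg (p * q)%R <= s + t)%N.
Proof.
move=> /pdegP hp /pdegP hq; apply/pdegP => a /msuppM_le/allpairsP[[b c]]/=[/hp bs /hq ct ->].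
by rewrite mdegD leq_add.
Qed.

Lemma pdegM p q : (pdeg (p * q)%R <= pdeg p + pdeg q)%N.
Proof. exact: pdegM_le. Qed.

Lemma pdeg_sum_le (I : Type) (r : seq I) (P : pred I) (F : I -> {mpoly R[N]}) t :
  (forall i, P i -> (pdeg (F i) <= t)%N) -> (pdeg (\sum_(i <- r | P i) F i)%R <= t)%N.
Proof.
move=> hF; elim/big_ind: _ => //; first by rewrite pdeg0.
by move=> p q hp hq; exact: pdegD_le.
Qed.

Lemma pdeg_prod_le0 (I : Type) (r : seq I) (P : pred I) (F : I -> {mpoly R[N]}) :
  (forall i, (pdeg (F i) <= 0)%N) -> (pdeg (\prod_(i <- r | P i) F i)%R <= 0)%N.
Proof.
move=> F0; elim/big_rec: _ => [|i q _]; first by rewrite pdeg1.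
exact: (@pdegM_le _ _ 0 0).
Qed.

Lemma pdegXn p k s : (pdeg p <= s)%N -> (pdeg (p ^+ k) <= k * s)%N.
Proof.
move=> ps; elim: k => [|k ih]; first by rewrite expr0 pdeg1.
by rewrite exprS mulSn; exact: pdegM_le.
Qed.

Lemma pdeg_mpolyX (a : multinom N) : pdeg (mpolyX R a) = mdeg a.
Proof. by rewrite /pdeg msizeX. Qed.

Lemma pevalD p q x : peval (p + q) x = peval p x + peval q x.
Proof. exact: mevalD. Qed.
Lemma pevalN p x : peval (- p) x = - peval p x.
Proof. exact: mevalN. Qed.
Lemma pevalM p q x : peval (p * q) x = peval p x * peval q x.
Proof. exact: mevalM. Qed.
Lemma pevalZ c p x : peval (c *: p) x = c * peval p x.
Proof. exact: mevalZ. Qed.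
Lemma peval1 x : peval (1 : {mpoly R[N]}) x = 1.
Proof. exact: meval1. Qed.
Lemma peval0 x : peval (0 : {mpoly R[N]}) x = 0.
Proof. exact: meval0. Qed.
Lemma pevalX_mnm a x : peval (mpolyX R a) x = @monom R N a x.
Proof. by rewrite /peval mevalX. Qed.
Lemma pevalXU i (x : N.-tuple R) : peval (mpolyX R (mnm1 i)) x = tnth x i.
Proof. by rewrite /peval mevalXU. Qed.
Lemma peval_sum (I : Type) (r : seq I) (P : pred I) (F : I -> {mpoly R[N]}) x :
  peval (\sum_(i <- r | P i) F i) x = \sum_(i <- r | P i) peval (F i) x.
Proof.
by elim/big_rec2: _ => [|i y p _ <-]; [rewrite peval0|rewrite pevalD].
Qed.
Lemma peval_prod (I : Type) (r : seq I) (P : pred I) (F : I -> {mpoly R[N]}) x :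
  peval (\prod_(i <- r | P i) F i) x = \prod_(i <- r | P i) peval (F i) x.
Proof.
by elim/big_rec2: _ => [|i y p _ <-]; [rewrite peval1|rewrite pevalM].
Qed.
Lemma pevalXn p k x : peval (p ^+ k) x = peval p x ^+ k.
Proof. by rewrite -[k]card_ord -!prodr_const peval_prod. Qed.
Lemma pevalE p x : peval p x = \sum_(a <- msupp p) mcoeff a p * @monom R N a x.
Proof. exact: mevalE. Qed.

End Degree.

Section BodyPoly.
Context (R : realType).

Lemma body_tnth_le1 s N (x : N.-tuple R) i : body s N x -> `|tnth x i| <= 1.
Proof.
have le_sum (g : 'I_N -> R) : (forall j, 0 <= g j) -> g i <= \sum_j g j.
  by move=> g0; rewrite (bigD1 i)//= lerDl sumr_ge0.
case: s => /= [x1|[x0 x1]].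
  have h := le_trans (le_sum (fun j => tnth x j ^+ 2) (fun j => sqr_ge0 _)) x1.
  by rewrite -(@ler_pXn2r _ 2)// ?nnegrE// expr1n real_normK ?num_real.
by rewrite ger0_norm//; apply: le_trans x1; exact: le_sum.
Qed.

Lemma bounded_mfun_tnth s N i : bounded_mfun (body s N) (fun x : N.-tuple R => tnth x i).
Proof.
split; first by apply: measurable_funTS; exact: measurable_tnth.
by exists 1 => x; exact: body_tnth_le1.
Qed.

Lemma bounded_mfun_peval s N (p : {mpoly R[N]}) : bounded_mfun (body s N) (peval p).
Proof. by apply: bounded_mfun_meval => i; exact: bounded_mfun_tnth. Qed.

Lemma expect_cst s N (c : R) : \int[ref_prob R s N]_(x in body s N) c = c.
Proof.
have := @ref_prob_moment R s N (fun=> 0%N) 0; rewrite dirichlet_ratio0.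
under eq_Rintegral do
  rewrite /body_monom expr0 mulr1 (eq_bigr (fun=> 1)) ?big1_eq//.
have mB := @measurable_body R s N.
by rewrite !Rintegral_cst// mul1r => ->; rewrite mulr1.
Qed.

End BodyPoly.

(** * Ball and sphere *)

Section Sphere.
Context (R : realType) (N : nat).
Implicit Types (x y : N.-tuple R) (P Q : {mpoly R[N.+1]}) (e : R).
Local Notation ball := (body Ball N : set (N.-tuple R)).
Local Notation E f := (\int[ref_prob R Ball N]_(x in ball) f x).

(* The reference probability of the ball is the image of the uniform probability of
   the sphere S^N under the projection that drops the coordinate of index [ord0];
   [sphere_pt x 1] and [sphere_pt x (-1)] are the two points above [x]. *)
Definition sphere_pt x e (i : 'I_N.+1) : R :=
  if unlift ord0 i is Some j then tnth x j else e * Num.sqrt (slack Ball x).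

Lemma sphere_pt0 x e : sphere_pt x e ord0 = e * Num.sqrt (slack Ball x).
Proof. by rewrite /sphere_pt unlift_none. Qed.

Lemma sphere_ptS x e j : sphere_pt x e (lift ord0 j) = tnth x j.
Proof. by rewrite /sphere_pt liftK. Qed.

Lemma sphere_pt_norm x e : ball x -> e ^+ 2 = 1 -> \sum_i sphere_pt x e i ^+ 2 = 1.
Proof.
move=> bx e1; rewrite big_ord_recl sphere_pt0 exprMn e1 mul1r.
rewrite sqr_sqrtr ?slack_ge0//.
under eq_bigr do rewrite sphere_ptS.
by rewrite /slack/= subrK.
Qed.

Lemma measurable_sphere_pt e i : measurable_fun [set: _] (fun x => sphere_pt x e i).
Proof.
have [j ->|->] := unliftP ord0 i.
  by under eq_fun do rewrite sphere_ptS; exact: measurable_tnth.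
under eq_fun do rewrite sphere_pt0; apply: measurable_funM => //.
have ms : measurable_fun [set: N.-tuple R] (@slack R Ball N).
  have := @measurable_body_monom R Ball N (fun=> 0%N) 1.
  congr measurable_fun; apply/funext => x.
  by rewrite /body_monom big1 ?mul1r// => l _; rewrite expr0.
have mq : measurable_fun [set: R] (@Num.sqrt R).
  by apply: continuous_measurable_fun; exact: sqrt_continuous.
exact: (measurableT_comp mq ms).
Qed.

Lemma bounded_mfun_sphere_pt e i : bounded_mfun ball (fun x => sphere_pt x e i).
Proof.
split; first by apply: measurable_funTS; exact: measurable_sphere_pt.
have [j ->|->] := unliftP ord0 i.
  by exists 1 => x bx; rewrite sphere_ptS (body_tnth_le1 _ bx).
exists `|e| => x bx; rewrite sphere_pt0 normrM ler_piMr// ger0_norm ?sqrtr_ge0//.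
rewrite -sqrtr1 ler_sqrt// /slack gerBl sumr_ge0// => l _; exact: sqr_ge0.
Qed.

Definition sphere_mean P x : R := (P.@[sphere_pt x 1] + P.@[sphere_pt x (-1)]) / 2.

Definition sphere_expect P : R := E (sphere_mean P).

Lemma bounded_mfun_sphere_mean P : bounded_mfun ball (sphere_mean P).
Proof.
apply: bounded_mfunM; last exact: bounded_mfun_cst.
by apply: bounded_mfunD; apply: bounded_mfun_meval => i; exact: bounded_mfun_sphere_pt.
Qed.

Let mball : measurable ball. Proof. exact: measurable_body. Qed.

Lemma sphere_expectD P Q : sphere_expect (P + Q) = sphere_expect P + sphere_expect Q.
Proof.
rewrite /sphere_expect -expectD//; try exact: bounded_mfun_sphere_mean.
apply: eq_Rintegral => x _; rewrite /sphere_mean !mevalD; ring.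
Qed.

Lemma sphere_expectZ c P : sphere_expect (c *: P) = c * sphere_expect P.
Proof.
rewrite /sphere_expect -expectZ//; last exact: bounded_mfun_sphere_mean.
apply: eq_Rintegral => x _; rewrite /sphere_mean !mevalZ; ring.
Qed.

Lemma sphere_expect0 : sphere_expect 0 = 0.
Proof. by rewrite -(scale0r (0 : {mpoly R[N.+1]})) sphere_expectZ mul0r. Qed.

Lemma sphere_expect_sum (I : Type) (s : seq I) (p : pred I) (F : I -> {mpoly R[N.+1]}) :
  sphere_expect (\sum_(i <- s | p i) F i) = \sum_(i <- s | p i) sphere_expect (F i).
Proof. exact: (big_morph sphere_expect sphere_expectD sphere_expect0). Qed.

Definition sphere_ratio (a : 'I_N.+1 -> nat) : R :=
  (\prod_i pochhammer 2^-1 (a i)) / pochhammer (N.+1%:R / 2) (\sum_i a i)%N.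

(** The formula is symmetric in all [N.+1] coordinates: the slack, which is the square of the lifted
    coordinate, has the same parameter 1/2 as the others. *)
Lemma sphere_expect_even (m : multinom N.+1) (a : 'I_N.+1 -> nat) :
  (forall i, m i = (2 * a i)%N) -> sphere_expect (mpolyX R m) = sphere_ratio a.
Proof.
move=> ma; transitivity (dirichlet_ratio R (a \o lift ord0) (a ord0)); last first.
  rewrite /dirichlet_ratio /sphere_ratio !big_ord_recl/=; congr (_ / pochhammer _ _).
    exact: mulrC.
  exact: addnC.
rewrite -(ref_prob_moment R Ball); apply: eq_Rintegral => x; rewrite inE => bx.
rewrite /sphere_mean /body_monom !mevalX !big_ord_recl !sphere_pt0 !ma.
have hp e : \prod_(j < N) sphere_pt x e (lift ord0 j) ^+ m (lift ord0 j) =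
    \prod_(j < N) (tnth x j ^+ 2) ^+ a (lift ord0 j).
  by apply: eq_bigr => j _; rewrite sphere_ptS ma exprM.
have hq e : e ^+ 2 = 1 ->
    (e * Num.sqrt (slack Ball x)) ^+ (2 * a ord0) = slack Ball x ^+ a ord0.
  by move=> e1; rewrite exprM [(e * _) ^+ 2]exprMn e1 mul1r sqr_sqrtr ?slack_ge0.
by rewrite !hp !hq ?sqrrN ?expr1n//=; field.
Qed.

(** For the lifted coordinate the values at the two lifts cancel pointwise; for any other
    coordinate, a reflection of the ball changes the sign. *)
Lemma sphere_expect_odd (m : multinom N.+1) i :
  odd (m i) -> sphere_expect (mpolyX R m) = 0.
Proof.
rewrite /sphere_expect; have [j ->|->] := unliftP ord0 i => mi.
  apply: (@ref_prob_ball_odd _ _ j).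
    have mX e : measurable_fun [set: _] (fun x => (mpolyX R m).@[sphere_pt x e]).
      under eq_fun do rewrite mevalX.
      by apply: measurable_prod => l _; apply: measurable_funX; exact: measurable_sphere_pt.
    by apply: measurable_funM => //; apply: measurable_funD; exact: mX.
  move=> x; rewrite /sphere_mean !mevalX -mulNr opprD; congr (_ / _).
  have sl : slack Ball (flip j x) = slack Ball x.
    rewrite /slack; congr (_ - _); apply: eq_bigr => l _ /=.
    by rewrite tnth_flip; case: ifP => // _; rewrite sqrrN.
  have main e : \prod_(l < N.+1) sphere_pt (flip j x) e l ^+ m l =
      - \prod_(l < N.+1) sphere_pt x e l ^+ m l.
    rewrite (bigD1 (lift ord0 j))//= [in RHS](bigD1 (lift ord0 j))//= -mulNr.
    congr (_ * _).
      rewrite !sphere_ptS tnth_flip eqxx exprNn -signr_odd mi expr1; ring.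
    apply: eq_bigr => l lj; congr (_ ^+ _).
    have [l' le|->] := unliftP ord0 l; last by rewrite !sphere_pt0 sl.
    move: lj; rewrite le !sphere_ptS tnth_flip (inj_eq lift_inj) => /negbTE ->.
    by [].
  by rewrite !main.
transitivity (\int[ref_prob R Ball N]_(x in ball) (0 : R)).
  apply: eq_Rintegral => x _; rewrite /sphere_mean !mevalX !big_ord_recl !sphere_pt0.
  rewrite mul1r mulN1r [X in _ + X * _]exprNn -signr_odd mi expr1.
  under eq_bigr do rewrite sphere_ptS.
  under [X in _ + _ * X]eq_bigr do rewrite sphere_ptS.
  ring.
exact: expect_cst.
Qed.

(** Unless all exponents of the raised monomial are even, both sides vanish by parity, or by the
    factor [m i] when the subtraction is truncated. Otherwise the two moments differ by one factor
    in a numerator and one in the denominator of [sphere_ratio]. *)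
Lemma sphere_stein_monom (m : multinom N.+1) i :
  (N + mdeg m)%:R * sphere_expect (mpolyX R (mnm_add m (mnm1 i))) =
  (m i)%:R * sphere_expect (mpolyX R (mnm_sub m (mnm1 i))).
Proof.
have [/forallP ev|] := boolP [forall j, ~~ odd (mnm_add m (mnm1 i) j)]; last first.
  rewrite negb_forall => /existsP[j]; rewrite negbK => oj.
  rewrite (sphere_expect_odd oj) mulr0.
  have [->|mi0] := posnP (m i); first by rewrite mul0r.
  rewrite (@sphere_expect_odd _ j) ?mulr0//.
  move: oj; rewrite mnmDE mnmBE mnm1E; case: eqP => [<-|_] /=; lia.
pose b j := (mnm_sub m (mnm1 i) j)./2.
have mb j : m j = (2 * b j + (i == j))%N.
  have := ev j; rewrite /b mnmDE mnmBE mnm1E; case: eqP => [<-|_] /=; lia.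
pose a j := (b j + (i == j))%N.
rewrite (@sphere_expect_even _ a); last first.
  by move=> j; rewrite /a mnmDE mnm1E mb; lia.
rewrite (@sphere_expect_even _ b); last first.
  by move=> j; rewrite mnmBE mnm1E mb; lia.
have sum1 : (\sum_(j < N.+1) (i == j) = 1)%N.
  rewrite (bigD1 i)//= eqxx big1// => j; rewrite eq_sym => /negbTE ->//.
have -> : mdeg m = (2 * \sum_j b j + 1)%N.
  rewrite mdegE -[X in _ = (_ + X)%N]sum1 big_distrr/= -big_split/=.
  by apply: eq_bigr => j _; exact: mb.
have -> : m i = (2 * b i).+1 by rewrite mb eqxx addn1.
rewrite /sphere_ratio.
have -> : (\sum_j a j = (\sum_j b j).+1)%N by rewrite big_split/= sum1 addn1.
have -> : \prod_j pochhammer 2^-1 (a j) =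
    (2^-1 + (b i)%:R) * \prod_j pochhammer 2^-1 (b j) :> R.
  rewrite (bigD1 i)//= [in RHS](bigD1 i)//= mulrA /a eqxx addn1 pochhammerS.
  rewrite [_ * (_ + _)]mulrC; congr (_ * _); apply: eq_bigr => j.
  by rewrite eq_sym => /negbTE ->; rewrite addn0.
rewrite pochhammerS.
have := pochhammer_gt0 (\sum_j b j)%N (divr_gt0 (ltr0Sn R N) (ltr0Sn R 1)).
move: (b i) (\prod_j _) (\sum_j b j)%N (pochhammer (N.+1%:R / 2) (\sum_j b j)%N) => c v S u u0.
have h1 : 0 < (N.+1%:R / 2 + S%:R : R) by rewrite ltr_wpDr.
field; rewrite gt_eqF//= -?natrM -?natrD.
Qed.

Lemma mderiv_sum n (I : Type) (s : seq I) (F : I -> {mpoly R[n]}) i :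
  mderiv i (\sum_(j <- s) F j) = \sum_(j <- s) mderiv i (F j).
Proof. exact: (big_morph (mderiv i) (mderivD i) (mderiv0 _ i)). Qed.

(* The divergence theorem on S^N, for a homogeneous polynomial. *)
Lemma sphere_stein d P i : {in msupp P, forall m, mdeg m = d} ->
  (N + d)%:R * sphere_expect (mpolyX R (mnm1 i) * P) = sphere_expect (mderiv i P).
Proof.
move=> hP; rewrite [in LHS](mpolyE P) [in RHS](mpolyE P).
rewrite mderiv_sum mulr_sumr !sphere_expect_sum mulr_sumr.
rewrite !big_seq; apply: eq_bigr => m /hP md.
rewrite mderivZ mderivX -scalerAr !sphere_expectZ -md mulrCA; congr (_ * _).
by rewrite -mpolyXD (_ : mnm_add _ _ = mnm_add m (mnm1 i)) ?sphere_stein_monom//;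
   apply/mnmP => j; rewrite !mnmDE addnC.
Qed.

Section Zonal.
Variable c : 'I_N.+1 -> R.
Hypothesis c1 : \sum_i c i ^+ 2 = 1.

Definition zonal_form : {mpoly R[N.+1]} := \sum_i c i *: mpolyX R (mnm1 i).
Local Notation tau := zonal_form.

Lemma msupp_zonal_exp d : {in msupp (tau ^+ d), forall m, mdeg m = d}.
Proof.
have ht : {in msupp tau, forall m, mdeg m = 1%N}.
  move=> m /msupp_sum_le/flattenP[s /mapP[i _ ->]] /msuppZ_le.
  by rewrite msuppX inE => /eqP ->; rewrite mdeg1.
elim: d => [|d ih] m; first by rewrite expr0 msupp1 inE => /eqP ->; rewrite mdeg0.
rewrite exprS => /msuppM_le/allpairsP[[a b]]/=[/ht a1 /ih bd ->].
by rewrite mdegD a1 bd.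
Qed.

Lemma mderiv_zonal_exp d i : mderiv i (tau ^+ d) = (d%:R * c i) *: tau ^+ d.-1.
Proof.
have dt : mderiv i tau = mpolyC N.+1 (c i).
  rewrite mderiv_sum (bigD1 i)//= big1 ?addr0 => [|j ji].
    rewrite mderivZ mderivX mnm1E eqxx scale1r (_ : mnm_sub _ _ = mnm0).
      by rewrite mpolyX0 -mul_mpolyC mulr1.
    by apply/mnmP => j; rewrite mnmBE mnm0E subnn.
  by rewrite mderivZ mderivX mnm1E (negbTE ji) scale0r scaler0.
elim: d => [|d ih]; first by rewrite expr0 -mpolyC1 mderivC mul0r scale0r.
rewrite exprS mderivM dt ih mul_mpolyC -scalerAr.
case: d {ih} => [|d]; first by rewrite /= !mul0r scale0r addr0 mul1r.
by rewrite /= -exprS -scalerDl -[in RHS]natr1; congr (_ *: _); ring.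
Qed.

(** The direction [c] enters only through the sum of the [c i ^+ 2], equal to 1. All moments of the
    zonal form are therefore the same in every direction, which is the part of rotation invariance
    that the kernel requires. *)
Lemma sphere_expect_zonal d :
  (N + d.+1)%:R * sphere_expect (tau ^+ d.+2) = d.+1%:R * sphere_expect (tau ^+ d).
Proof.
rewrite exprS {1}/zonal_form mulr_suml sphere_expect_sum mulr_sumr.
transitivity (\sum_i c i ^+ 2 * (d.+1%:R * sphere_expect (tau ^+ d))).
  apply: eq_bigr => i _; rewrite -scalerAl sphere_expectZ mulrCA.
  rewrite (sphere_stein _ (@msupp_zonal_exp d.+1)) mderiv_zonal_exp sphere_expectZ /=.
  ring.
by rewrite -mulr_suml c1 mul1r.
Qed.

Definition zonal x e : R := tau.@[sphere_pt x e].

Lemma zonalE x e : zonal x e =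
  c ord0 * (e * Num.sqrt (slack Ball x)) + \sum_j c (lift ord0 j) * tnth x j.
Proof.
rewrite /zonal /zonal_form (raddf_sum (meval (sphere_pt x e))) big_ord_recl/=.
rewrite mevalZ mevalXU sphere_pt0; congr (_ + _); apply: eq_bigr => j _.
by rewrite mevalZ mevalXU sphere_ptS.
Qed.

Lemma bounded_mfun_zonal e : bounded_mfun ball (zonal^~ e).
Proof. by apply: bounded_mfun_meval => i; exact: bounded_mfun_sphere_pt. Qed.

Definition zonal_mean (p : {poly R}) x : R := (p.[zonal x 1] + p.[zonal x (-1)]) / 2.

Definition zonal_expect (p : {poly R}) : R := E (zonal_mean p).

Lemma bounded_mfun_zonal_mean p : bounded_mfun ball (zonal_mean p).
Proof.
apply: bounded_mfunM; last exact: bounded_mfun_cst.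
by apply: bounded_mfunD; apply: bounded_mfun_horner; exact: bounded_mfun_zonal.
Qed.

Lemma zonal_expectD p q : zonal_expect (p + q) = zonal_expect p + zonal_expect q.
Proof.
rewrite /zonal_expect -expectD//; try exact: bounded_mfun_zonal_mean.
apply: eq_Rintegral => x _; rewrite /zonal_mean !hornerD; ring.
Qed.

Lemma zonal_expectZ a p : zonal_expect (a *: p) = a * zonal_expect p.
Proof.
rewrite /zonal_expect -expectZ//; last exact: bounded_mfun_zonal_mean.
apply: eq_Rintegral => x _; rewrite /zonal_mean !hornerZ; ring.
Qed.

Lemma zonal_expectXn d : zonal_expect 'X^d = sphere_expect (tau ^+ d).
Proof.
apply: eq_Rintegral => x _; rewrite /zonal_mean /sphere_mean !hornerXn.
by rewrite !(rmorphXn (meval _)).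
Qed.

Lemma zonal_expect1 : zonal_expect 1 = 1.
Proof.
rewrite -[RHS](@expect_cst R Ball N); apply: eq_Rintegral => x _.
by rewrite /zonal_mean !hornerC; field.
Qed.

Lemma zonal_expectX : zonal_expect 'X = 0.
Proof.
rewrite -['X]expr1 zonal_expectXn expr1 sphere_expect_sum big1// => i _.
rewrite sphere_expectZ (@sphere_expect_odd _ i) ?mulr0//.
by rewrite mnm1E eqxx.
Qed.

Lemma zonal_expectXSS d :
  (N.+1 + d)%:R * zonal_expect 'X^(d.+2) = d.+1%:R * zonal_expect 'X^d.
Proof. by rewrite !zonal_expectXn -sphere_expect_zonal addSnnS. Qed.

Definition ball_poly : {mpoly R[N]} := 1 - \sum_(j < N) mpolyX R (mnm1 j) ^+ 2.

Lemma peval_ball_poly x : peval ball_poly x = slack Ball x.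
Proof.
rewrite /ball_poly pevalD pevalN peval1 peval_sum; congr (_ - _).
by apply: eq_bigr => j _; rewrite pevalXn pevalXU.
Qed.

Lemma pdeg_ball_poly : (pdeg ball_poly <= 2)%N.
Proof.
apply: pdegD_le; rewrite ?pdeg1// pdegN; apply: pdeg_sum_le => j _.
by apply: (@pdegXn _ _ _ 2 1); rewrite pdeg_mpolyX mdeg1.
Qed.

(** The normal form of a polynomial on the sphere modulo the relation that the square of the lifted
    coordinate is the slack, the sign [e] choosing the lift. [B] has smaller degree because it
    multiplies that coordinate. The case [B = 0] is separate since [pdeg 0 = 0] is not below
    [d = 0]. *)
Definition ball_split d (w : N.-tuple R -> R -> R) := exists A B : {mpoly R[N]},
  [/\ (pdeg A <= d)%N, B = 0 \/ (pdeg B < d)%N &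
   forall x e, ball x -> e ^+ 2 = 1 ->
     w x e = peval A x + e * Num.sqrt (slack Ball x) * peval B x].

Lemma ball_splitD d w w' : ball_split d w -> ball_split d w' ->
  ball_split d (fun x e => w x e + w' x e).
Proof.
move=> [A [B [dA dB h]]] [A' [B' [dA' dB' h']]].
exists (A + A'), (B + B'); split; first exact: pdegD_le.
  case: d dB dB' {h h' dA dA'} => [|d] [->|dB] [->|dB'] //; rewrite ?add0r ?addr0; auto.
  by right; rewrite ltnS pdegD_le.
by move=> x e bx e1; rewrite h// h'// !pevalD; ring.
Qed.

Lemma ball_splitZ d a w : ball_split d w -> ball_split d (fun x e => a * w x e).
Proof.
move=> [A [B [dA dB h]]]; exists (a *: A), (a *: B); split; first exact: pdegZ_le.
  case: dB => [->|dB]; [by left; rewrite scaler0|right].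
  by case: d dB {h dA} => // d; rewrite !ltnS; exact: pdegZ_le.
by move=> x e bx e1; rewrite h// !pevalZ; ring.
Qed.

Lemma ball_split_widen d d' w : (d <= d')%N -> ball_split d w -> ball_split d' w.
Proof.
move=> dd [A [B [dA dB h]]]; exists A, B; split=> //; first exact: leq_trans dd.
by case: dB => [->|dB]; [left|right; exact: leq_trans dd].
Qed.

Lemma ball_split_exp d : ball_split d (fun x e => zonal x e ^+ d).
Proof.
pose l : {mpoly R[N]} := \sum_j c (lift ord0 j) *: mpolyX R (mnm1 j).
have dl : (pdeg l <= 1)%N.
  by apply: pdeg_sum_le => j _; apply: pdegZ_le; rewrite pdeg_mpolyX mdeg1.
elim: d => [|d [A [B [dA dB h]]]].
  exists 1, 0; split; [by rewrite pdeg1|by left|].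
  by move=> x e _ _; rewrite expr0 peval1 peval0 mulr0 addr0.
exists (l * A + c ord0 *: (ball_poly * B)), (l * B + c ord0 *: A); split.
- apply: pdegD_le; first exact: (pdegM_le dl dA).
  apply: pdegZ_le; case: dB => [->|dB]; first by rewrite mulr0 pdeg0.
  by apply: leq_trans (pdegM _ _) _; have := pdeg_ball_poly; lia.
- right; rewrite ltnS; apply: pdegD_le; last exact: pdegZ_le.
  case: dB => [->|dB]; first by rewrite mulr0 pdeg0.
  by apply: leq_trans (pdegM _ _) _; lia.
- move=> x e bx e1; rewrite exprS h// zonalE !pevalD !pevalZ !pevalM peval_ball_poly.
  have -> : peval l x = \sum_j c (lift ord0 j) * tnth x j.
    by rewrite peval_sum; apply: eq_bigr => j _; rewrite pevalZ pevalXU.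
  have := sqr_sqrtr (slack_ge0 bx); move: (slack Ball x) (Num.sqrt (slack Ball x)) => ? q <-.
  move: (\sum_j _) (peval A x) (peval B x) (c ord0) => u a b v.
  transitivity (u * a + v * (e ^+ 2 * q ^+ 2) * b + e * q * (u * b + v * a)); first ring.
  rewrite e1; ring.
Qed.

Lemma ball_split_horner d (s : {poly R}) : (size s <= d.+1)%N ->
  ball_split d (fun x e => s.[zonal x e]).
Proof.
move=> sd.
suff [A [B [dA dB h]]] : ball_split d (fun x e => \sum_(i < d.+1) s`_i * zonal x e ^+ i).
  exists A, B; split => // x e bx e1; rewrite -h//.
  exact: horner_coef_wide.
have aux d' : (d' <= d)%N ->
    ball_split d (fun x e => \sum_(i < d'.+1) s`_i * zonal x e ^+ i).
  elim: d' => [_|d' ih d'd].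
    exists (mpolyC N s`_0), 0; split; [|by left|].
      by rewrite /pdeg mmeasureC; case: (_ != _).
    by move=> x e _ _; rewrite big_ord_recl big_ord0 expr0 /peval mevalC meval0; ring.
  have [A [B [dA dB h]]] : ball_split d (fun x e =>
      \sum_(i < d'.+1) s`_i * zonal x e ^+ i + s`_d'.+1 * zonal x e ^+ d'.+1).
    apply: ball_splitD; first by apply: ih; exact: ltnW.
    by apply: ball_splitZ; exact: ball_split_widen (ball_split_exp _).
  by exists A, B; split => // x e bx e1; rewrite -h// big_ord_recr.
exact: aux.
Qed.

End Zonal.
End Sphere.

(** * Restriction to great circles *)

Section GreatCircle.
Context (R : realType).

Lemma trig_poly_linear_exp k (T : R -> R) u w d : trig_poly k T ->
  trig_poly (d + k) (fun t => (u * cos t + w * sin t) ^+ d * T t).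
Proof.
move=> hT; elim: d => [|d ih].
  by apply: (trig_poly_ext (T := T)) => // t; rewrite expr0 mul1r.
apply: (trig_poly_ext (T := fun t =>
  (u * cos t + w * sin t) * ((u * cos t + w * sin t) ^+ d * T t))).
  by move=> t; rewrite mulrA -exprS.
exact: trig_polyM.
Qed.

Lemma trig_poly_monom (I : Type) (s : seq I) (a : I -> nat) (u w : I -> R) :
  trig_poly (\sum_(i <- s) a i)%N
    (fun t => \prod_(i <- s) (u i * cos t + w i * sin t) ^+ a i).
Proof.
elim: s => [|i s ih].
  rewrite big_nil; apply: (trig_poly_ext (T := fun t => cos (0%:R * t))).
    by move=> t; rewrite mul0r cos0 big_nil.
  exact: trig_poly_cos.
rewrite big_cons; apply: trig_poly_ext (trig_poly_linear_exp (u i) (w i) (a i) ih).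
by move=> t; rewrite big_cons.
Qed.

Lemma trig_poly_meval N k (p : {mpoly R[N]}) (u w : 'I_N -> R) : (pdeg p <= k)%N ->
  trig_poly k (fun t => p.@[fun j => u j * cos t + w j * sin t]).
Proof.
move=> /pdegP pk.
apply: (trig_poly_ext (T := fun t => \sum_(a <- msupp p | a \in msupp p)
    mcoeff a p * \prod_j (u j * cos t + w j * sin t) ^+ a j)).
  by move=> t; rewrite mevalE -big_seq.
apply: (trig_poly_ext (T := fun t => \sum_(a <- msupp p)
    if a \in msupp p then mcoeff a p * \prod_j (u j * cos t + w j * sin t) ^+ a j
    else 0 * cos (0%:R * t))).
  by move=> t; rewrite [RHS]big_mkcond; apply: eq_bigr => a _; rewrite mul0r.
apply: trig_poly_sum => a; have [/pk ak|_] := boolP (a \in msupp p); apply: trig_polyZ.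
  apply: (trig_poly_widen ak); rewrite mdegE; exact: trig_poly_monom.
exact: trig_poly_cos.
Qed.

Variable N : nat.
Implicit Types x y z : N.-tuple R.

Definition inner_sphere y x e : R := zonal (sphere_pt y 1) x e.

Lemma inner_sphereE y x e : inner_sphere y x e = \sum_i sphere_pt y 1 i * sphere_pt x e i.
Proof.
rewrite /inner_sphere /zonal /zonal_form (raddf_sum (meval (sphere_pt x e))).
by apply: eq_bigr => i _; rewrite /= mevalZ mevalXU.
Qed.

(* The great circle of the sphere S^N through the lifts of [y] and [x] projects
   to a curve in the ball, along which [f] is a trigonometric polynomial. *)
Lemma ball_growth (f : {mpoly R[N]}) k (M delta : R) y x e : (pdeg f <= k)%N ->
  (forall z, body Ball N z -> `|peval f z| <= M) ->
  (forall z, body Ball N z -> peval f y <= peval f z + delta) ->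
  body Ball N y -> body Ball N x -> e ^+ 2 = 1 ->
  peval f x - peval f y <= 2 * k%:R ^+ 2 * M * (1 - inner_sphere y x e) + delta.
Proof.
move=> fk fM fmin by_ bx e1; set t := inner_sphere y x e.
pose u i := sphere_pt y 1 i; pose v i := sphere_pt x e i.
have u1 : \sum_i u i ^+ 2 = 1 by apply: sphere_pt_norm; rewrite ?expr1n.
have v1 : \sum_i v i ^+ 2 = 1 by exact: sphere_pt_norm.
have uv : \sum_i u i * v i = t by rewrite /t inner_sphereE.
clearbody t.
have sq : \sum_i (v i - t * u i) ^+ 2 = 1 - t ^+ 2.
  transitivity (\sum_i v i ^+ 2 - 2 * t * (\sum_i u i * v i) + t ^+ 2 * \sum_i u i ^+ 2).
    rewrite !mulr_sumr -sumrB -big_split/=; apply: eq_bigr => i _.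
    ring.
  by rewrite u1 v1 uv; ring.
have t2 : 0 <= 1 - t ^+ 2 by rewrite -sq sumr_ge0// => i _; exact: sqr_ge0.
have t1 : -1 <= t <= 1 by rewrite -ler_norml -(@ler_pXn2r _ 2)// ?nnegrE// expr1n
  real_normK ?num_real//; lra.
(* If the two lifts are parallel, [sg] is 0 and so is [w], by the convention on inverses. The bound
   on the sum of the [w i ^+ 2] covers this degenerate case and suffices to keep the projected curve
   in the ball. *)
pose sg := Num.sqrt (1 - t ^+ 2); pose w i := (v i - t * u i) / sg.
have sg2 : sg ^+ 2 = 1 - t ^+ 2 by rewrite sqr_sqrtr.
have sw i : sg * w i = v i - t * u i.
  have [s0|s0] := eqVneq sg 0; last by rewrite /w mulrC divfK.
  rewrite s0 mul0r; apply/esym/eqP; rewrite -sqrf_eq0.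
  have := @psumr_eq0P _ _ xpredT _ (fun i _ => sqr_ge0 (v i - t * u i)).
  by move=> -> //; rewrite sq -sg2 s0 expr0n.
have w1 : \sum_i w i ^+ 2 <= 1.
  have [s0|s0] := eqVneq sg 0.
    by rewrite big1 => [|i _]; rewrite ?ler01// /w s0 invr0 mulr0 expr0n.
  under eq_bigr do rewrite /w exprMn exprVn sg2.
  by rewrite -mulr_suml sq divff// -sg2 expf_eq0.
have uw : \sum_i u i * w i = 0.
  under eq_bigr do rewrite /w mulrA.
  rewrite -mulr_suml.
  have -> : \sum_i u i * (v i - t * u i) = \sum_i u i * v i - t * \sum_i u i ^+ 2.
    by rewrite mulr_sumr -sumrB; apply: eq_bigr => i _; ring.
  by rewrite uv u1 mulr1 subrr mul0r.
pose U (j : 'I_N) := u (lift ord0 j); pose W (j : 'I_N) := w (lift ord0 j).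
pose T phi := f.@[fun j => U j * cos phi + W j * sin phi].
have TE phi : exists2 z, body Ball N z & T phi = peval f z.
  exists [tuple U j * cos phi + W j * sin phi | j < N]; last first.
    by apply: meval_eq => j; rewrite tnth_mktuple.
  rewrite /body/=; under eq_bigr do rewrite tnth_mktuple.
  apply: (@le_trans _ _ (\sum_i (u i * cos phi + w i * sin phi) ^+ 2)).
    by rewrite big_ord_recl ler_wpDl// sqr_ge0.
  have -> : \sum_i (u i * cos phi + w i * sin phi) ^+ 2 = cos phi ^+ 2 * \sum_i u i ^+ 2 +
      2 * cos phi * sin phi * (\sum_i u i * w i) + sin phi ^+ 2 * \sum_i w i ^+ 2.
    rewrite !mulr_sumr -!big_split/=; apply: eq_bigr => i _; ring.
  rewrite u1 uw mulr1 mulr0 addr0 -[leRHS](cos2Dsin2 phi) lerD2l.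
  by rewrite ler_piMr// sqr_ge0.
have T0 : T 0 = peval f y.
  by apply: meval_eq => j; rewrite cos0 sin0 mulr1 mulr0 addr0 /U /u sphere_ptS.
have Tt : T (acos t) = peval f x.
  apply: meval_eq => j; rewrite acosK ?in_itv//= sin_acos// -/sg [_ * sg]mulrC sw.
  by rewrite /U /v sphere_ptS; ring.
have := @trig_poly_growth R k T M delta (acos t) (trig_poly_meval U W fk).
rewrite Tt T0 acosK ?in_itv//; apply.
- by move=> phi; have [z bz ->] := TE phi; exact: fM.
- by move=> phi; have [z bz ->] := TE phi; rewrite lerBlDr; exact: fmin.
Qed.

End GreatCircle.

(** * Densities on a single ball *)

Section BallBlock.
Context (R : realType).

Lemma body0 s N : body s N ([tuple 0 | _ < N] : N.-tuple R).
Proof.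
case: s => /=; first by rewrite big1 ?ler01// => j _; rewrite tnth_mktuple expr0n.
by split=> [j|]; [rewrite tnth_mktuple|rewrite big1 ?ler01// => j _; rewrite tnth_mktuple].
Qed.

(** Boundedness alone gives a point that is minimal up to [delta]; the estimates that follow carry
    this additive error along. *)
Lemma approx_min (T : Type) (D : set T) (f : T -> R) (M delta : R) : 0 < delta ->
  D !=set0 -> (forall x, D x -> `|f x| <= M) ->
  exists2 y, D y & forall z, D z -> f y <= f z + delta.
Proof.
move=> d0 [x0 Dx0] fM; set S := [set f x | x in D].
have lb : has_lbound S.
  by exists (- M) => _ [x Dx <-]; have := fM _ Dx; rewrite ler_norml => /andP[].
have hS : has_inf S by split=> //; exists (f x0), x0.
have [_ [y Dy <-] fy] := inf_adherent d0 hS.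
exists y => // z Dz; rewrite (le_trans (ltW fy))// lerD2r.
by apply: ge_inf => //; exists z.
Qed.

Lemma ball_block N k r (f : {mpoly R[N.+1]}) (M delta : R) : (0 < r)%N ->
  (pdeg f <= k)%N -> (forall z, body Ball N.+1 z -> `|peval f z| <= M) -> 0 < delta ->
  exists A B : {mpoly R[N.+1]}, let q := A ^+ 2 + ball_poly R N.+1 * B ^+ 2 in
  [/\ (pdeg A <= r)%N, B = 0 \/ (pdeg B < r)%N,
    \int[ref_prob R Ball N.+1]_(x in body Ball N.+1) peval q x = 1 &
    forall z, body Ball N.+1 z ->
      \int[ref_prob R Ball N.+1]_(x in body Ball N.+1) (peval f x * peval q x) <=
      peval f z + 2 * N.+2%:R ^+ 2 * k%:R ^+ 2 * M / r%:R ^+ 2 + delta].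
Proof.
(* One half of [delta] is spent in the growth inequality, the other in comparing the value at the
   near-minimizer [y] with the value at [z]. *)
move=> r0 fk fM d0; pose d2 := delta / 2; have d20 : 0 < d2 by rewrite divr_gt0.
have bne : (body Ball N.+1 : set (N.+1.-tuple R)) !=set0 by eexists; exact: body0.
have [y by_ ymin] := approx_min d20 bne fM.
pose c := sphere_pt y 1.
have c1 : \sum_i c i ^+ 2 = 1 by apply: sphere_pt_norm => //; rewrite expr1n.
pose L := zonal_expect c.
(* The kernel is used with [n = N], for the sphere of dimension [N.+1] above this ball; hence the
   constant [N.+2]. *)
have [s0 [ss L0 hs0]] := gegenbauer_kernel (L := L) (zonal_expectD c) (zonal_expectZ c)
  (zonal_expect1 c) (zonal_expectX c) (zonal_expectXSS c1) r0.
have LZ b p : L (b *: p) = b * L p := zonal_expectZ c b p.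
pose a := (Num.sqrt (L (s0 ^+ 2)))^-1; pose s := a *: s0.
have a2 : a ^+ 2 * L (s0 ^+ 2) = 1.
  by rewrite exprVn sqr_sqrtr ?ltW// mulVf// gt_eqF.
have Ls : L (s ^+ 2) = 1 by rewrite exprZn LZ.
have hs : L ((1 - 'X) * s ^+ 2) <= N.+2%:R ^+ 2 / r%:R ^+ 2.
  rewrite exprZn -scalerAr LZ ler_pdivlMr; last by rewrite exprn_gt0 ?ltr0n.
  rewrite -mulrA (le_trans (ler_wpM2l (sqr_ge0 a) hs0))//.
  by rewrite mulrCA a2 mulr1.
have ssz : (size s <= r.+1)%N by rewrite (leq_trans (size_scale_leq _ _)).
have [A [B [dA dB h]]] := ball_split_horner c ssz.
exists A, B; set q := A ^+ 2 + _.
have qE x : body Ball N.+1 x -> peval q x = zonal_mean c (s ^+ 2) x.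
  move=> bx; rewrite /zonal_mean !horner_exp !h ?sqrrN ?expr1n//.
  rewrite pevalD pevalM !pevalXn peval_ball_poly.
  have := sqr_sqrtr (slack_ge0 bx).
  by move: (slack Ball x) (Num.sqrt (slack Ball x)) => ? u <-; field.
have mB : measurable (body Ball N.+1 : set (N.+1.-tuple R)) by exact: measurable_body.
have bq := @bounded_mfun_peval R Ball N.+1 q.
have bf := @bounded_mfun_peval R Ball N.+1 f.
have Eq : \int[ref_prob R Ball N.+1]_(x in body Ball N.+1) peval q x = 1.
  by rewrite -Ls; apply: eq_Rintegral => x; rewrite inE => /qE.
have M0 : 0 <= M.
  by have [x0 bx0] := bne; exact: le_trans (normr_ge0 _) (fM _ bx0).
split=> // z bz.
pose K := 2 * k%:R ^+ 2 * M.
have pointwise x : body Ball N.+1 x -> peval f x * peval q x <=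
    (peval f y + d2) * peval q x + K * zonal_mean c ((1 - 'X) * s ^+ 2) x.
  move=> bx; rewrite qE// /zonal_mean ![((1 - 'X) * _).[_]]hornerM !horner_exp !hornerD !hornerN !hornerX !hornerC.
  (* The growth inequality holds at each lift separately, with its own scalar product; only after
     multiplication by the square of [s] are the two lifts averaged. *)
  have g e : e ^+ 2 = 1 -> (peval f x - peval f y - d2) * s.[zonal c x e] ^+ 2 <=
      K * (1 - zonal c x e) * s.[zonal c x e] ^+ 2.
    move=> e1; apply: ler_wpM2r; first exact: sqr_ge0.
    by have := ball_growth fk fM ymin by_ bx e1; rewrite -/K /inner_sphere -/c; lra.
  have := g 1 (expr1n _ _); have := g (-1); rewrite sqrrN expr1n => /(_ erefl).
  move: (_ ^+ 2) (_ ^+ 2) => u v; lra.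
have bz1 := bounded_mfun_zonal_mean c ((1 - 'X) * s ^+ 2).
apply: (le_trans (@ler_expect _ _ _ _ _ mB _ _ _ _ pointwise)).
- exact: bounded_mfunM.
- by apply: bounded_mfunD; exact: bounded_mfunZ.
rewrite expectD//; [|exact: bounded_mfunZ|exact: bounded_mfunZ].
rewrite !expectZ// Eq mulr1 -/(zonal_expect c _) -/(L _).
have K0 : 0 <= K by rewrite !mulr_ge0// sqr_ge0.
have := ler_wpM2l K0 hs; have := ymin _ bz.
rewrite (_ : 2 * N.+2%:R ^+ 2 * k%:R ^+ 2 * M / r%:R ^+ 2 =
  K * (N.+2%:R ^+ 2 / r%:R ^+ 2)); last by rewrite /K; ring.
by rewrite /d2; lra.
Qed.

End BallBlock.

(** * Preorderings and the simplex *)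

Section Membership.
Context (R : realType).

Section InPreordering.
Context (n : nat).
Implicit Types (g : seq {mpoly R[n]}) (p q h : {mpoly R[n]}) (b : bitseq).

Lemma half_degM_le p q : (half_deg (p * q)%R <= half_deg p + half_deg q)%N.
Proof. by rewrite /half_deg; have := pdegM p q; lia. Qed.

Definition mask_prod g b : {mpoly R[n]} := \prod_(h <- mask b g) h.

(* Subsets of the list [g] are encoded by masks, which behave well under
   concatenation of lists. *)
Definition in_preordering g r q := exists2 S : seq (bitseq * {mpoly R[n]}),
  forall t, t \in S -> size t.1 = size g /\
    (t.2 != 0 -> (pdeg t.2 + half_deg (mask_prod g t.1) <= r)%N) &
  q = \sum_(t <- S) t.2 ^+ 2 * mask_prod g t.1.

Lemma in_preordering_term g r b h : size b = size g ->
  (h != 0 -> (pdeg h + half_deg (mask_prod g b) <= r)%N) ->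
  in_preordering g r (h ^+ 2 * mask_prod g b).
Proof.
move=> sb hb; exists [:: (b, h)]; last by rewrite big_seq1.
by move=> t; rewrite inE => /eqP ->.
Qed.

Lemma in_preorderingD g r p q :
  in_preordering g r p -> in_preordering g r q -> in_preordering g r (p + q).
Proof.
move=> [S hS ->] [T hT ->]; exists (S ++ T); last by rewrite big_cat.
by move=> t; rewrite mem_cat => /orP[/hS|/hT].
Qed.

Lemma in_preordering_sum g r (I : Type) (s : seq I) (F : I -> {mpoly R[n]}) :
  (forall i, in_preordering g r (F i)) -> in_preordering g r (\sum_(i <- s) F i).
Proof.
move=> hF; elim: s => [|i s ih]; first by exists [::] => //; rewrite !big_nil.
by rewrite big_cons; exact: in_preorderingD.
Qed.

Lemma in_preordering_widen g r r' q : (r <= r')%N ->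
  in_preordering g r q -> in_preordering g r' q.
Proof.
move=> rr [S hS ->]; exists S => // t /hS[s1 h1].
by split=> // t0; exact: leq_trans (h1 t0) rr.
Qed.

Lemma in_preordering_nil : in_preordering [::] 0 1.
Proof.
exists [:: ([::], 1)]; last by rewrite big_seq1 /mask_prod big_nil expr1n mulr1.
move=> t; rewrite inE => /eqP -> /=; split=> // _.
by rewrite /mask_prod big_nil /half_deg pdeg1.
Qed.

(** Rounding up the half degrees separately can only overestimate that of the product, so the levels
    add. Applied once per block, this is the origin of the level [m * r]. *)
Lemma in_preordering_cat g g' r r' q q' : in_preordering g r q ->
  in_preordering g' r' q' -> in_preordering (g ++ g') (r + r') (q * q').
Proof.
move=> [S hS ->] [T hT ->].
have mcat t u : t \in S -> mask_prod (g ++ g') (t.1 ++ u.1) =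
    mask_prod g t.1 * mask_prod g' u.1 :> {mpoly R[n]}.
  by move=> /hS[st _]; rewrite /mask_prod mask_cat// big_cat.
exists [seq (t.1 ++ u.1, t.2 * u.2) | t <- S, u <- T] => [v|].
  move=> /allpairsP[[t u]/= [tS uT ->]] /=.
  have [st ht] := hS t tS; have [su hu] := hT u uT.
  split; first by rewrite !size_cat st su.
  rewrite mcat// => tu; have t0 : t.2 != 0 by apply: contra_neq tu => ->; rewrite mul0r.
  have u0 : u.2 != 0 by apply: contra_neq tu => ->; rewrite mulr0.
  apply: (leq_trans (leq_add (pdegM _ _) (half_degM_le _ _))).
  by rewrite addnACA; exact: leq_add (ht t0) (hu u0).
rewrite big_allpairs_dep/= big_distrlr/=.
apply: eq_big_seq => t tS; apply: eq_big_seq => u uT.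
by rewrite mcat//; ring.
Qed.

Lemma in_preordering_flatten r (I : Type) (s : seq I) (G : I -> seq {mpoly R[n]})
    (q : I -> {mpoly R[n]}) : (forall i, in_preordering (G i) r (q i)) ->
  in_preordering (flatten [seq G i | i <- s]) (size s * r) (\prod_(i <- s) q i).
Proof.
move=> hq; elim: s => [|i s ih]; first by rewrite big_nil; exact: in_preordering_nil.
by rewrite big_cons /= mulSn; exact: in_preordering_cat.
Qed.

(** Terms whose masks select the same positions are merged into one sum of squares. Terms with zero
    polynomial are dropped first, because no degree bound is recorded for them. *)
Lemma in_preorderingP g r q : in_preordering g r q -> preordering g r q.
Proof.
move=> [S hS ->].
pose J (b : bitseq) : {set 'I_(size g)} := finset (fun i : 'I_(size g) => nth false b i).
have JE b : prod_constraints (J b) = mask_prod g b.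
  rewrite /mask_prod big_mask /prod_constraints; apply: eq_big => [i|i _].
    by rewrite inE andbT.
  by rewrite (tnth_nth 0).
exists (fun K => \sum_(t <- S | (t.2 != 0) && (J t.1 == K)) t.2 ^+ 2); split.
  move=> K dK; split; last first.
    by exists [seq t.2 | t <- S & (t.2 != 0) && (J t.1 == K)]; rewrite big_map big_filter.
  rewrite big_seq_cond; apply: pdeg_sum_le => t /andP[/hS[_ ht]] /andP[/ht h /eqP tK].
  apply: leq_trans (pdegXn 2 (leqnn _)) _.
  have sub (u v : nat) : (u + v <= r)%N -> (2 * u <= 2 * (r - v))%N by lia.
  by apply: sub; rewrite -tK JE.
transitivity (\sum_(t <- S | t.2 != 0) t.2 ^+ 2 * mask_prod g t.1).
  rewrite [RHS]big_mkcond; apply: eq_bigr => t _.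
  by case: eqP => //= ->; rewrite expr0n mul0r.
under [RHS]eq_bigr do rewrite mulr_suml.
rewrite big_seq_cond (partition_big (J \o fst)
  (fun K => (half_deg (prod_constraints K) <= r)%N)) /=; last first.
  by move=> t /andP[/hS[_ ht] /ht]; rewrite JE; apply: leq_trans; exact: leq_addl.
apply: eq_bigr => K _; rewrite [RHS]big_seq_cond.
apply: eq_big => [t|t /andP[_ /eqP <-]]; first by rewrite -andbA.
by rewrite JE.
Qed.

End InPreordering.

Lemma pdeg_comp_mpoly_le n k (lq : n.-tuple {mpoly R[k]}) e (p : {mpoly R[n]}) :
  (forall i, (pdeg (tnth lq i) <= e)%N) -> (pdeg (comp_mpoly lq p) <= pdeg p * e)%N.
Proof.
move=> he; rewrite comp_mpolyE big_seq.
apply: pdeg_sum_le => a /(pdegP p _ (leqnn _)) ap; apply: pdegZ_le.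
apply: leq_trans (leq_mul ap (leqnn e)); rewrite mdegE big_distrl/=.
elim/big_rec2: _ => [|i t q _ tq]; first by rewrite pdeg1.
by apply: pdegM_le => //; exact: pdegXn.
Qed.

Lemma in_preordering_map n k (lq : n.-tuple {mpoly R[k]}) (g : seq {mpoly R[n]}) r q :
  (forall i, (pdeg (tnth lq i) <= 1)%N) -> in_preordering g r q ->
  in_preordering [seq comp_mpoly lq h | h <- g] r (comp_mpoly lq q).
Proof.
move=> h1 [S hS ->].
have cM p p' : comp_mpoly lq (p * p') = comp_mpoly lq p * comp_mpoly lq p'.
  exact: (comp_mpoly_is_multiplicative lq).1.
have hd p : (pdeg (comp_mpoly lq p) <= pdeg p)%N.
  by have := pdeg_comp_mpoly_le p h1; rewrite muln1.
have hm b : mask_prod [seq comp_mpoly lq h | h <- g] b = comp_mpoly lq (mask_prod g b).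
  rewrite /mask_prod -map_mask big_map; apply/esym.
  exact: (big_morph (comp_mpoly lq) cM (comp_mpoly1 lq)).
exists [seq (t.1, comp_mpoly lq t.2) | t <- S].
  move=> _ /mapP[t /hS[st ht] ->] /=; split; first by rewrite size_map.
  move=> t0; have {t0}/ht : t.2 != 0.
    by apply: contra_neq t0 => ->; rewrite comp_mpoly0.
  by apply: leq_trans; rewrite hm leq_add// /half_deg !uphalfE half_leq// ltnS hd.
rewrite big_map (big_morph (comp_mpoly lq) (comp_mpolyD lq) (comp_mpoly0 lq)).
by apply: eq_bigr => t _; rewrite /= hm !expr2 !cM.
Qed.

Lemma in_preordering_poly_block m (n_ : 'I_m -> nat) i (g : seq {mpoly R[n_ i]}) r q :
  in_preordering g r q ->
  in_preordering [seq poly_block i h | h <- g] r (poly_block i q).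
Proof.
by apply: in_preordering_map => j; rewrite tnth_mktuple pdeg_mpolyX mdeg1.
Qed.

Lemma peval_poly_block m (n_ : 'I_m -> nat) i (p : {mpoly R[n_ i]}) x :
  peval (poly_block i p) x = peval p (point_block i x).
Proof.
rewrite /peval comp_mpoly_meval; apply: meval_eq => j.
by rewrite !tnth_mktuple mevalXU.
Qed.

Lemma in_preordering_ge0 n (g : seq {mpoly R[n]}) r q x : in_preordering g r q ->
  (forall h, h \in g -> 0 <= peval h x) -> 0 <= peval q x.
Proof.
move=> [S _ ->] hg; rewrite peval_sum sumr_ge0// => t _.
rewrite pevalM pevalXn mulr_ge0 ?sqr_ge0// /mask_prod peval_prod.
by rewrite big_seq prodr_ge0// => h /mem_mask/hg.
Qed.

Lemma constraints_ge0 s N (x : N.-tuple R) h :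
  body s N x -> h \in constraints R s N -> 0 <= peval h x.
Proof.
case: s => /=.
  by rewrite inE => bx /eqP ->; rewrite peval_ball_poly subr_ge0.
move=> [x0 x1]; rewrite mem_rcons inE => /predU1P[->|/mapP[j _ ->]].
  rewrite pevalD pevalN peval1 peval_sum subr_ge0.
  by under eq_bigr do rewrite pevalXU.
by rewrite pevalXU.
Qed.

Lemma ball_in_preordering N r (A B : {mpoly R[N]}) : (pdeg A <= r)%N ->
  B = 0 \/ (pdeg B < r)%N ->
  in_preordering (constraints R Ball N) r (A ^+ 2 + ball_poly R N * B ^+ 2).
Proof.
move=> dA dB; apply: in_preorderingD.
  rewrite -[A ^+ 2]mulr1 (_ : 1 = mask_prod (constraints R Ball N) [:: false]); last first.
    by rewrite /mask_prod big_nil.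
  apply: in_preordering_term => // _.
  by rewrite /mask_prod big_nil /half_deg pdeg1 addn0.
rewrite mulrC (_ : ball_poly R N = mask_prod (constraints R Ball N) [:: true]); last first.
  by rewrite /mask_prod big_seq1.
apply: in_preordering_term => // B0; case: dB => [BE|dB]; first by rewrite BE eqxx in B0.
by rewrite /mask_prod big_seq1 /half_deg; have := pdeg_ball_poly R N; rewrite /ball_poly; lia.
Qed.

End Membership.

(** * From the ball to the simplex *)

Section SimplexBlock.
Context (R : realType).

Section Parity.
Context (N : nat).
Implicit Types (p q A : {mpoly R[N]}) (x : N.-tuple R) (J K : {set 'I_N}).
Local Notation ball := (body Ball N : set (N.-tuple R)).
Local Notation simplex := (body Simplex N : set (N.-tuple R)).

Definition sq_pt x : N.-tuple R := [tuple tnth x j ^+ 2 | j < N].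

Definition comp_sq p : {mpoly R[N]} :=
  comp_mpoly [tuple mpolyX R (mnm1 j) ^+ 2 | j < N] p.

Lemma peval_comp_sq p x : peval (comp_sq p) x = peval p (sq_pt x).
Proof.
rewrite /peval comp_mpoly_meval; apply: meval_eq => j.
by rewrite !tnth_mktuple expr2 mevalM mevalXU.
Qed.

Lemma pdeg_comp_sq p : (pdeg (comp_sq p) <= pdeg p * 2)%N.
Proof.
apply: pdeg_comp_mpoly_le => j; rewrite tnth_mktuple.
by apply: (@pdegXn _ _ _ 2 1); rewrite pdeg_mpolyX mdeg1.
Qed.

Lemma body_sq_pt x : ball x -> simplex (sq_pt x).
Proof.
rewrite /body/= => bx; split=> [j|]; first by rewrite tnth_mktuple sqr_ge0.
by under eq_bigr do rewrite tnth_mktuple.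
Qed.

Lemma sq_pt_surj z : simplex z -> exists2 x, ball x & sq_pt x = z.
Proof.
move=> [z0 z1]; exists [tuple Num.sqrt (tnth z j) | j < N].
  rewrite /body/=; under eq_bigr do rewrite tnth_mktuple sqr_sqrtr//.
  exact: z1.
by apply: eq_from_tnth => j; rewrite !tnth_mktuple sqr_sqrtr.
Qed.

(** Both sides are linear in [p], and on a monomial both are the same [dirichlet_ratio]. *)
Lemma expect_sq_pt p :
  \int[ref_prob R Ball N]_(x in ball) peval p (sq_pt x) =
  \int[ref_prob R Simplex N]_(x in simplex) peval p x.
Proof.
have bm s a : bounded_mfun (body s N) (@monom R N a).
  apply: eq_bounded_mfun (@bounded_mfun_peval R s N (mpolyX R a)) => x _.
  exact: pevalX_mnm.
have bm2 a : bounded_mfun ball (fun x => @monom R N a (sq_pt x)).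
  apply: eq_bounded_mfun (@bounded_mfun_peval R Ball N (comp_sq (mpolyX R a))) => x _.
  by rewrite peval_comp_sq pevalX_mnm.
have mb s : measurable (body s N : set (N.-tuple R)) by exact: measurable_body.
under eq_Rintegral do rewrite pevalE.
under [RHS]eq_Rintegral do rewrite pevalE.
rewrite !expect_sum; [|exact: mb|by move=> a; exact: bounded_mfunZ
  |exact: mb|by move=> a; exact: bounded_mfunZ].
have momentE a : \int[ref_prob R Ball N]_(x in ball) @monom R N a (sq_pt x) =
    \int[ref_prob R Simplex N]_(x in simplex) @monom R N a x.
  transitivity (dirichlet_ratio R a 0).
    rewrite -(ref_prob_moment R Ball); apply: eq_Rintegral => x _.
    rewrite /body_monom expr0 mulr1; apply: eq_bigr => j _.
    by rewrite tnth_mktuple.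
  rewrite -(ref_prob_moment R Simplex); apply: eq_Rintegral => x _.
  by rewrite /body_monom expr0 mulr1.
apply: eq_bigr => a _.
transitivity (mcoeff a p * \int[ref_prob R Ball N]_(x in ball) @monom R N a (sq_pt x)).
  exact: (expectZ _ (mb Ball) _ (bm2 a)).
transitivity (mcoeff a p * \int[ref_prob R Simplex N]_(x in simplex) @monom R N a x);
  last exact/esym/(expectZ _ (mb Simplex) _ (bm Simplex a)).
exact: (congr1 (fun t => mcoeff a p * t) (momentE a)).
Qed.

Definition parity_set (a : multinom N) : {set 'I_N} := finset (fun j : 'I_N => odd (a j)).

Definition half_mnm (a : multinom N) : multinom N :=
  Multinom [tuple (a j)./2 | j < N].

Lemma half_mnmE a j : half_mnm a j = (a j)./2.
Proof. exact: mnmE. Qed.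

Definition parity_part A J : {mpoly R[N]} :=
  \sum_(a <- msupp A | parity_set a == J) mcoeff a A *: mpolyX R (half_mnm a).

Definition set_monom J : {mpoly R[N]} := \prod_(j in J) mpolyX R (mnm1 j).

Lemma pdeg_set_monom J : (pdeg (set_monom J) <= #|J|)%N.
Proof.
rewrite /set_monom -sum1_card; elim/big_rec2: _ => [|j t p _ tp].
  by rewrite pdeg1.
by apply: pdegM_le => //; rewrite pdeg_mpolyX mdeg1.
Qed.

Lemma parity_partE A x : peval A x =
  \sum_J peval (set_monom J) x * peval (parity_part A J) (sq_pt x).
Proof.
rewrite pevalE (partition_big parity_set xpredT)//=; apply: eq_bigr => J _.
rewrite /parity_part peval_sum mulr_sumr; apply: eq_bigr => a /eqP <-.
rewrite pevalZ mulrCA; congr (_ * _).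
rewrite pevalX_mnm /set_monom peval_prod big_mkcond -big_split/=.
apply: eq_bigr => j _; rewrite tnth_mktuple half_mnmE inE pevalXU.
rewrite -exprM -[in LHS](odd_double_half (a j)) exprD mul2n.
by case: (odd (a j)).
Qed.

(** A nonzero part contains some monomial of [A], which is what bounds the cardinality of [J] by
    [d]; each monomial of the part costs twice its degree plus that cardinality. *)
Lemma pdeg_parity_part A J d : (pdeg A <= d)%N -> parity_part A J != 0 ->
  (#|J| + 2 * pdeg (parity_part A J) <= d)%N.
Proof.
move=> /pdegP dA A0.
have dm a : parity_set a = J -> (#|J| + 2 * mdeg (half_mnm a) = mdeg a)%N.
  move=> <-; rewrite !mdegE -sum1_card big_mkcond big_distrr -big_split/=.
  by apply: eq_bigr => j _; rewrite half_mnmE inE; case: ifP; lia.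
have hJ : (#|J| <= d)%N.
  case: (leqP #|J| d) => // dJ; case/eqP: A0.
  rewrite /parity_part big_seq_cond big1// => a /andP[/dA ad /eqP /dm].
  by lia.
have : (pdeg (parity_part A J) <= (d - #|J|)./2)%N.
  rewrite /parity_part big_seq_cond; apply: pdeg_sum_le => a /andP[/dA ad /eqP /dm h].
  by apply: pdegZ_le; rewrite pdeg_mpolyX; lia.
by lia.
Qed.

Lemma expect_ball_odd i p : (forall x, peval p (flip i x) = - peval p x) ->
  \int[ref_prob R Ball N]_(x in ball) peval p x = 0.
Proof.
move=> hp; apply: (@ref_prob_ball_odd _ _ i) => //.
have -> : peval p = fun x => \sum_(a <- msupp p) mcoeff a p * \prod_j tnth x j ^+ a j.
  by apply/funext => x; rewrite pevalE.
apply: measurable_sum => a; apply: measurable_funM => //.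
by apply: measurable_prod => j _; apply: measurable_funX; exact: measurable_tnth.
Qed.

Lemma flip_set_monom i J x :
  peval (set_monom J) (flip i x) = (-1) ^+ (i \in J) * peval (set_monom J) x.
Proof.
rewrite /set_monom !peval_prod; have [iJ|iJ] := boolP (i \in J).
  rewrite (bigD1 i)//= [in RHS](bigD1 i)//= !pevalXU tnth_flip eqxx expr1.
  rewrite mulrA mulN1r; congr (_ * _); apply: eq_bigr => j /andP[_ ji].
  by rewrite !pevalXU tnth_flip (negbTE ji).
rewrite expr0 mul1r; apply: eq_bigr => j jJ; rewrite !pevalXU tnth_flip.
by have /negbTE -> : j != i by apply: contraNneq iJ => <-.
Qed.

Lemma sq_pt_flip i x : sq_pt (flip i x) = sq_pt x.
Proof.
apply: eq_from_tnth => j; rewrite [LHS]tnth_mktuple [RHS]tnth_mktuple tnth_flip.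
by case: ifP => // _; rewrite sqrrN.
Qed.

(** Written in the squares of the coordinates, this is the part of [A ^+ 2] that is invariant under
    all sign changes. *)
Definition simplex_square A : {mpoly R[N]} :=
  \sum_J parity_part A J ^+ 2 * set_monom J.

(* The substitution [x_j -> x_j^2] maps the ball to the simplex. Products of parts
   of [A] of different parities are odd in some coordinate and integrate to 0. *)
Lemma expect_simplex_square p A :
  \int[ref_prob R Ball N]_(x in ball) (peval p (sq_pt x) * peval A x ^+ 2) =
  \int[ref_prob R Simplex N]_(x in simplex) (peval p x * peval (simplex_square A) x).
Proof.
have mb : measurable ball by exact: measurable_body.
pose G (z : {set 'I_N} * {set 'I_N}) : {mpoly R[N]} := comp_sq p *
  (set_monom z.1 * comp_sq (parity_part A z.1)) *
  (set_monom z.2 * comp_sq (parity_part A z.2)).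
have GE z x : peval (G z) x = peval p (sq_pt x) *
    (peval (set_monom z.1) x * peval (parity_part A z.1) (sq_pt x)) *
    (peval (set_monom z.2) x * peval (parity_part A z.2) (sq_pt x)).
  by rewrite /G !pevalM !peval_comp_sq.
transitivity (\int[ref_prob R Ball N]_(x in ball)
    \sum_(z <- index_enum ({set 'I_N} * {set 'I_N})%type) peval (G z) x).
  apply: eq_Rintegral => x _; rewrite (parity_partE A) expr2 big_distrlr/=.
  rewrite pair_bigA/= mulr_sumr; apply: eq_bigr => -[J K] _ /=.
  by rewrite GE; ring.
rewrite expect_sum//; last by move=> z; exact: bounded_mfun_peval.
rewrite -(pair_bigA _ (fun J K => \int[ref_prob R Ball N]_(x in ball) peval (G (J, K)) x))/=.
transitivity (\sum_J \int[ref_prob R Ball N]_(x in ball) peval (G (J, J)) x).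
  apply: eq_bigr => J _; rewrite (bigD1 J)//= big1 ?addr0// => K KJ.
  have [i iJK] : exists i, (i \in J) != (i \in K).
    apply/existsP; rewrite -[X in is_true X]negbK negb_exists; apply: contra KJ.
    move=> /forallP h; apply/eqP/setP => i; have := h i; rewrite negbK => /eqP ->.
    by [].
  apply: (@expect_ball_odd i (G (J, K))) => x.
  rewrite (GE _ (flip i x)) (GE _ x).
  rewrite sq_pt_flip /fst /snd.
  rewrite !flip_set_monom.
  move: iJK; case: (i \in J); case: (i \in K) => // _.
    by rewrite expr1 expr0; ring.
  by rewrite expr1 expr0; ring.
transitivity (\sum_(J <- index_enum {set 'I_N}) \int[ref_prob R Ball N]_(x in ball)
    peval (p * (parity_part A J ^+ 2 * set_monom J)) (sq_pt x)).
  apply: eq_bigr => J _; apply: eq_Rintegral => x _.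
  rewrite GE !pevalM /set_monom !peval_prod.
  have -> : \prod_(j in J) peval (mpolyX R (mnm1 j)) (sq_pt x) =
      (\prod_(j in J) peval (mpolyX R (mnm1 j)) x) ^+ 2.
    rewrite expr2 -big_split/=; apply: eq_bigr => j _.
    by rewrite !pevalXU tnth_mktuple expr2.
  ring.
under eq_bigr do rewrite expect_sq_pt.
rewrite -expect_sum; [|exact: measurable_body|by move=> J; exact: bounded_mfun_peval].
apply: eq_Rintegral => x _; rewrite /simplex_square -pevalM -peval_sum.
by rewrite mulr_sumr.
Qed.

Definition simplex_poly : {mpoly R[N]} := 1 - \sum_(j < N) mpolyX R (mnm1 j).

Lemma simplex_polyE x : peval simplex_poly (sq_pt x) = peval (ball_poly R N) x.
Proof.
rewrite peval_ball_poly pevalD pevalN peval1 peval_sum; congr (_ - _).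
by apply: eq_bigr => j _; rewrite pevalXU tnth_mktuple.
Qed.

Lemma pdeg_simplex_poly : (pdeg simplex_poly <= 1)%N.
Proof.
apply: pdegD_le; rewrite ?pdeg1// pdegN; apply: pdeg_sum_le => j _.
by rewrite pdeg_mpolyX mdeg1.
Qed.

(** The degree bound for the parts, halved and rounded, is exactly the bound of the preordering,
    since [set_monom J] has degree at most the cardinality of [J]. The strict bound on the degree of
    [B] pays for the extra factor [simplex_poly]. *)
Lemma simplex_in_preordering r A B : (pdeg A <= 2 * r)%N ->
  B = 0 \/ (pdeg B < 2 * r)%N ->
  in_preordering (constraints R Simplex N) r
    (simplex_square A + simplex_poly * simplex_square B).
Proof.
move=> dA dB; pose g := constraints R Simplex N.
pose b J e := rcons [seq j \in J | j <- enum 'I_N] e.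
have sb J e : size (b J e) = size g by rewrite !size_rcons !size_map.
have bE J e : mask_prod g (b J e) = set_monom J * simplex_poly ^+ e.
  rewrite /mask_prod mask_rcons ?size_map// big_cat/=; congr (_ * _).
    rewrite -map_mask -filter_mask big_map big_filter big_enum_cond.
    by apply: eq_bigl => j.
  by case: e => /=; rewrite ?big_seq1 ?big_nil.
apply: in_preorderingD.
  apply: in_preordering_sum => J; rewrite -[set_monom J]mulr1 -[1](expr0 simplex_poly).
  rewrite -(bE J false); apply: in_preordering_term => //.
  move=> /(pdeg_parity_part dA); rewrite bE expr0 mulr1 /half_deg.
  by have := pdeg_set_monom J; lia.
rewrite mulr_sumr; apply: in_preordering_sum => J; rewrite mulrCA [_ * set_monom J]mulrC.
rewrite -[X in _ * X]expr1 -(bE J true); apply: in_preordering_term => //.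
case: dB => [->|dB].
  by rewrite /parity_part msupp0 big_nil eqxx.
have dB' : (pdeg B <= (2 * r).-1)%N by lia.
move=> /(pdeg_parity_part dB'); rewrite bE expr1 /half_deg.
have := pdegM (set_monom J) simplex_poly.
by have := pdeg_set_monom J; have := pdeg_simplex_poly; lia.
Qed.

End Parity.

(** For the simplex, pulling back to the ball doubles both the degree of [f] and the admissible
    degree of the kernel, so the quotient of [k] by [r], hence the error, is the same as for the
    ball. *)
Lemma body_block s N k r (f : {mpoly R[N]}) (M delta : R) : (0 < N)%N -> (0 < r)%N ->
  (pdeg f <= k)%N -> (forall z, body s N z -> `|peval f z| <= M) -> 0 < delta ->
  exists q, [/\ in_preordering (constraints R s N) r q,
    \int[ref_prob R s N]_(x in body s N) peval q x = 1 &
    forall z, body s N z ->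
      \int[ref_prob R s N]_(x in body s N) (peval f x * peval q x) <=
      peval f z + 2 * N.+1%:R ^+ 2 * k%:R ^+ 2 * M / r%:R ^+ 2 + delta].
Proof.
case: N f => // N f _ r0 fk; case: s => fM d0.
  have [A [B [dA dB q1 hq]]] := ball_block r0 fk fM d0.
  by exists (A ^+ 2 + ball_poly R N.+1 * B ^+ 2); split => //; exact: ball_in_preordering.
have r20 : (0 < 2 * r)%N by rewrite muln_gt0.
have fk2 : (pdeg (comp_sq f) <= k * 2)%N.
  by apply: leq_trans (pdeg_comp_sq f) _; rewrite leq_mul2r.
have fM2 z : body Ball N.+1 z -> `|peval (comp_sq f) z| <= M.
  by move=> bz; rewrite peval_comp_sq; apply: fM; exact: body_sq_pt.
have [A [B [dA dB q1 hq]]] := ball_block r20 fk2 fM2 d0.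
pose q := simplex_square A + simplex_poly N.+1 * simplex_square B.
have main (p : {mpoly R[N.+1]}) :
    \int[ref_prob R Ball N.+1]_(x in body Ball N.+1) (peval (comp_sq p) x *
      peval (A ^+ 2 + ball_poly R N.+1 * B ^+ 2) x) =
    \int[ref_prob R Simplex N.+1]_(x in body Simplex N.+1) (peval p x * peval q x).
  have mb s : measurable (body s N.+1 : set (N.+1.-tuple R)) by exact: measurable_body.
  have bm s (p1 p2 : {mpoly R[N.+1]}) :
      bounded_mfun (body s N.+1) (fun x => peval p1 x * peval p2 x).
    by apply: bounded_mfunM; exact: bounded_mfun_peval.
  transitivity (\int[ref_prob R Simplex N.+1]_(x in body Simplex N.+1)
      (peval p x * peval (simplex_square A) x +
       peval (p * simplex_poly N.+1) x * peval (simplex_square B) x)).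
    rewrite expectD// -!expect_simplex_square -expectD//.
    - apply: eq_Rintegral => x _; rewrite !pevalD !pevalM simplex_polyE.
      by rewrite peval_comp_sq; ring.
    - apply: eq_bounded_mfun (bm Ball (comp_sq p) (A ^+ 2)) => x _.
      by rewrite peval_comp_sq pevalXn.
    - apply: eq_bounded_mfun (bm Ball (comp_sq (p * simplex_poly N.+1)) (B ^+ 2)) => x _.
      by rewrite peval_comp_sq pevalXn.
  by apply: eq_Rintegral => x _; rewrite /q !pevalD !pevalM; ring.
exists q; split; first exact: simplex_in_preordering.
  transitivity (\int[ref_prob R Simplex N.+1]_(x in body Simplex N.+1)
      (peval (1 : {mpoly R[N.+1]}) x * peval q x)).
    by apply: eq_Rintegral => x _; rewrite peval1 mul1r.
  rewrite -main -[RHS]q1; apply: eq_Rintegral => x _.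
  by rewrite peval_comp_sq peval1 mul1r.
move=> z /sq_pt_surj[x bx <-]; rewrite -main; apply: (le_trans (hq x bx)).
rewrite peval_comp_sq !natrM lerD2r lerD2l le_eqVlt; apply/orP; left; apply/eqP.
have : r%:R != 0 :> R by rewrite pnatr_eq0 -lt0n.
by move=> r1; field.
Qed.

End SimplexBlock.

(** * Products of bodies *)

Section ProductExpectation.
Context (R : realType).

Lemma bounded_mfun_patch d (T : measurableType d) (D : set T) (f : T -> R) :
  measurable D -> bounded_mfun D f -> bounded_mfun [set: T] (f \_ D).
Proof.
move=> mD [mf [C fC]]; split; first exact/(measurable_restrictT _ mD).1.
exists `|C| => x _; rewrite patchE; case: ifPn => [|_]; last by rewrite normr0.
by rewrite inE => /fC xC; rewrite (le_trans xC)// ler_norm.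
Qed.

Local Notation glueR := (@Defs.glue R _ _).

Section Tensor.
Context d1 d2 (T1 : measurableType d1) (T2 : measurableType d2).
Variables (P : probability T1 R) (Q : probability T2 R).

Lemma integral_tensor (u : T1 -> R) (v : T2 -> R) :
  bounded_mfun [set: T1] u -> bounded_mfun [set: T2] v ->
  (P \x Q)%E.-integrable [set: _] (fun z => (u z.1 * v z.2)%:E) /\
  (\int[P \x Q]_z (u z.1 * v z.2)%:E =
   (\int[P]_x u x * \int[Q]_y v y)%R%:E)%E.
Proof.
move=> bu bv; have iu := bounded_mfun_integrable P measurableT bu.
have iv := bounded_mfun_integrable Q measurableT bv.
have PQoo : ((P \x Q)%E [set: T1 * T2] < +oo)%E.
  rewrite -setXTT product_measure1E//.
  rewrite [X in (X * _)%E](probability_setT P) [X in (_ * X)%E](probability_setT Q).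
  by rewrite mule1 ltry.
have ib : (P \x Q)%E.-integrable [set: _] (fun z => (u z.1 * v z.2)%:E).
  move: bu bv => [mu [A uA]] [mv [B vB]].
  suff : (P \x Q)%E.-integrable [set: _] (EFin \o (fun z : T1 * T2 => u z.1 * v z.2)) by [].
  apply: measurable_bounded_integrable => //.
  - apply: measurable_funM.
      exact: (measurableT_comp mu).
    exact: (measurableT_comp mv).
  - exists (A * B); split; first exact: num_real.
    move=> M AM z _; apply: (le_trans _ (ltW AM)).
    by rewrite normrM ler_pM//; [exact: uA|exact: vB].
split=> //; rewrite -(integral12_prod_meas1 ib) /fubini_F/=.
transitivity (\int[P]_x ((\int[Q]_y v y)%:E * (u x)%:E))%E.
  apply: eq_integral => x _.
  transitivity ((u x)%:E * \int[Q]_y (v y)%:E)%E.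
    by rewrite -integralZl//; apply: eq_integral => y _; rewrite EFinM.
  by rewrite muleC /Rintegral fineK//; exact: integrable_fin_num.
rewrite integralZl// mulrC EFinM; congr (_ * _)%E.
by rewrite /Rintegral fineK//; exact: integrable_fin_num.
Qed.

End Tensor.

(** Extending the functions by 0 outside the domains moves the integral to the whole product space,
    where the integrand is a product in separate variables and Fubini applies. *)
Lemma expect_glue m (n_ : 'I_m.+1 -> nat) (P : probability ((n_ ord0).-tuple R) R)
    (Q : probability ((\sum_(i < m) n_ (lift ord0 i)).-tuple R) R)
    (D : set ((\sum_i n_ i).-tuple R)) D1 D2 h u v :
  measurable D -> measurable D1 -> measurable D2 ->
  bounded_mfun D h -> bounded_mfun D1 u -> bounded_mfun D2 v ->
  (forall z, D (glueR z) <-> D1 z.1 /\ D2 z.2) ->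
  (forall z, D1 z.1 -> D2 z.2 -> h (glueR z) = u z.1 * v z.2) ->
  \int[glue_prob P Q]_(x in D) h x =
  \int[P]_(x in D1) u x * \int[Q]_(y in D2) v y.
Proof.
move=> mD mD1 mD2 bh bu bv DE hE; 
rewrite Rintegral_mkcond [X in _ = X * _]Rintegral_mkcond [X in _ = _ * X]Rintegral_mkcond.
have [it te] := integral_tensor P Q (bounded_mfun_patch mD1 bu) (bounded_mfun_patch mD2 bv).
have hg z : (h \_ D) (glueR z) = (u \_ D1) z.1 * (v \_ D2) z.2.
  rewrite !patchE; have [z1|z1] := pselect (D1 z.1); last first.
    rewrite (memNset z1) mul0r ifF//; apply/negbTE/negP; rewrite inE => /DE[].
    by [].
  have [z2|z2] := pselect (D2 z.2); last first.
    rewrite (memNset z2) mulr0 ifF//; apply/negbTE/negP; rewrite inE => /DE[].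
    by [].
  by rewrite !mem_set ?hE//; exact/DE.
have [mh _] := bounded_mfun_patch mD bh.
rewrite {1}/Rintegral.
transitivity (fine (\int[(P \x Q)%E]_z ((h \_ D) (glueR z))%:E)%E).
  congr fine.
  transitivity (\int[pushforward (P \x Q)%E (@Defs.glue R m n_)]_x ((h \_ D) x)%:E)%E.
    exact: eq_measure_integral.
  rewrite (@integral_pushforward _ _ _ _ _ _ (@measurable_glue R m n_))//.
  - exact/measurable_EFinP.
  - rewrite preimage_setT; congr (_.-integrable _ _): it; apply/funext => z /=.
    by rewrite hg.
under eq_integral do rewrite hg.
by rewrite te.
Qed.

Section ProdRef.
Context (m : nat) (s : 'I_m -> body_kind) (n_ : 'I_m -> nat).

Lemma measurable_point_block i :
  measurable_fun [set: _] (@point_block m n_ R i).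
Proof.
apply/measurable_fun_tnthP => j.
rewrite (_ : _ \o _ = fun x => tnth x (tagnat.Rank i j)); first exact: measurable_tnth.
by apply/funext => x; rewrite /= /point_block tnth_mktuple.
Qed.

Lemma measurable_prod_body : measurable (prod_body R s n_).
Proof.
rewrite (_ : prod_body R s n_ = \bigcap_(i in [set: 'I_m])
    (@point_block m n_ R i @^-1` body (s i) (n_ i))); last first.
  by apply/seteqP; split => [x Ax i _|x Ax i]; [exact: Ax|exact: (Ax i I)].
apply: fin_bigcap_measurable => // i _.
rewrite -[X in measurable X]setTI.
by apply: measurable_point_block => //; exact: measurable_body.
Qed.

Lemma bounded_mfun_block i (h : (n_ i).-tuple R -> R) : bounded_mfun (body (s i) (n_ i)) h ->
  bounded_mfun (prod_body R s n_) (fun x => h (point_block i x)).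
Proof.
move=> [mh [C hC]]; split.
  apply: (measurable_comp (F := body (s i) (n_ i))) => //.
  - exact: measurable_body.
  - by move=> _ [x Dx <-]; exact: Dx.
  - by apply: measurable_funTS; exact: measurable_point_block.
by exists C => x Dx; apply: hC; exact: Dx.
Qed.

End ProdRef.

Lemma expect_prod m (s : 'I_m -> body_kind) (n_ : 'I_m -> nat)
    (h : forall i, (n_ i).-tuple R -> R) :
  (forall i, bounded_mfun (body (s i) (n_ i)) (h i)) ->
  \int[prod_ref R s n_]_(x in prod_body R s n_) \prod_i h i (point_block i x) =
  \prod_i \int[ref_prob R (s i) (n_ i)]_(x in body (s i) (n_ i)) h i x.
Proof.
elim: m s n_ h => [|m ih] s n_ h bh.
  rewrite [RHS]big_ord0 /prod_ref/=.
  transitivity (\int[prod_ref R s n_]_(x in prod_body R s n_) (1 : R)).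
    by apply: eq_Rintegral => x _; exact: big_ord0.
  rewrite Rintegral_cst; last exact: measurable_prod_body.
  rewrite mul1r; change (fine (\d_ ([tuple 0 | _ < _] : (\sum_i n_ i).-tuple R)
    (prod_body R s n_)) = 1 :> R).
  by rewrite diracE mem_set//= => -[].
rewrite [RHS]big_ord_recl -(ih (fun i => s (lift ord0 i)) (fun i => n_ (lift ord0 i))
  (fun i => h (lift ord0 i)))//.
apply: expect_glue.
- exact: measurable_prod_body.
- exact: measurable_body.
- exact: measurable_prod_body.
- by apply: bounded_mfun_prod => i; exact: bounded_mfun_block.
- exact: bh.
- by apply: bounded_mfun_prod => i; apply: (bounded_mfun_block
    (s := fun i => s (lift ord0 i))); exact: bh.
- move=> z; split=> [Dz|[Dz0 Dz] i].
    split=> [|i]; first by have := Dz ord0; rewrite point_block_glue0.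
    by have := Dz (lift ord0 i); rewrite point_block_glueS.
  by have [j ->|->] := unliftP ord0 i; rewrite ?point_block_glueS ?point_block_glue0.
- move=> z _ _; rewrite big_ord_recl point_block_glue0; congr (_ * _).
  by apply: eq_bigr => i _; rewrite point_block_glueS.
Qed.

Section BlockPoly.
Context (m : nat) (s : 'I_m -> body_kind) (n_ : 'I_m -> nat).
Local Notation n := (\sum_i n_ i)%N.
Local Notation X := (prod_body R s n_).
Local Notation mu := (prod_ref R s n_).

Lemma big_block (T : Type) (idx : T) (op : Monoid.com_law idx) (F : 'I_n -> T) :
  \big[op/idx]_j F j = \big[op/idx]_i \big[op/idx]_(j < n_ i) F (tagnat.Rank i j).
Proof.
rewrite (reindex (@tagnat.rank m n_)); last exact: tagnat.rank_bij_on.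
rewrite (eq_bigr (fun p => F (tagnat.Rank (tag p) (tagged p)))) => [|p _].
  by rewrite [RHS]sig_big_dep.
by rewrite tagnat.rankE.
Qed.

Lemma monom_block (a : multinom n) (x : n.-tuple R) :
  monom a x = \prod_i monom (mnm_block i a) (point_block i x).
Proof.
rewrite /monom big_block; apply: eq_bigr => i _; apply: eq_bigr => j _.
by rewrite tnth_mktuple mnmE.
Qed.

Lemma mdeg_mnm_block (a : multinom n) : mdeg a = (\sum_i mdeg (mnm_block i a))%N.
Proof.
rewrite mdegE big_block; apply: eq_bigr => i _; rewrite mdegE.
by apply: eq_bigr => j _; rewrite mnmE.
Qed.

Lemma bounded_mfun_monom t N a : bounded_mfun (body t N) (@monom R N a).
Proof.
apply: eq_bounded_mfun (@bounded_mfun_peval R t N (mpolyX R a)) => x _.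
exact: pevalX_mnm.
Qed.

Lemma bounded_mfun_peval_prod p : bounded_mfun X (peval p).
Proof.
apply: bounded_mfun_meval => j.
have := bounded_mfun_block (@bounded_mfun_tnth R (s (tagnat.sig1 j)) _ (tagnat.sig2 j)).
by apply: eq_bounded_mfun => x _; rewrite tnth_mktuple tagnat.sig2K.
Qed.

Lemma moment_prod (a : multinom n) : moment mu X a =
  \prod_i moment (ref_prob R (s i) (n_ i)) (body (s i) (n_ i)) (mnm_block i a).
Proof.
rewrite /moment -expect_prod; last by move=> i; exact: bounded_mfun_monom.
by apply: eq_Rintegral => x _; exact: monom_block.
Qed.

Lemma expect_prod_cst c : \int[mu]_(x in X) c = c.
Proof.
have := @expect_prod m s n_ (fun _ _ => 1) (fun i => bounded_mfun_cst _ _).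
rewrite [RHS]big1 => [|i _]; last exact: expect_cst.
under eq_Rintegral do rewrite big1//.
rewrite !(Rintegral_cst mu (@measurable_prod_body m s n_)) mul1r => ->.
by rewrite mulr1.
Qed.

End BlockPoly.
End ProductExpectation.

(** * Choice of the densities block by block *)

Section ProductBlock.
Context (R : realType) (m : nat) (s : 'I_m -> body_kind) (n_ : 'I_m -> nat).
Local Notation n := (\sum_i n_ i)%N.
Local Notation X := (prod_body R s n_).
Local Notation mu := (prod_ref R s n_).
Local Notation bodyi i := (body (s i) (n_ i) : set ((n_ i).-tuple R)).
Local Notation E i f := (\int[ref_prob R (s i) (n_ i)]_(x in bodyi i) f x).

Definition assemble (z : forall i, (n_ i).-tuple R) : n.-tuple R :=
  [tuple tnth (z (tag (tagnat.sig j))) (tagged (tagnat.sig j)) | j < n].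

Lemma point_block_assemble z i : point_block i (assemble z) = z i.
Proof.
apply: eq_from_tnth => j; rewrite [LHS]tnth_mktuple [LHS]tnth_mktuple.
by rewrite /tagnat.Rank tagnat.rankK.
Qed.

Lemma assemble_point_block x : assemble (fun i => point_block i x) = x.
Proof.
apply: eq_from_tnth => j; rewrite [LHS]tnth_mktuple [LHS]tnth_mktuple.
by rewrite -tagnat.rankE tagnat.sigK.
Qed.

(** The common features of a point evaluation and of the integration against a density: linearity
    and domination by the maximum norm. Treated and untreated blocks are thus handled alike. *)
Definition body_functional i (phi : {mpoly R[n_ i]} -> R) :=
  (forall c p q, phi (c *: p + q) = c * phi p + phi q) /\
  (forall p M, (forall z, bodyi i z -> `|peval p z| <= M) -> `|phi p| <= M).

Lemma body_functional_peval i z : bodyi i z -> body_functional (fun p => peval p z).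
Proof.
by move=> bz; split=> [c p q|p M]; [rewrite pevalD pevalZ|exact].
Qed.

Lemma body_functional_density i r q : in_preordering (constraints R (s i) (n_ i)) r q ->
  E i (peval q) = 1 -> body_functional (fun p => E i (fun x => peval p x * peval q x)).
Proof.
move=> hq q1; have mb : measurable (bodyi i) by exact: measurable_body.
have bp p : bounded_mfun (bodyi i) (fun x => peval p x * peval q x).
  by apply: bounded_mfunM; exact: bounded_mfun_peval.
have q0 x : bodyi i x -> 0 <= peval q x.
  by move=> bx; apply: (in_preordering_ge0 hq) => h; exact: constraints_ge0.
split=> [c p p'|p M pM].
  transitivity (E i (fun x => c * (peval p x * peval q x) + peval p' x * peval q x)).
    by apply: eq_Rintegral => x _; rewrite pevalD pevalZ; ring.
  rewrite expectD//; last exact/bounded_mfunZ/bp.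
  by rewrite expectZ.
have EM c : E i (fun x => c * peval q x) = c.
  by rewrite expectZ ?q1 ?mulr1//; exact: bounded_mfun_peval.
have bM c : bounded_mfun (bodyi i) (fun x => c * peval q x).
  by apply: bounded_mfunZ; exact: bounded_mfun_peval.
rewrite ler_norml; apply/andP; split.
  rewrite -[leLHS]EM; apply: ler_expect => // x bx; rewrite ler_wpM2r ?q0//.
  by have := pM _ bx; rewrite ler_norml => /andP[].
rewrite -[leRHS]EM; apply: ler_expect => // x bx; rewrite ler_wpM2r ?q0//.
by have := pM _ bx; rewrite ler_norml => /andP[].
Qed.

Variables (f : {mpoly R[n]}) (k : nat) (M : R).
Hypothesis fk : (pdeg f <= k)%N.
Hypothesis fM : forall x, X x -> `|peval f x| <= M.

(* [f] integrated against a tensor product of functionals, each of which is either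
   the evaluation at a point or the integration against a density. *)
Definition tensor_apply (phi : forall i, {mpoly R[n_ i]} -> R) : R :=
  \sum_(a <- msupp f) mcoeff a f * \prod_i phi i (mpolyX R (mnm_block i a)).

(** The polynomial that remains in block [i] once the functionals of all other blocks have been
    applied. It has degree at most [k], so the estimate for a single body applies to it with the
    same [k]. *)
Definition tensor_partial (phi : forall i, {mpoly R[n_ i]} -> R) i : {mpoly R[n_ i]} :=
  \sum_(a <- msupp f)
    (mcoeff a f * \prod_(j | j != i) phi j (mpolyX R (mnm_block j a))) *:
    mpolyX R (mnm_block i a).

Lemma eq_tensor_apply phi phi' : (forall i p, phi i p = phi' i p) ->
  tensor_apply phi = tensor_apply phi'.
Proof.
by move=> h; apply: eq_bigr => a _; congr (_ * _); apply: eq_bigr => i _; exact: h.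
Qed.

Lemma eq_tensor_partial phi phi' i : (forall j p, j != i -> phi j p = phi' j p) ->
  tensor_partial phi i = tensor_partial phi' i.
Proof.
move=> h; apply: eq_bigr => a _; congr (_ * _ *: _).
by apply: eq_bigr => j ji; exact: h.
Qed.

Lemma tensor_partialE phi i : body_functional (phi i) ->
  tensor_apply phi = phi i (tensor_partial phi i).
Proof.
move=> [lin _]; have phi0 : phi i 0 = 0.
  by have := lin 0 0 0; rewrite scale0r addr0 mul0r add0r => h; have := lin 1 0 0;
    rewrite scaler0 addr0 mul1r => /eqP; rewrite -subr_eq0 opprD addrA subrr add0r oppr_eq0 => /eqP.
rewrite /tensor_apply /tensor_partial.
elim: (msupp f) => [|a t ih]; first by rewrite !big_nil phi0.
rewrite !big_cons lin ih; congr (_ + _).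
by rewrite [X in _ * X = _](bigD1 i)//=; ring.
Qed.

Lemma tensor_apply_dfwith phi i w :
  tensor_apply (@eqtype.dfwith _ (fun i => {mpoly R[n_ i]} -> R) phi i (fun p => peval p w)) =
  peval (tensor_partial phi i) w.
Proof.
rewrite /tensor_partial peval_sum; apply: eq_bigr => a _; rewrite pevalZ -mulrA.
congr (_ * _); rewrite (bigD1 i)//= mulrC eqtype.dfwith_in; congr (_ * _).
by apply: eq_bigr => j ji; rewrite eqtype.dfwith_out// eq_sym.
Qed.

Lemma tensor_apply_peval z :
  tensor_apply (fun i p => peval p (z i)) = peval f (assemble z).
Proof.
rewrite pevalE; apply: eq_bigr => a _; rewrite monom_block; congr (_ * _).
by apply: eq_bigr => i _; rewrite point_block_assemble pevalX_mnm.
Qed.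

Lemma pdeg_tensor_partial phi i : (pdeg (tensor_partial phi i) <= k)%N.
Proof.
rewrite /tensor_partial big_seq; apply: pdeg_sum_le => a /(pdegP _ _ fk) ak.
apply: pdegZ_le; rewrite pdeg_mpolyX (leq_trans _ ak)//.
by rewrite mdeg_mnm_block (bigD1 i)//= leq_addr.
Qed.

(** The integer [l] bounds the blocks that may carry something else than an evaluation. By
    domination, the functional of the last such block can be replaced by the evaluation at an
    arbitrary point of its body; with none left, the value is one of [f] on the product. *)
Lemma tensor_apply_bound l phi z : (forall i, body_functional (phi i)) ->
  (forall i, bodyi i (z i)) ->
  (forall (i : 'I_m) p, (l <= i)%N -> phi i p = peval p (z i)) -> `|tensor_apply phi| <= M.
Proof.
elim: l phi z => [|l ih] phi z hphi bz hz.
  rewrite (eq_tensor_apply (phi' := fun i p => peval p (z i))) => [|i p]; last exact: hz.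
  rewrite tensor_apply_peval; apply: fM => i.
  by rewrite point_block_assemble.
have [ml|lm] := leqP m l.
  by apply: (ih phi z) => // i p; have := ltn_ord i; lia.
pose i0 := Ordinal lm; rewrite (tensor_partialE (hphi i0)).
apply: (hphi i0).2 => w bw; rewrite -tensor_apply_dfwith.
apply: (ih _ (@eqtype.dfwith _ (fun i => (n_ i).-tuple R) z i0 w)).
- by move=> i; case: eqtype.dfwithP => [|j _]; [exact: body_functional_peval|exact: hphi].
- by move=> i; case: eqtype.dfwithP => [|j _].
- move=> i p li; have [ii0|ii0] := eqVneq i0 i.
    by move: p li; rewrite -ii0 => p _; rewrite !eqtype.dfwith_in.
  rewrite !eqtype.dfwith_out//; apply: hz; rewrite ltn_neqAle li andbT.
  by rewrite -(inj_eq val_inj) in ii0.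
Qed.

Definition body_error r i : R := 2 * (n_ i).+1%:R ^+ 2 * k%:R ^+ 2 * M / r%:R ^+ 2.

Definition block_density r i (q : {mpoly R[n_ i]}) :=
  in_preordering (constraints R (s i) (n_ i)) r q /\ E i (peval q) = 1.

Definition mixed_functional z (q : forall i, {mpoly R[n_ i]}) l i (p : {mpoly R[n_ i]}) :=
  if (i < l)%N then E i (fun x => peval p x * peval (q i) x) else peval p (z i).

Definition body_errors r delta l : R := \sum_(i < m | (i < l)%N) (body_error r i + delta).

Lemma body_errors0 r delta : body_errors r delta 0 = 0.
Proof. exact: big_pred0. Qed.

Lemma body_errorsS r delta (i : 'I_m) :
  body_errors r delta i.+1 = body_error r i + delta + body_errors r delta i.
Proof.
rewrite /body_errors (bigD1 i)//=; congr (_ + _); apply: eq_bigl => j.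
by rewrite ltnS leq_eqVlt -val_eqE; case: ltngtP.
Qed.

Lemma body_errors_full r delta : body_errors r delta m = \sum_i (body_error r i + delta).
Proof. by apply: eq_bigl => i; rewrite ltn_ord. Qed.

Lemma mixed_density r delta z l : (forall i, 0 < n_ i)%N -> (0 < r)%N -> 0 < delta ->
  (forall i, bodyi i (z i)) -> (l <= m)%N -> exists q : forall i, {mpoly R[n_ i]},
  (forall i : 'I_m, (i < l)%N -> block_density r (q i)) /\
  tensor_apply (mixed_functional z q l) <=
    peval f (assemble z) + body_errors r delta l.
Proof.
move=> n0 r0 d0 bz; elim: l => [_|l ih lm].
  exists (fun=> 0); split=> //; rewrite body_errors0 addr0 -tensor_apply_peval.
  by rewrite (eq_tensor_apply (phi' := fun i p => peval p (z i))).
have [q [hq hE]] := ih (ltnW lm); pose i0 := Ordinal lm.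
pose F := tensor_partial (mixed_functional z q l) i0.
(* The earlier densities have total mass 1, so partial integration does not enlarge the bound, and
   the error of each block involves the same [M]. *)
have FM w : bodyi i0 w -> `|peval F w| <= M.
  move=> bw; rewrite -tensor_apply_dfwith.
  apply: (@tensor_apply_bound l _ (@eqtype.dfwith _ (fun i => (n_ i).-tuple R) z i0 w)).
  - move=> i; case: eqtype.dfwithP => [|j _]; first exact: body_functional_peval.
    rewrite /mixed_functional; case: (boolP (j < l)%N) => [jl|_].
      by have [hj qj] := hq j jl; exact: body_functional_density hj qj.
    exact: body_functional_peval.
  - by move=> i; case: eqtype.dfwithP => [|j _].
  - move=> i p li; have [ii0|ii0] := eqVneq i0 i.
    by move: p li; rewrite -ii0 => p _; rewrite !eqtype.dfwith_in.
    by rewrite !eqtype.dfwith_out// /mixed_functional ltnNge li.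
have [q0 [q0p q01 q0E]] := body_block (n0 i0) r0 (pdeg_tensor_partial _ i0) FM d0.
pose q' := @eqtype.dfwith _ (fun i => {mpoly R[n_ i]}) q i0 q0.
have lS (i : 'I_m) : (i < l.+1)%N = (i == i0) || (i < l)%N by rewrite ltnS leq_eqVlt -(inj_eq val_inj).
exists q'; split.
  move=> i; rewrite lS => /predU1P[->|il]; first by rewrite /q' eqtype.dfwith_in.
  rewrite /q' eqtype.dfwith_out; first exact: hq.
  by apply: contraTneq il => <-; rewrite ltnn.
have mixE : mixed_functional z q' l.+1 (i := i0) =
    fun p => E i0 (fun x => peval p x * peval q0 x).
  by apply/funext => p; rewrite /mixed_functional lS eqxx /= /q' eqtype.dfwith_in.
have FE : tensor_partial (mixed_functional z q' l.+1) i0 = F.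
  apply: eq_tensor_partial => j p ji; rewrite /mixed_functional lS (negbTE ji) /=.
  by case: ifP => // _; rewrite /q' eqtype.dfwith_out// eq_sym.
rewrite (@tensor_partialE _ i0) mixE ?FE; last exact: body_functional_density q0p q01.
apply: (le_trans (q0E _ (bz i0))); rewrite (body_errorsS r delta i0) -/F.
have -> : peval F (z i0) = tensor_apply (mixed_functional z q l).
  rewrite -tensor_apply_dfwith; apply: eq_tensor_apply => i p.
  case: eqtype.dfwithP p => [|j _] p //; rewrite /mixed_functional ltnn//.
by move: hE; rewrite /body_error /=; lra.
Qed.

Lemma product_block r delta x : (forall i, 0 < n_ i)%N -> (0 < r)%N -> 0 < delta -> X x ->
  exists q, [/\ in_preordering (all_constraints R s n_) (m * r) q,
    \int[mu]_(y in X) peval q y = 1 &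
    \int[mu]_(y in X) (peval f y * peval q y) <=
      peval f x + \sum_i (body_error r i + delta)].
Proof.
move=> n0 r0 d0 Xx.
have [q [hq hE]] := mixed_density n0 r0 d0 Xx (leqnn m).
have qE y : peval (\prod_i poly_block i (q i)) y = \prod_i peval (q i) (point_block i y).
  by rewrite peval_prod; apply: eq_bigr => i _; rewrite peval_poly_block.
exists (\prod_i poly_block i (q i)); split.
- have pE : \prod_(i <- enum 'I_m) poly_block i (q i) = \prod_i poly_block i (q i).
    exact: big_enum.
  have := @in_preordering_flatten R _ r _ (enum 'I_m)
    (fun i => [seq poly_block i g | g <- constraints R (s i) (n_ i)])
    (fun i => poly_block i (q i)).
  rewrite size_enum_ord pE; apply=> i; apply: in_preordering_poly_block.
  by have [] := hq i (ltn_ord i).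
- under eq_Rintegral do rewrite qE.
  rewrite (expect_prod (h := fun i => peval (q i))); last by move=> i; exact: bounded_mfun_peval.
  by rewrite big1// => i _; have [] := hq i (ltn_ord i).
(* With all blocks treated, every functional is an integration, and the tensor expression is the
   integral of [f] against the product density, expanded over the monomials of [f]. *)
rewrite assemble_point_block body_errors_full in hE.
apply: le_trans hE; rewrite le_eqVlt; apply/orP; left; apply/eqP.
have bm a i : bounded_mfun (bodyi i) (fun y => monom (mnm_block i a) y * peval (q i) y).
  by apply: bounded_mfunM; [exact: bounded_mfun_monom|exact: bounded_mfun_peval].
pose G a y := \prod_i (monom (mnm_block i a) (point_block i y) * peval (q i) (point_block i y)).
have bG a : bounded_mfun X (G a).
  by apply: bounded_mfun_prod => i; exact: (bounded_mfun_block (bm a i)).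
have mX : measurable X by exact: measurable_prod_body.
transitivity (\int[mu]_(y in X) \sum_(a <- msupp f) (mcoeff a f * G a y)).
  apply: eq_Rintegral => y _; rewrite pevalE qE mulr_suml; apply: eq_bigr => a _.
  by rewrite monom_block -mulrA -big_split.
rewrite expect_sum//; last by move=> a; exact: bounded_mfunZ.
apply: eq_bigr => a _; rewrite (expectZ mu mX _ (bG a)); congr (_ * _).
rewrite (expect_prod (bm a)); apply: eq_bigr => i _.
rewrite /mixed_functional ltn_ord; apply: eq_Rintegral => y _.
by rewrite pevalX_mnm.
Qed.

End ProductBlock.

(** * Upper bounds and the harmonic constant *)

Section UpperBound.
Context (R : realType) (m : nat) (s : 'I_m -> body_kind) (n_ : 'I_m -> nat).
Local Notation n := (\sum_i n_ i)%N.
Local Notation X := (prod_body R s n_).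
Local Notation mu := (prod_ref R s n_).
Local Notation g := (all_constraints R s n_).
Implicit Types (f p q : {mpoly R[n]}).

Let mX : measurable X. Proof. exact: measurable_prod_body. Qed.

Lemma prod_body0 : X !=set0.
Proof.
exists (assemble (fun i => [tuple 0 | _ < n_ i])) => i.
by rewrite point_block_assemble; exact: body0.
Qed.

Lemma ler_sup_norm p x : X x -> `|peval p x| <= sup_norm X p.
Proof.
move=> Xx; have [_ [C hC]] := bounded_mfun_peval_prod s p.
apply: ub_le_sup; last by exists x.
by exists C => _ [y Xy <-]; exact: hC.
Qed.

Lemma sup_norm_ge0 p : 0 <= sup_norm X p.
Proof. by have [x Xx] := prod_body0; exact: le_trans (normr_ge0 _) (ler_sup_norm p Xx). Qed.

Lemma sup_norm_le p C : (forall x, X x -> `|peval p x| <= C) -> sup_norm X p <= C.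
Proof.
move=> hC; apply: ge_sup; last by move=> _ [x Xx <-]; exact: hC.
by have [x Xx] := prod_body0; exists `|peval p x|, x.
Qed.

Lemma min_on_le f x : X x -> min_on X f <= peval f x.
Proof.
move=> Xx; apply: ge_inf; last by exists x.
exists (- sup_norm X f) => _ [y Xy <-].
by have := ler_sup_norm f Xy; rewrite ler_norml => /andP[].
Qed.

Lemma all_constraints_ge0 h x : X x -> h \in g -> 0 <= peval h x.
Proof.
move=> Xx /flattenP[_ /mapP[i _ ->] /mapP[h' h'i ->]].
by rewrite peval_poly_block; exact: constraints_ge0 (Xx i) h'i.
Qed.

Lemma preordering_ge0 r q x : preordering g r q -> X x -> 0 <= peval q x.
Proof.
move=> [sigma [hs ->]] Xx; rewrite peval_sum sumr_ge0// => J Jr.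
have [_ [t ->]] := hs J Jr; rewrite pevalM mulr_ge0//.
  by rewrite peval_sum sumr_ge0// => h _; rewrite pevalXn sqr_ge0.
rewrite /prod_constraints peval_prod prodr_ge0// => j _.
by apply: all_constraints_ge0 => //; rewrite mem_nth.
Qed.

Lemma bounded_mfun_pevalM p q : bounded_mfun X (fun x => peval p x * peval q x).
Proof. by apply: bounded_mfunM; exact: bounded_mfun_peval_prod. Qed.

Lemma min_on_le_expect f r q : preordering g r q -> \int[mu]_(x in X) peval q x = 1 ->
  min_on X f <= \int[mu]_(x in X) (peval f x * peval q x).
Proof.
move=> hq q1; rewrite -[leLHS]mulr1 -q1 -expectZ//; last exact: bounded_mfun_peval_prod.
apply: ler_expect => //.
- by apply: bounded_mfunZ; exact: bounded_mfun_peval_prod.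
- exact: bounded_mfun_pevalM.
- by move=> x Xx; rewrite ler_wpM2r ?(preordering_ge0 hq)// min_on_le.
Qed.

Hypothesis n_gt0 : forall i, (0 < n_ i)%N.

(* The infimum of a set without lower bound, or of the empty set, is a junk value:
   nonemptiness has to be established here. *)
Lemma ub_ge f r : (m <= r)%N -> min_on X f <= ub mu X g f r.
Proof.
move=> mr; apply: lb_le_inf; last by move=> _ [q [hq q1] <-]; exact: min_on_le_expect hq q1.
have [x Xx] := prod_body0.
have [q [hq q1 _]] := product_block (leqnn _) (@ler_sup_norm f) n_gt0 (ltn0Sn 0) ltr01 Xx.
exists (\int[mu]_(x in X) (peval f x * peval q x)), q => //; split=> //.
by apply: in_preorderingP; apply: in_preordering_widen hq; rewrite muln1.
Qed.

Lemma ub_le f k r t : (pdeg f <= k)%N -> (0 < r)%N -> (m * r <= t)%N ->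
  ub mu X g f t - min_on X f <=
  (\sum_i c_const (n_ i) k)%N%:R * (sup_norm X f / r%:R ^+ 2).
Proof.
move=> fk r0 rt; apply/ler_addgt0Pr => e e0.
(* The error [e] is shared between the [m] blocks and the choice of a near-minimizer. *)
pose d := e / (m.+1)%:R; have d0 : 0 < d by rewrite divr_gt0.
have [x Xx fx] : exists2 x, X x & peval f x <= min_on X f + d.
  have [x0 Xx0] := prod_body0.
  have hinf : has_inf [set peval f x | x in X].
    split; first by exists (peval f x0), x0.
    exists (min_on X f) => _ [y Xy <-]; exact: min_on_le.
  by have [_ [x Xx <-] hx] := inf_adherent d0 hinf; exists x => //; exact: ltW.
have [q [hq q1 qE]] := product_block fk (@ler_sup_norm f) n_gt0 r0 d0 Xx.
have hub : ub mu X g f t <= \int[mu]_(y in X) (peval f y * peval q y).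
  apply: ge_inf.
    by exists (min_on X f) => _ [q' [hq' q'1] <-]; exact: min_on_le_expect hq' q'1.
  by exists q => //; split=> //; apply: in_preorderingP; exact: in_preordering_widen hq.
have err : \sum_i (body_error n_ k (sup_norm X f) r i + d) =
    (\sum_i c_const (n_ i) k)%N%:R * (sup_norm X f / r%:R ^+ 2) + m%:R * d.
  rewrite big_split/= sumr_const card_ord -[d *+ m]mulr_natl natr_sum mulr_suml; congr (_ + _).
  apply: eq_bigr => i _; rewrite /body_error /c_const natrM [(2 * _)%:R]natrM !natrX; ring.
have : m%:R * d + d = e by rewrite /d -[in m.+1%:R]natr1; field; rewrite natr1.
by move: hub qE; rewrite err; lra.
Qed.

End UpperBound.

(** * Lower bound for the harmonic constant *)

Section HarmonicConstant.
Context (R : realType) (m : nat) (s : 'I_m -> body_kind) (n_ : 'I_m -> nat).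
Local Notation n := (\sum_i n_ i)%N.
Local Notation X := (prod_body R s n_).
Local Notation mu := (prod_ref R s n_).
Variable P : forall i, multinom (n_ i) -> {mpoly R[n_ i]}.
Hypothesis hP : forall i, orthonormal_basis (ref_prob R (s i) (n_ i))
  (body (s i) (n_ i)) (@P i).
Local Notation B := (prod_basis (@P)).

Let mX : measurable X. Proof. exact: measurable_prod_body. Qed.

Lemma mnm_block_inj (a b : multinom n) :
  (forall i, mnm_block i a = mnm_block i b) -> a = b.
Proof.
move=> ab; apply/mnmP => j; rewrite -[j](@tagnat.sig2K m n_).
have := congr1 (fun c : multinom _ => c (tagnat.sig2 j)) (ab (tagnat.sig1 j)).
by rewrite /= !mnmE.
Qed.

Lemma prod_basis_orthonormal a b :
  \int[mu]_(x in X) (peval (B a) x * peval (B b) x) = (a == b)%:R.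
Proof.
transitivity (\prod_i (mnm_block i a == mnm_block i b)%:R : R).
  transitivity (\int[mu]_(x in X) \prod_i (peval (P (mnm_block i a)) (point_block i x) *
      peval (P (mnm_block i b)) (point_block i x))).
    apply: eq_Rintegral => x _; rewrite !peval_prod -big_split/=.
    by apply: eq_bigr => i _; rewrite !peval_poly_block.
  rewrite (@expect_prod R m s n_ (fun i x => peval (P (mnm_block i a)) x *
      peval (P (mnm_block i b)) x)); last first.
    by move=> i; apply: bounded_mfunM; exact: bounded_mfun_peval.
  by apply: eq_bigr => i _; have [hPi _ _] := hP i; rewrite hPi.
have [<-|ab] := eqVneq a b; first by rewrite big1// => i _; rewrite eqxx.
have [i /negbTE iab] : exists i, mnm_block i a != mnm_block i b.
  apply/existsP; rewrite -[X in is_true X]negbK negb_exists; apply: contra ab.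
  move=> /forallP h; apply/eqP/mnm_block_inj => i.
  by have := h i; rewrite negbK => /eqP.
by apply/eqP/prodf_eq0; exists i => //; rewrite iab.
Qed.

Lemma expect_norm_le p q :
  `|\int[mu]_(x in X) (peval p x * peval q x)| <= sup_norm X p * sup_norm X q.
Proof.
have bd x : X x -> `|peval p x * peval q x| <= sup_norm X p * sup_norm X q.
  by move=> Xx; rewrite normrM ler_pM//; exact: ler_sup_norm.
rewrite ler_norml; apply/andP; split.
  rewrite -[leLHS](@expect_prod_cst R m s n_); apply: ler_expect => //.
  - exact: bounded_mfun_cst.
  - exact: bounded_mfun_pevalM.
  - by move=> x /bd; rewrite ler_norml => /andP[].
rewrite -[leRHS](@expect_prod_cst R m s n_); apply: ler_expect => //.
- exact: bounded_mfun_pevalM.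
- exact: bounded_mfun_cst.
- by move=> x /bd; rewrite ler_norml => /andP[].
Qed.

Lemma expect_suml (I : Type) (t : seq I) (r : pred I) (F : I -> {mpoly R[n]}) q :
  \int[mu]_(x in X) (peval (\sum_(i <- t | r i) F i) x * peval q x) =
  \sum_(i <- t | r i) \int[mu]_(x in X) (peval (F i) x * peval q x).
Proof.
elim: t => [|i t ih].
  rewrite [RHS]big_nil -[RHS](@expect_prod_cst R m s n_).
  by apply: eq_Rintegral => x _; rewrite big_nil peval0 mul0r.
rewrite [RHS]big_cons -ih; under eq_Rintegral do rewrite big_cons.
case: (r i) => //; rewrite -expectD//; try exact: bounded_mfun_pevalM.
by apply: eq_Rintegral => x _; rewrite pevalD mulrDl.
Qed.

Definition block_degrees (a : multinom n) : multinom m :=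
  Multinom [tuple mdeg (mnm_block i a) | i < m].

Lemma mdeg_block_degrees a : mdeg (block_degrees a) = mdeg a.
Proof.
by rewrite mdeg_mnm_block mdegE; apply: eq_bigr => i _; exact: mnmE.
Qed.

(** Orthonormality of the product basis recovers the coefficients; components with other block
    degrees contribute nothing, so the coefficients can later be read off the full polynomial. *)
Lemma harmonic_space_coeff j d (c : multinom n -> R) (a : multinom n) :
  d = \sum_(b : bmultinom n (mdeg j).+1 |
    [forall i, mdeg (mnm_block i b) == j i]) c b *: B b ->
  \int[mu]_(x in X) (peval d x * peval (B a) x) =
  if block_degrees a == j then c a else 0.
Proof.
move=> ->; rewrite expect_suml.
have term (b : multinom n) : \int[mu]_(x in X) (peval (c b *: B b) x * peval (B a) x) =
    c b * (b == a)%:R.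
  rewrite -prod_basis_orthonormal -expectZ//; last exact: bounded_mfun_pevalM.
  by apply: eq_Rintegral => x _; rewrite pevalZ mulrA.
transitivity (\sum_(b : bmultinom n (mdeg j).+1 |
    [forall i, mdeg (mnm_block i b) == j i]) c b * (b == a :> multinom n)%:R).
  by apply: eq_bigr => b _; exact: term.
have degP (b : multinom n) :
    [forall i, mdeg (mnm_block i b) == j i] = (block_degrees b == j).
  apply/forallP/eqP => [h|<- i]; last by rewrite mnmE.
  by apply/mnmP => i; rewrite mnmE; exact/eqP.
have [aj|aj] := eqVneq (block_degrees a) j.
  have am : (mdeg a < (mdeg j).+1)%N by rewrite -aj mdeg_block_degrees.
  rewrite (bigD1 (BMultinom am)) ?degP ?aj//= eqxx mulr1 big1 ?addr0// => b /andP[_ ba].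
  by rewrite (_ : (b == a :> multinom n) = false) ?mulr0//; apply: contraNF ba => /eqP ba;
     apply/eqP/val_inj.
rewrite big1// => b; rewrite degP => /eqP bj; rewrite (_ : (b == a :> multinom n) = false) ?mulr0//.
by apply: contraNF aj => /eqP <-; rewrite bj.
Qed.

Definition harmonic_bound k : R :=
  \sum_(t < k.+1) \sum_(a : bmultinom n t.+1) sup_norm X (B a) ^+ 2.

(** Each coefficient is the integral of [p] against a basis element, hence at most the product of
    their norms. The resulting bound is crude, but it depends on [k] alone and makes the quotients
    defining [harmonic_constant] bounded, so that their [sup] is genuine. *)
Lemma harmonic_component_le k p d j : harmonic_decomposition (@P) k p d ->
  (mdeg j <= k)%N -> sup_norm X (d j) <= sup_norm X p * harmonic_bound k.
Proof.
move=> [hd pE] jk; have [c dE] := hd j jk.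
have ca (a : multinom n) : block_degrees a = j ->
    c a = \int[mu]_(x in X) (peval p x * peval (B a) x).
  move=> aj; rewrite pE expect_suml.
  have jk' : (mdeg j < k.+1)%N by [].
  rewrite (bigD1 (BMultinom jk'))//= (harmonic_space_coeff a dE) aj eqxx big1 ?addr0//.
  move=> j' jj'; have [c' dE'] : harmonic_space (@P) j' (d j').
    by apply: hd; rewrite -ltnS; exact: bmdeg.
  rewrite (harmonic_space_coeff a dE') aj ifF//.
  by apply: contraNF jj' => /eqP jE; apply/eqP/val_inj.
apply: sup_norm_le => x Xx; rewrite dE peval_sum.
apply: (le_trans (ler_norm_sum _ _ _)).
apply: (@le_trans _ _ (\sum_(a : bmultinom n (mdeg j).+1)
    sup_norm X p * sup_norm X (B a) ^+ 2)).
  rewrite big_mkcond/=; apply: ler_sum => a _; case: ifP => [/forallP aj|_]; last first.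
    by rewrite mulr_ge0 ?sup_norm_ge0 ?sqr_ge0.
  rewrite pevalZ normrM expr2 mulrA ler_pM//; last exact: ler_sup_norm.
  rewrite ca; first exact: expect_norm_le.
  by apply/mnmP => i; rewrite mnmE; exact/eqP/aj.
rewrite -mulr_sumr ler_wpM2l ?sup_norm_ge0//.
have jk' : (mdeg j < k.+1)%N by [].
rewrite /harmonic_bound (bigD1 (Ordinal jk'))//= lerDl sumr_ge0// => t _.
by rewrite sumr_ge0// => a _; rewrite sqr_ge0.
Qed.

(** The witness is the basis element of index 0: it has degree 0, is nonzero since its square has
    integral 1, and is its own component in degree 0, so the quotient 1 occurs. *)
Lemma harmonic_constant_ge1 k : 1 <= harmonic_constant s (@P) k.
Proof.
pose a0 : multinom n := mnm0; pose p := B a0.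
have blk i : mnm_block i a0 = mnm0.
  by apply/mnmP => j; rewrite !mnmE.
have p1 : \int[mu]_(x in X) (peval p x * peval p x) = 1.
  by rewrite prod_basis_orthonormal eqxx.
have p0 : sup_norm X p != 0.
  apply/negP => /eqP p0; have := expect_norm_le p p.
  by rewrite p1 p0 mul0r normr1 ler10.
have pne : p != 0.
  apply: contra_neq p0 => ->; apply/le_anti; rewrite sup_norm_ge0 andbT.
  by apply: sup_norm_le => x _; rewrite peval0 normr0.
apply: ub_le_sup; last first.
  pose d (j : multinom m) : {mpoly R[n]} := if j == mnm0 then p else 0.
  exists p, d, mnm0; rewrite /d; split=> //.
  - apply: leq_trans (leq0n k); apply: pdeg_prod_le0 => i.
    have := @pdeg_comp_mpoly_le R _ _
      [tuple mpolyX R (mnm1 (tagnat.Rank i j)) | j < n_ i] 1 (P (mnm_block i a0)).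
    have [_ hdeg _] := hP i; rewrite hdeg blk mdeg0 mul0n; apply=> j.
    by rewrite tnth_mktuple pdeg_mpolyX mdeg1.
  - split=> [j _|].
      case: eqP => [->|_]; last first.
        by exists (fun=> 0); apply/esym; apply: big1 => a _; exact: scale0r.
      exists (fun=> 1).
      have am : (mdeg a0 < (mdeg (mnm0 : multinom m)).+1)%N by rewrite !mdeg0.
      rewrite (bigD1 (BMultinom am))/=; last first.
        by apply/forallP => i; rewrite blk mdeg0 mnm0E.
      rewrite scale1r -[LHS]addr0; congr (_ + _); apply/esym; apply: big1 => a /andP[_ aa0].
      case/eqP: aa0; apply/val_inj => /=.
      have ha : (mdeg a <= mdeg (mnm0 : multinom m))%N by rewrite -ltnS; exact: bmdeg.
      by apply/eqP; rewrite -mdeg_eq0 -leqn0 (leq_trans ha)// mdeg0.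
    have m0 : (mdeg (mnm0 : multinom m) < k.+1)%N by rewrite mdeg0.
    rewrite (bigD1 (BMultinom m0))//= eqxx -[LHS]addr0; congr (_ + _).
    apply/esym; apply: big1 => j jm0.
    by rewrite ifF//; apply: contraNF jm0 => /eqP jE; apply/eqP/val_inj.
  - by rewrite mdeg0.
  - by rewrite eqxx divff.
exists (harmonic_bound k) => _ [q [d [j [_ _ hd jk ->]]]].
have K0 : 0 <= harmonic_bound k.
  by rewrite !sumr_ge0// => t _; rewrite sumr_ge0// => a _; rewrite sqr_ge0.
(* A zero norm makes the quotient 0 by the convention on inverses. *)
have [q0|q0] := eqVneq (sup_norm X q) 0; first by rewrite q0 invr0 mulr0.
rewrite ler_pdivrMr; last by rewrite lt_neqAle eq_sym q0 sup_norm_ge0.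
by rewrite mulrC; exact: harmonic_component_le.
Qed.

End HarmonicConstant.

Theorem theorem3p9 (R : realType) (m : nat) (s : 'I_m -> body_kind)
    (n_ : 'I_m -> nat) (m_gt0 : (0 < m)%N) (n_gt0 : forall i, (0 < n_ i)%N) :
  let X : set ((\sum_i n_ i).-tuple R) := prod_body R s n_ in
  let mu := prod_ref R s n_ in
  let g := all_constraints R s n_ in
  [/\ (* moments *)
      forall a : multinom (\sum_i n_ i),
        moment mu X a =
        \prod_i moment (ref_prob R (s i) (n_ i)) (body (s i) (n_ i))
                  (mnm_block i a),
      (* error bound *)
      forall P : forall i, multinom (n_ i) -> {mpoly R[n_ i]},
        (forall i, orthonormal_basis (ref_prob R (s i) (n_ i))
                     (body (s i) (n_ i)) (P i)) ->
      forall (f : {mpoly R[\sum_i n_ i]}) (k : nat), pdeg f = k ->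
      forall r : nat, (2 * (\max_i n_ i).+1 * k < r)%N ->
        ub mu X g f (m * r) - min_on X f <=
        'C(k + m - 1, m - 1)%:R * (\sum_i c_const (n_ i) k)%N%:R *
        (harmonic_constant s P k * sup_norm X f / r%:R ^+ 2)
    & (* convergence rate *)
      forall f : {mpoly R[\sum_i n_ i]},
        (fun r : nat => ub mu X g f r - min_on X f) =O_\oo
        (fun r : nat => (r%:R ^+ 2)^-1 : R)].
Proof.
move=> X mu g; split.
- exact: moment_prod.
- move=> P hP f k fk r kr; have r0 : (0 < r)%N by apply: leq_trans kr.
  have fk' : (pdeg f <= k)%N by rewrite fk.
  apply: (le_trans (ub_le s n_gt0 fk' r0 (leqnn _))).
  have bin1 : (1 : R) <= 'C(k + m - 1, m - 1)%:R by rewrite ler1n bin_gt0; lia.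
  have := ler_pM ler01 ler01 bin1 (harmonic_constant_ge1 hP k).
  move: ('C(_, _)%:R) (harmonic_constant _ _ _) => b L; rewrite mul1r => bL.
  set C := (_ : nat)%:R; set S := sup_norm _ _; set D := r%:R ^+ 2.
  have CSD : 0 <= C * (S / D) by rewrite mulr_ge0 ?divr_ge0 ?sup_norm_ge0 ?sqr_ge0 ?ler0n.
  rewrite (_ : b * C * (L * S / D) = b * L * (C * (S / D))); last by ring.
  by rewrite ler_peMl.
- move=> f; apply/eqO_exP.
  pose A : R := (\sum_i c_const (n_ i) (pdeg f))%N%:R * sup_norm X f.
  have A0 : 0 <= A by rewrite mulr_ge0 ?sup_norm_ge0 ?ler0n.
  (* The summand 1 keeps the constant positive even when [A] is 0. *)
  exists (A * (2 * m)%:R ^+ 2 + 1); first by rewrite ltr_wpDl// mulr_ge0// sqr_ge0.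
  near=> r; have mr : (m <= r)%N by near: r; exact: nbhs_infty_ge.
  (* The level [r] contains the level [m * (r %/ m)], and the rounded quotient is at least [r]
     divided by [2 * m]; this accounts for the factor [(2 * m)%:R ^+ 2]. *)
  have d0 : (0 < r %/ m)%N by rewrite divn_gt0.
  have dr : (m * (r %/ m) <= r)%N by rewrite mulnC leq_trunc_div.
  have rd : (r <= 2 * m * (r %/ m))%N.
    by have := ltn_ceil r m_gt0; nia.
  rewrite ger0_norm ?subr_ge0; last exact: ub_ge.
  rewrite ger0_norm ?invr_ge0 ?sqr_ge0//.
  apply: (le_trans (ub_le s n_gt0 (leqnn _) d0 dr)).
  have r0 : 0 < (r%:R : R) ^+ 2 by rewrite exprn_gt0 ?ltr0n ?(leq_trans m_gt0).
  rewrite ler_pdivlMr// mulrA -/A.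
  apply: (@le_trans _ _ (A * (2 * m)%:R ^+ 2)); last by rewrite lerDl.
  rewrite -mulrA ler_wpM2l// mulrC ler_pdivrMr ?exprn_gt0 ?ltr0n//.
  by rewrite -exprMn -natrM ler_pXn2r ?nnegrE ?ler0n// ler_nat.
Unshelve. all: by end_near.
Qed.
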